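(* Let $\mathcal{A}$ be the Hopf algebra of regular functions on a linear algebraic group $G$ whose category of finite-dimensional representations is semisimple. Let $(\mathcal{E},d)$ be the classical bicovariant differential calculus on $\mathcal{A}$ and $\Omega$ a normalised dual $2$-cocycle on $\mathcal{A}$. If $g'$ is a bi-invariant pseudo-Riemannian metric on the bicovariant differential calculus $(\mathcal{E}_\Omega,d_\Omega)$ over the Hopf algebra $\mathcal{A}_\Omega$, then there exists a unique bicovariant Levi-Civita connection for the triple $(\mathcal{E}_\Omega,d_\Omega,g')$.
   Context: The classical bicovariant differential calculus on $\mathcal{A}=\mathcal{O}(G)$ ($G$ over $\mathbb{C}$) is the module $\Omega^1(\mathcal{A})$ of (algebraic) differential one-forms on $G$ with left and right actions equal, together with the usual exterior derivative $d$. Cocycle deformation. All vector spaces are over $\mathbb{C}$. $\mathcal{A}$ has coproduct $\Delta$, counit $\epsilon$; Sweedler notation $\Delta(a)=a_{(1)}\otimes a_{(2)}$, left coactions $m\mapsto m_{(-1)}\otimes m_{(0)}$, right coactions $m\mapsto m_{(0)}\otimes m_{(1)}$. Let $\widehat{\mathcal{A}}$ be the restricted dual Hopf algebra of $\mathcal{A}$. A normalised dual $2$-cocycle is an invertible $\Omega=\sum_ih_i\otimes k_i\in\widehat{\mathcal{A}}\otimes\widehat{\mathcal{A}}$ with $(\widehat\epsilon\otimes\mathrm{id})(\Omega)=1=(\mathrm{id}\otimes\widehat\epsilon)(\Omega)$ and $(\Omega\otimes1)[(\widehat\Delta\otimes\mathrm{id})(\Omega)]=(1\otimes\Omega)[(\mathrm{id}\otimes\widehat\Delta)(\Omega)]$.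 Put $\gamma(a\otimes b)=\sum_ih_i(a)k_i(b)$, with convolution inverse $\overline\gamma$. $\mathcal{A}_\Omega$ is $\mathcal{A}$ with the same coproduct and product $a*_\Omega b=\gamma(a_{(1)}\otimes b_{(1)})a_{(2)}b_{(2)}\overline\gamma(a_{(3)}\otimes b_{(3)})$. For a bicovariant $\mathcal{A}$-bimodule $M$, $M_\Omega$ is the bicovariant $\mathcal{A}_\Omega$-bimodule with the same space and coactions and actions $a*_\Omega m=\gamma(a_{(1)}\otimes m_{(-1)})a_{(2)}m_{(0)}\overline\gamma(a_{(3)}\otimes m_{(1)})$, $m*_\Omega a=\gamma(m_{(-1)}\otimes a_{(1)})m_{(0)}a_{(2)}\overline\gamma(m_{(1)}\otimes a_{(3)})$. $(\mathcal{E}_\Omega,d_\Omega)$, with $d_\Omega=d$ as a linear map, is a bicovariant differential calculus over $\mathcal{A}_\Omega$; its canonical braiding satisfies $\sigma_\Omega^2=1$, so ${}_0(\sigma_\Omega)$ is diagonalisable. The following notions, written for a bicovariant calculus $(\mathcal{E},d)$ over a Hopf algebra $\mathcal{A}$ with finite-dimensional ${}_0\mathcal{E}$, $\mathcal{E}_0$, are applied to $(\mathcal{E}_\Omega,d_\Omega)$ over $\mathcal{A}_\Omega$. Bimodules. A left-covariant bimodule is a bimodule $M$ with a left comodule coaction $\Delta_M:M\to\mathcal{A}\otimes M$ such that $\Delta_M(am)=\Delta(a)\Delta_M(m)$, $\Delta_M(ma)=\Delta_M(m)\Delta(a)$; right-covariant bimodules are defined in the same way with ${}_M\Delta:M\to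 M\otimes\mathcal{A}$; bicovariant means both, with $(\mathrm{id}\otimes{}_M\Delta)\Delta_M=(\Delta_M\otimes\mathrm{id}){}_M\Delta$. A linear map is left-covariant (right-covariant, bicovariant) if it intertwines the left (right, both) coactions. ${}_0M$, $M_0$ are the left-, right-coinvariants. $M\otimes_{\mathcal{A}}N$ carries the diagonal coactions; multiplication ${}_0M\otimes_{\mathbb{C}}\mathcal{A}\to M$ is an isomorphism and ${}_0(M\otimes_{\mathcal{A}}N)={}_0M\otimes_{\mathbb{C}}{}_0N$ (recalled facts). Calculi. A first order differential calculus is a bimodule $\mathcal{E}$ with a linear derivation $d:\mathcal{A}\to\mathcal{E}$ such that every element of $\mathcal{E}$ is of the form $\sum a_kdb_k$; it is bicovariant if $\sum_ka_kdb_k=0$ implies $\sum_k\Delta(a_k)(\mathrm{id}\otimes d)\Delta(b_k)=0$ and $\sum_k\Delta(a_k)(d\otimes\mathrm{id})\Delta(b_k)=0$; then $\mathcal{E}$ is a bicovariant bimodule with $\Delta_{\mathcal{E}}d=(\mathrm{id}\otimes d)\Delta$, ${}_{\mathcal{E}}\Delta d=(d\otimes\mathrm{id})\Delta$. The canonical braiding $\sigma$ is the unique bimodule endomorphism of $\mathcal{E}\otimes_{\mathcal{A}}\mathcal{E}$ with $\sigma(\omega\otimes\eta)=\eta\otimes\omega$ for $\omega\in{}_0\mathcal{E}$, $\eta\in\mathcal{E}_0$; ${}_0\sigma$ is its restriction to ${}_0\mathcal{E}\otimes_{\mathbb{C}}{}_0\mathcal{E}$. $\Omega^2(\mathcal{A})=(\mathcal{E}\otimes_{\mathcal{A}}\mathcal{E})/\mathrm{Ker}(\sigma-1)$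 with quotient map $\wedge$; $d:\mathcal{E}\to\Omega^2(\mathcal{A})$ is $d(\sum a_kdb_k)=\sum da_k\wedge db_k$. ${}_0P_{\mathrm{sym}}$ is the idempotent on ${}_0\mathcal{E}\otimes_{\mathbb{C}}{}_0\mathcal{E}$ with range $\mathrm{Ker}({}_0\sigma-1)$ and kernel the sum of the eigenspaces of ${}_0\sigma$ for eigenvalues $\neq1$. Metrics and connections. A pseudo-Riemannian metric is a right $\mathcal{A}$-linear map $g:\mathcal{E}\otimes_{\mathcal{A}}\mathcal{E}\to\mathcal{A}$ with $g\circ\sigma=g$ and such that $g(\rho\otimes\nu)=0$ for all $\nu$ implies $\rho=0$. It is bi-invariant if $(\mathrm{id}\otimes\epsilon g)\Delta_{\mathcal{E}\otimes_{\mathcal{A}}\mathcal{E}}=g$ and $(\epsilon g\otimes\mathrm{id}){}_{\mathcal{E}\otimes_{\mathcal{A}}\mathcal{E}}\Delta=g$. A (right) connection is a linear $\nabla:\mathcal{E}\to\mathcal{E}\otimes_{\mathcal{A}}\mathcal{E}$ with $\nabla(\rho a)=\nabla(\rho)a+\rho\otimes da$; it is torsionless if $\wedge\circ\nabla+d=0$ on $\mathcal{E}$; left-covariant/bicovariant if it is so as a map. For left-covariant $\nabla$ define $\widetilde{\Pi^0_g}(\nabla)=2(\mathrm{id}\otimes g)(\sigma\otimes\mathrm{id})(\nabla\otimes\mathrm{id}){}_0P_{\mathrm{sym}}:{}_0\mathcal{E}\otimes_{\mathbb{C}}{}_0\mathcal{E}\to{}_0\mathcal{E}$ and $\widetilde{\Pi_g}(\nabla)(\omega_1\otimes\omega_2a)=\widetilde{\Pi^0_g}(\nabla)(\omega_1\otimes\omega_2)a+g(\omega_1\otimes\omega_2)da$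 for $\omega_i\in{}_0\mathcal{E}$, $a\in\mathcal{A}$. $\nabla$ is compatible with $g$ if $\widetilde{\Pi_g}(\nabla)=dg$, where $dg(e\otimes f)=d(g(e\otimes f))$. A Levi-Civita connection for $(\mathcal{E},d,g)$ is a left-covariant connection that is torsionless and compatible with $g$. *)

(* Defs.v *)
From HB Require Import structures.
From mathcomp Require Import all_boot all_order all_algebra.
From mathcomp Require Import generic_quotient.
From mathcomp Require Import boolp classical_sets functions reals.
From mathcomp Require Import complex.
From mathcomp Require Import finmap monalg mpoly.

Set Implicit Arguments.
Unset Strict Implicit.
Unset Printing Implicit Defensive.

Import GRing.Theory.
Local Open Scope ring_scope.
Local Open Scope quotient_scope.
Local Open Scope classical_set_scope.

(* Definite description.  Every object described below is unique, and it exists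
   for the coordinate Hopf algebra of a linear algebraic group, its Kähler
   differentials and their cocycle deformations (these are theorems).  [x0] is
   only a default value that makes [the] total. *)
Definition the (T : Type) (x0 : T) (P : T -> Prop) : T :=
  if pselect (exists x, P x) is left h then projT1 (cid h) else x0.

Lemma theP (T : Type) (x0 : T) (P : T -> Prop) :
  (exists x, P x) -> P (the x0 P).
Proof. by rewrite /the => h; case: pselect => // h'; case: (cid h'). Qed.

Section Span.
Variables (K : fieldType) (V : lmodType K) (W : set V).

Inductive span : set V :=
| span0 : span 0
| span_cons c w x : W w -> span x -> span (c *: w + x).

Lemma span_gen w : W w -> span w.
Proof. by move=> Ww; rewrite -[w]addr0 -[w]scale1r; apply: span_cons span0. Qed.

Lemma spanD x y : span x -> span y -> span (x + y).
Proof.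
elim=> [|c w {}x Ww _ IH] hy; first by rewrite add0r.
by rewrite -addrA; apply: span_cons => //; apply: IH.
Qed.

Lemma spanZ a x : span x -> span (a *: x).
Proof.
elim=> [|c w {}x Ww _ IH]; first by rewrite scaler0; exact: span0.
by rewrite scalerDr scalerA; apply: span_cons.
Qed.

Lemma spanN x : span x -> span (- x).
Proof. by rewrite -scaleN1r; apply: spanZ. Qed.

Definition span_rel : rel V := fun x y => `[< span (x - y) >].

Lemma span_rel_equiv : equiv_class_of span_rel.
Proof.
split=> [x|x y|y x z].
- by apply/asboolP; rewrite subrr; exact: span0.
- by apply/asboolP/asboolP => /spanN; rewrite opprB.
- move=> /asboolP xy /asboolP yz; apply/asboolP.
  by rewrite -(subrKA y); apply: spanD.
Qed.

Canonical span_equiv := EquivRelPack span_rel_equiv.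

Definition quot := {eq_quot span_equiv}.
HB.instance Definition _ := Choice.on quot.
HB.instance Definition _ := EqQuotient.on quot.

Definition qpi (x : V) : quot := \pi_quot x.

Lemma qpiE x y : (qpi x = qpi y) <-> span (x - y).
Proof.
split; first by move=> /eqmodP /asboolP.
by move=> h; apply/eqmodP/asboolP.
Qed.

Lemma qpi_eq w x y : W w -> x - y = w -> qpi x = qpi y.
Proof. by move=> Ww xyw; apply/qpiE; rewrite xyw; apply: span_gen. Qed.

Lemma qpi_repr (q : quot) : qpi (repr q) = q.
Proof. exact: reprK. Qed.

Lemma span_repr x : span (repr (qpi x) - x).
Proof. by apply/qpiE; rewrite qpi_repr. Qed.

Definition qadd (p q : quot) : quot := qpi (repr p + repr q).
Definition qopp (p : quot) : quot := qpi (- repr p).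
Definition qscale (c : K) (p : quot) : quot := qpi (c *: repr p).

Lemma qaddE x y : qadd (qpi x) (qpi y) = qpi (x + y).
Proof.
apply/qpiE; rewrite opprD addrACA.
by apply: spanD; apply: span_repr.
Qed.

Lemma qoppE x : qopp (qpi x) = qpi (- x).
Proof. by apply/qpiE; rewrite -opprD; apply: spanN; apply: span_repr. Qed.

Lemma qscaleE c x : qscale c (qpi x) = qpi (c *: x).
Proof. by apply/qpiE; rewrite -scalerBr; apply: spanZ; apply: span_repr. Qed.

Lemma quot_ind (P : quot -> Prop) : (forall x, P (qpi x)) -> forall q, P q.
Proof. by move=> h q; rewrite -[q]qpi_repr. Qed.

Fact qaddA : associative qadd.
Proof.
elim/quot_ind=> x; elim/quot_ind=> y; elim/quot_ind=> z.
by rewrite !qaddE addrA.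
Qed.

Fact qaddC : commutative qadd.
Proof.
by elim/quot_ind=> x; elim/quot_ind=> y; rewrite !qaddE addrC.
Qed.

Fact qadd0 : left_id (qpi 0) qadd.
Proof. by elim/quot_ind=> x; rewrite qaddE add0r. Qed.

Fact qaddN : left_inverse (qpi 0) qopp qadd.
Proof. by elim/quot_ind=> x; rewrite qoppE qaddE addNr. Qed.

HB.instance Definition _ := GRing.isZmodule.Build quot qaddA qaddC qadd0 qaddN.

Fact qscaleA a b (q : quot) : qscale a (qscale b q) = qscale (a * b) q.
Proof. by elim/quot_ind: q => x; rewrite !qscaleE scalerA. Qed.

Fact qscale1 : left_id 1 qscale.
Proof. by elim/quot_ind=> x; rewrite qscaleE scale1r. Qed.

Fact qscaleDr : right_distributive qscale qadd.
Proof.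
move=> a; elim/quot_ind=> x; elim/quot_ind=> y.
by rewrite qaddE !qscaleE qaddE scalerDr.
Qed.

Fact qscaleDl q a b : qscale (a + b) q = qadd (qscale a q) (qscale b q).
Proof. by elim/quot_ind: q => x; rewrite !qscaleE qaddE scalerDl. Qed.

HB.instance Definition _ := GRing.Zmodule_isLmodule.Build K quot
  qscaleA qscale1 qscaleDr qscaleDl.

Fact qpi_linear : linear qpi.
Proof. by move=> a x y; rewrite -qaddE -qscaleE. Qed.

HB.instance Definition _ := GRing.isLinear.Build K V quot _ qpi qpi_linear.

End Span.

Section LinExt.
Variables (K : fieldType) (X Y : Type) (T P : lmodType K).

(* The linear map on [T] prescribed by its values [f x y] on a spanning family
   [gen x y]; it is meant for families [f] compatible with the relations
   between the [gen x y]. *)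
Definition lin_ext (gen : X -> Y -> T) (f : X -> Y -> P) : {linear T -> P} :=
  @the {linear T -> P} \0 (fun L => forall x y, L (gen x y) = f x y).

Lemma lin_extE gen f x y :
  (exists L : {linear T -> P}, forall x y, L (gen x y) = f x y) ->
  lin_ext gen f (gen x y) = f x y.
Proof. by move=> h; rewrite /lin_ext (theP _ h). Qed.

End LinExt.

Section Tensor.
Variables (K : fieldType) (U V : lmodType K).

Definition fpair (u : U) (v : V) : {malg K[(U * V)%type]} := << (u, v) >>.

Inductive tens_rel : set {malg K[(U * V)%type]} :=
| tens_relDl u u' v : tens_rel (fpair (u + u') v - (fpair u v + fpair u' v))
| tens_relDr u v v' : tens_rel (fpair u (v + v') - (fpair u v + fpair u v'))
| tens_relZl c u v : tens_rel (fpair (c *: u) v - c *: fpair u v)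
| tens_relZr c u v : tens_rel (fpair u (c *: v) - c *: fpair u v).

Definition tens : lmodType K := quot tens_rel.

Definition tpure (u : U) (v : V) : tens := qpi tens_rel (fpair u v).

Lemma tpureDl u u' v : tpure (u + u') v = tpure u v + tpure u' v.
Proof. exact: etrans (qpi_eq (tens_relDl _ _ _) (erefl _)) (linearD _ _ _). Qed.

Lemma tpureDr u v v' : tpure u (v + v') = tpure u v + tpure u v'.
Proof. exact: etrans (qpi_eq (tens_relDr _ _ _) (erefl _)) (linearD _ _ _). Qed.

Lemma tpureZl c u v : tpure (c *: u) v = c *: tpure u v.
Proof. exact: etrans (qpi_eq (tens_relZl _ _ _) (erefl _)) (linearZ _ _). Qed.

Lemma tpureZr c u v : tpure u (c *: v) = c *: tpure u v.
Proof. exact: etrans (qpi_eq (tens_relZr _ _ _) (erefl _)) (linearZ _ _). Qed.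

End Tensor.

Notation "u ⊗ v" := (tpure u v) (at level 40, left associativity) : ring_scope.

Definition tlift (K : fieldType) (U V P : lmodType K) (f : U -> V -> P) :
  {linear tens U V -> P} := lin_ext (@tpure K U V) f.

Lemma quot_lift_ex (K : fieldType) (V P : lmodType K) (W : set V)
    (f : {linear V -> P}) : (forall w, W w -> f w = 0) ->
  exists L : {linear quot W -> P}, forall x, L (qpi W x) = f x.
Proof.
move=> fW; have f0 x : span W x -> f x = 0.
  by elim=> [|c w y /fW fw _ fy]; rewrite ?linear0 // linearP fw fy scaler0 addr0.
have fE x : f (repr (qpi W x)) = f x.
  by apply/eqP; rewrite -subr_eq0 -linearB; apply/eqP/f0/span_repr.
have Llin : linear (fun q : quot W => f (repr q)).
  move=> a p q; rewrite -[p]qpi_repr -[q]qpi_repr -[_ + _]linearP !fE.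
  by rewrite linearP.
pose L : {linear quot W -> P} :=
  HB.pack (fun q : quot W => f (repr q)) (GRing.isLinear.Build _ _ _ _ _ Llin).
by exists L.
Qed.

Lemma tliftE (K : fieldType) (U V P : lmodType K) (f : U -> V -> P) u v :
  bilinear_for *:%R *:%R f -> tlift f (u ⊗ v) = f u v.
Proof.
move=> [fl fr]; apply: lin_extE.
pose F (g : {malg K[(U * V)%type]}) : P := \sum_(k <- monalg.msupp g) monalg.mcoeff k g *: f k.1 k.2.
have FE (d : {fset (U * V)%type}) g : (monalg.msupp g `<=` d)%fset ->
    F g = \sum_(k <- d) monalg.mcoeff k g *: f k.1 k.2.
  move=> sgd; rewrite /F (big_fset_incl _ sgd) // => k _ kg.
  by rewrite monalg.mcoeff_outdom // scale0r.
have Flin : linear F.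
  move=> a g h; pose d := (monalg.msupp g `|` monalg.msupp h `|` monalg.msupp (a *: g + h))%fset.
  rewrite !(FE d); try by apply/fsubsetP => k; rewrite !inE => ->; rewrite ?orbT.
  rewrite scaler_sumr -big_split; apply: eq_bigr => k _ /=.
  by rewrite monalg.mcoeffD monalg.mcoeffZ scalerDl scalerA.
pose L : {linear {malg K[(U * V)%type]} -> P} :=
  HB.pack F (GRing.isLinear.Build _ _ _ _ _ Flin).
have FU a b : L (fpair a b) = f a b.
  by rewrite /= /F /fpair monalg.msuppU oner_eq0 big_seq_fset1 monalg.mcoeffUU scale1r.
have [w|L' L'E] := @quot_lift_ex _ _ _ (@tens_rel K U V) L.
  case=> [a a' b|a b b'|c a b|c a b].
  - have := fl b 1 a a'; rewrite linearB linearD !FU scale1r => ->.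
    by rewrite /= scale1r subrr.
  - have := fr a 1 b b'; rewrite linearB linearD !FU scale1r => ->.
    by rewrite /= scale1r subrr.
  - have fl0 : f 0 b = 0.
      by have := fl b (-1) 0 0; rewrite addr0 scaler0 /= scaleN1r addNr.
    have := fl b c a 0; rewrite linearB linearZ !FU !addr0 fl0 addr0 => ->.
    by rewrite /= subrr.
  - have fr0 : f a 0 = 0.
      by have := fr a (-1) 0 0; rewrite addr0 scaler0 /= scaleN1r addNr.
    have := fr a c b 0; rewrite linearB linearZ !FU !addr0 fr0 addr0 => ->.
    by rewrite /= subrr.
by exists L' => a b; rewrite L'E FU.
Qed.

Definition tmap (K : fieldType) (U V U' V' : lmodType K)
    (f : U -> U') (g : V -> V') : {linear tens U V -> tens U' V'} :=
  tlift (fun u v => f u ⊗ g v).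

Definition tassoc (K : fieldType) (U V W : lmodType K) :
    {linear tens (tens U V) W -> tens U (tens V W)} :=
  tlift (fun t w => tlift (fun u v => u ⊗ (v ⊗ w)) t).

(* These records only carry the structure maps; they are applied to coordinate
   algebras, their restricted duals and their cocycle deformations, for which
   the Hopf algebra and bimodule axioms are theorems.  The antipode is omitted
   because no definition below refers to it. *)

Record hopfData (K : fieldType) := HopfData {
  hcar :> lmodType K;
  hmul : hcar -> hcar -> hcar;
  hone : hcar;
  hcomul : {linear hcar -> tens hcar hcar};
  hcounit : {linear hcar -> K^o}
}.

Record bimodData (K : fieldType) (A : hopfData K) := BimodData {
  mcar :> lmodType K;
  lact : A -> mcar -> mcar;
  ract : mcar -> A -> mcar;
  lco : {linear mcar -> tens A mcar};
  rco : {linear mcar -> tens mcar A}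
}.

Record calculus (K : fieldType) (A : hopfData K) := Calculus {
  cmod :> bimodData A;
  cd : {linear A -> cmod}
}.

Section RestrictedDual.
Variables (K : fieldType) (A : hopfData K).

(* The restricted (finite) dual of [A] consists of the linear functionals [h]
   for which [(a, b) |-> h (a b)] lies in the algebraic tensor product of the
   full linear dual of [A] with itself. *)
Definition representative (h : A -> K^o) : Prop :=
  linear h /\
  exists s : seq ({linear A -> K^o} * {linear A -> K^o}),
    forall a b, h (hmul a b) = \sum_(p <- s) p.1 a * p.2 b.

Definition rdual_pred : {pred (A -> K^o)} := fun h => `[< representative h >].

Fact rdual_submod : submod_closed rdual_pred.
Proof.
split.
  apply/asboolP; split=> [c a b|]; first by rewrite /= scaler0 addr0.
  by exists [::] => a b; rewrite big_nil.
move=> c g h /asboolP[lg [s gs]] /asboolP[lh [t ht]]; apply/asboolP; split.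
  move=> k a b; rewrite /= !fctE lg lh; rewrite !scalerDr !scalerA.
  by rewrite [c * k]mulrC addrACA.
pose sc (p : {linear A -> K^o} * {linear A -> K^o}) :=
  ((c \*: p.1 : {linear A -> K^o}), p.2).
exists (map sc s ++ t) => a b.
rewrite big_cat big_map /= fctE -ht; congr (_ + _).
transitivity (c *: g (hmul a b)); first by [].
rewrite gs scaler_sumr.
by apply: eq_bigr => p _; rewrite /= -scalerAl.
Qed.

HB.instance Definition _ := GRing.isSubmodClosed.Build K (A -> K^o) rdual_pred
  rdual_submod.

Record rdual_type := RDual { rdual_fun :> A -> K^o; _ : rdual_fun \in rdual_pred }.
HB.instance Definition _ := [isSub for rdual_fun].
HB.instance Definition _ := [Choice of rdual_type by <:].
HB.instance Definition _ := [SubChoice_isSubLmodule of rdual_type by <:].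

Let ev2 (t : tens rdual_type rdual_type) (a b : A) : K^o :=
  tlift (fun h k : rdual_type => (h a * k b : K^o)) t.

Definition rdual_mul (h k : rdual_type) : rdual_type :=
  insubd (0 : rdual_type)
    (fun a => tlift (fun x y : A => (h x * k y : K^o)) (hcomul A a)).

Definition rdual_one : rdual_type := insubd (0 : rdual_type) (hcounit A).

Definition rdual_comul : {linear rdual_type -> tens rdual_type rdual_type} :=
  @the {linear rdual_type -> tens rdual_type rdual_type} \0
    (fun L => forall h a b, ev2 (L h) a b = h (hmul a b)).

Fact rdual_counit_linear : linear (fun h : rdual_type => h (hone A)).
Proof. by []. Qed.

Definition rdual_counit : {linear rdual_type -> K^o} :=
  HB.pack (fun h : rdual_type => h (hone A))
    (GRing.isLinear.Build _ _ _ _ _ rdual_counit_linear).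

Definition rdual : hopfData K :=
  @HopfData K rdual_type rdual_mul rdual_one rdual_comul rdual_counit.

End RestrictedDual.

Section Cocycle.
Variables (K : fieldType) (A : hopfData K).

Definition tmul2 (H : hopfData K) (s t : tens H H) : tens H H :=
  tlift (fun a b => tlift (fun a' b' => hmul a a' ⊗ hmul b b') t) s.

Definition tmul3 (H : hopfData K) (s t : tens H (tens H H)) :
    tens H (tens H H) :=
  tlift (fun a u => tlift (fun a' u' => hmul a a' ⊗ tmul2 u u') t) s.

Definition dual_2cocycle (H := rdual A) (Om : tens H H) : Prop :=
  tmul3 (tassoc H H H (Om ⊗ hone H)) (tassoc H H H (tmap (hcomul H) id Om))
  = tmul3 (hone H ⊗ Om) (tmap id (hcomul H) Om).

Definition normalised (H := rdual A) (Om : tens H H) : Prop :=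
  tlift (fun h k : H => hcounit H h *: k) Om = hone H
  /\ tlift (fun h k : H => hcounit H k *: h) Om = hone H.

Definition tinvertible (H : hopfData K) (Om : tens H H) : Prop :=
  exists Om', tmul2 Om Om' = hone H ⊗ hone H /\ tmul2 Om' Om = hone H ⊗ hone H.

Definition normalised_dual_2cocycle (Om : tens (rdual A) (rdual A)) : Prop :=
  [/\ tinvertible Om, normalised Om & dual_2cocycle Om].

Definition cocycle_pairing (Om : tens (rdual A) (rdual A)) :
    {linear tens A A -> K^o} :=
  tlift (fun a b => tlift (fun h k : rdual A => (h a * k b : K^o)) Om).

Definition convolution (f g : tens A A -> K^o) (a b : A) : K^o :=
  tlift (fun a1 a2 => tlift (fun b1 b2 => (f (a1 ⊗ b1) * g (a2 ⊗ b2) : K^o))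
    (hcomul A b)) (hcomul A a).

Definition convolution_inverse (f : tens A A -> K^o) :
    {linear tens A A -> K^o} :=
  @the {linear tens A A -> K^o} \0 (fun g => forall a b,
    convolution f g a b = hcounit A a * hcounit A b /\
    convolution g f a b = hcounit A a * hcounit A b).

Variable Om : tens (rdual A) (rdual A).
Let gam := cocycle_pairing Om.
Let gambar := convolution_inverse gam.

(* [sum gam (x_1, y_1) op x_2 y_2 gambar (x_3, y_3)] for
   [tx = sum x_1 ⊗ (x_2 ⊗ x_3)] and [ty = sum y_1 ⊗ (y_2 ⊗ y_3)]. *)
Definition twist_op (X Y Z : lmodType K) (op : X -> Y -> Z)
    (tx : tens A (tens X A)) (ty : tens A (tens Y A)) : Z :=
  tlift (fun x1 tx' => tlift (fun x2 x3 =>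
    tlift (fun y1 ty' => tlift (fun y2 y3 =>
      (gam (x1 ⊗ y1) * gambar (x3 ⊗ y3)) *: op x2 y2) ty') ty) tx') tx.

Definition hcomul3 (a : A) : tens A (tens A A) :=
  tmap id (hcomul A) (hcomul A a).

Definition bico (M : bimodData A) (m : M) : tens A (tens M A) :=
  tmap id (rco M) (lco M m).

Definition deform_hopf : hopfData K :=
  @HopfData K A (fun a b => twist_op (@hmul _ A) (hcomul3 a) (hcomul3 b))
    (hone A) (hcomul A) (hcounit A).

Definition deform_bimod (M : bimodData A) : bimodData deform_hopf :=
  @BimodData K deform_hopf M
    (fun a m => twist_op (@lact _ _ M) (hcomul3 a) (bico m))
    (fun m a => twist_op (@ract _ _ M) (bico m) (hcomul3 a))
    (lco M) (rco M).

Definition deform_calculus (E : calculus A) : calculus deform_hopf :=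
  @Calculus K deform_hopf (deform_bimod E) (cd E).

End Cocycle.

Section AlgebraicGroup.
Variables (K : fieldType) (n : nat).

(* Coordinates of the closed embedding of GL_n in the affine space of
   dimension n^2 + 1: the matrix entries and the inverse determinant. *)
Definition gl_coord (x : 'M[K]_n) (k : 'I_(n * n + 1)) : K :=
  row_mx (mxvec x) ((\det x)^-1)%:M 0 k.

Definition gl_eval (p : mpoly.mpoly (n * n + 1) K) (x : 'M[K]_n) : K :=
  meval (gl_coord x) p.

Record linAlgGroup := LinAlgGroup {
  lag_set : set 'M[K]_n;
  lag_closed : exists S : set (mpoly.mpoly (n * n + 1) K),
    lag_set = [set x | x \in unitmx /\ forall p, S p -> gl_eval p x = 0];
  lag1 : lag_set 1%:M;
  lagM : forall x y, lag_set x -> lag_set y -> lag_set (x *m y);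
  lagV : forall x, lag_set x -> lag_set (invmx x)
}.

Variable G : linAlgGroup.

Definition point : Type := {x : 'M[K]_n | lag_set G x}.
Definition point1 : point := exist _ 1%:M (lag1 G).
Definition pointM (x y : point) : point :=
  exist _ (sval x *m sval y) (lagM (svalP x) (svalP y)).

Definition regular (f : point -> K) : Prop :=
  exists p : mpoly.mpoly (n * n + 1) K, forall x, f x = gl_eval p (sval x).

Definition regular_pred : {pred (point -> K^o)} := fun f => `[< regular f >].

Fact regular_submod : submod_closed regular_pred.
Proof.
split; first by apply/asboolP; exists 0 => x; rewrite /gl_eval meval0.
move=> c f g /asboolP[p fp] /asboolP[q gq]; apply/asboolP.
exists (c *: p + q) => x.
by rewrite /gl_eval mevalD mevalZ -!/(gl_eval _ _) -fp -gq.
Qed.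

HB.instance Definition _ := GRing.isSubmodClosed.Build K (point -> K^o)
  regular_pred regular_submod.

Record regfun := RegFun { regfun_fun :> point -> K^o;
                          _ : regfun_fun \in regular_pred }.
HB.instance Definition _ := [isSub for regfun_fun].
HB.instance Definition _ := [Choice of regfun by <:].
HB.instance Definition _ := [SubChoice_isSubLmodule of regfun by <:].

Fact regfun_mul_subproof (f g : regfun) :
  (fun x => f x * g x : K^o) \in regular_pred.
Proof.
have /asboolP[p fp] := valP f; have /asboolP[q gq] := valP g.
by apply/asboolP; exists (p * q) => x; rewrite /gl_eval mevalM [f x]fp [g x]gq.
Qed.

Definition regfun_mul (f g : regfun) : regfun := RegFun (regfun_mul_subproof f g).

Fact regfun_one_subproof : (fun=> 1 : K^o) \in regular_pred.
Proof. by apply/asboolP; exists 1 => x; rewrite /gl_eval meval1. Qed.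

Definition regfun_one : regfun := RegFun regfun_one_subproof.

Definition regfun_comul : {linear regfun -> tens regfun regfun} :=
  @the {linear regfun -> tens regfun regfun} \0 (fun L => forall f x y,
    tlift (fun a b : regfun => (a x * b y : K^o)) (L f) = f (pointM x y)).

Fact regfun_counit_linear : linear (fun f : regfun => f point1).
Proof. by []. Qed.

Definition regfun_counit : {linear regfun -> K^o} :=
  HB.pack (fun f : regfun => f point1)
    (GRing.isLinear.Build _ _ _ _ _ regfun_counit_linear).

Definition coord_hopf : hopfData K :=
  @HopfData K regfun regfun_mul regfun_one regfun_comul regfun_counit.

(* Finite-dimensional (rational) representations on column vectors; subspaces
   are row spaces, whence the transposition. *)
Definition is_representation (m : nat) (rho : point -> 'M[K]_m) : Prop :=
  [/\ rho point1 = 1%:M,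
      forall x y, rho (pointM x y) = rho x *m rho y
    & forall i j, regular (fun x => rho x i j)].

Definition subrepresentation (m : nat) (rho : point -> 'M[K]_m) (U : 'M[K]_m) :=
  forall x, stablemx U (rho x)^T.

Definition semisimple_representations : Prop :=
  forall (m : nat) (rho : point -> 'M[K]_m), is_representation rho ->
  forall U : 'M[K]_m, subrepresentation rho U ->
  exists W : 'M[K]_m, [/\ subrepresentation rho W,
    (U + W :=: 1%:M)%MS & (U :&: W)%MS = 0].

End AlgebraicGroup.

Section ClassicalCalculus.
Variables (K : fieldType) (A : hopfData K).

Inductive leibniz_rel : set (tens A A) :=
| leibniz_rel_intro a b c : leibniz_rel
    (a ⊗ hmul b c - (hmul a b ⊗ c + hmul a c ⊗ b)).

Definition kahler : lmodType K := quot leibniz_rel.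

Definition adb (a b : A) : kahler := qpi leibniz_rel (a ⊗ b).

Fact kahler_d_linear : linear (adb (hone A)).
Proof. by move=> c a b; rewrite /adb tpureDr tpureZr linearP. Qed.

Definition kahler_d : {linear A -> kahler} :=
  HB.pack (adb (hone A)) (GRing.isLinear.Build _ _ _ _ _ kahler_d_linear).

Definition kahler_act (a : A) : {linear kahler -> kahler} :=
  lin_ext adb (fun b c => adb (hmul a b) c).

Definition kahler_lco : {linear kahler -> tens A kahler} :=
  lin_ext adb (fun a b => tlift (fun a1 a2 => tlift (fun b1 b2 =>
    hmul a1 b1 ⊗ adb a2 b2) (hcomul A b)) (hcomul A a)).

Definition kahler_rco : {linear kahler -> tens kahler A} :=
  lin_ext adb (fun a b => tlift (fun a1 a2 => tlift (fun b1 b2 =>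
    adb a1 b1 ⊗ hmul a2 b2) (hcomul A b)) (hcomul A a)).

Definition kahler_bimod : bimodData A :=
  @BimodData K A kahler (fun a w => kahler_act a w) (fun w a => kahler_act a w)
    kahler_lco kahler_rco.

Definition classical_calculus : calculus A := @Calculus K A kahler_bimod kahler_d.

End ClassicalCalculus.

Section Connections.
Variables (K : fieldType) (A : hopfData K) (E : calculus A).

Inductive balanced_rel : set (tens E E) :=
| balanced_rel_intro m a n : balanced_rel (ract m a ⊗ n - m ⊗ lact a n).

Definition tensA : lmodType K := quot balanced_rel.

Definition tpureA (m n : E) : tensA := qpi balanced_rel (m ⊗ n).

Local Notation "m ⊗A n" := (tpureA m n) (at level 40, left associativity).

Definition lact2 (a : A) : {linear tensA -> tensA} :=
  lin_ext tpureA (fun m n => lact a m ⊗A n).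

Definition ract2 (t : tensA) (a : A) : tensA :=
  lin_ext tpureA (fun m n => m ⊗A ract n a) t.

Definition lco2 : {linear tensA -> tens A tensA} :=
  lin_ext tpureA (fun m n => tlift (fun a m0 => tlift (fun b n0 =>
    hmul a b ⊗ (m0 ⊗A n0)) (lco E n)) (lco E m)).

Definition rco2 : {linear tensA -> tens tensA A} :=
  lin_ext tpureA (fun m n => tlift (fun m0 a => tlift (fun n0 b =>
    (m0 ⊗A n0) ⊗ hmul a b) (rco E n)) (rco E m)).

Definition lcoinv_pred : {pred E} := fun m => lco E m == hone A ⊗ m.

Fact lcoinv_submod : submod_closed lcoinv_pred.
Proof.
split; first by rewrite unfold_in linear0 -(scale0r (0 : E)) tpureZr scale0r.
move=> c m n /eqP hm /eqP hn.
by rewrite unfold_in linearP hm hn tpureDr tpureZr.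
Qed.

HB.instance Definition _ := GRing.isSubmodClosed.Build K E lcoinv_pred
  lcoinv_submod.

Record lcoinv := LCoinv { lcoinv_val :> E; _ : lcoinv_val \in lcoinv_pred }.
HB.instance Definition _ := [isSub for lcoinv_val].
HB.instance Definition _ := [Choice of lcoinv by <:].
HB.instance Definition _ := [SubChoice_isSubLmodule of lcoinv by <:].

Definition rcoinvariant (m : E) : Prop := rco E m = m ⊗ hone A.

(* This is injective with range the left-coinvariants of [tensA]; maps that
   preserve the coinvariants are transported to [tens lcoinv lcoinv] along it. *)
Definition lcoinv2_incl : {linear tens lcoinv lcoinv -> tensA} :=
  tlift (fun u v : lcoinv => u ⊗A v).

Definition is_bimod_endo (s : tensA -> tensA) : Prop :=
  (forall a t, s (lact2 a t) = lact2 a (s t)) /\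
  (forall a t, s (ract2 t a) = ract2 (s t) a).

Definition braiding : {linear tensA -> tensA} :=
  @the {linear tensA -> tensA} \0 (fun s => is_bimod_endo s /\
    forall (w : lcoinv) (e : E), rcoinvariant e -> s (w ⊗A e) = e ⊗A w).

Definition braiding0 : {linear tens lcoinv lcoinv -> tens lcoinv lcoinv} :=
  @the {linear tens lcoinv lcoinv -> tens lcoinv lcoinv} \0 (fun s =>
    forall t, lcoinv2_incl (s t) = braiding (lcoinv2_incl t)).

Definition psym0 : {linear tens lcoinv lcoinv -> tens lcoinv lcoinv} :=
  @the {linear tens lcoinv lcoinv -> tens lcoinv lcoinv} \0 (fun P =>
    [/\ forall t, P (P t) = P t,
        forall t, (exists u, P u = t) <-> braiding0 t = t
      & forall t, P t = 0 <->
          span [set u | exists2 c : K, c != 1 & braiding0 u = c *: u] t]).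

Definition forms2 : lmodType K := quot [set t : tensA | braiding t - t = 0].

Definition wedge : {linear tensA -> forms2} :=
  qpi [set t : tensA | braiding t - t = 0].

Definition d2 : {linear E -> forms2} :=
  lin_ext (fun a b : A => lact a (cd E b)) (fun a b => wedge (cd E a ⊗A cd E b)).

Definition is_metric (g : tensA -> A) : Prop :=
  [/\ linear g,
      forall t a, g (ract2 t a) = hmul (g t) a,
      forall t, g (braiding t) = g t
    & forall r, (forall v, g (r ⊗A v) = 0) -> r = 0].

Definition bi_invariant (g : tensA -> A) : Prop :=
  (forall t, tlift (fun a u => hcounit A (g u) *: a) (lco2 t) = g t) /\
  (forall t, tlift (fun u a => hcounit A (g u) *: a) (rco2 t) = g t).

Definition is_connection (D : E -> tensA) : Prop :=
  linear D /\ forall r a, D (ract r a) = ract2 (D r) a + r ⊗A cd E a.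

Definition torsionless (D : E -> tensA) : Prop :=
  forall r, wedge (D r) + d2 r = 0.

Definition left_covariant (D : E -> tensA) : Prop :=
  forall m, lco2 (D m) = tmap id D (lco E m).

Definition right_covariant (D : E -> tensA) : Prop :=
  forall m, rco2 (D m) = tmap D id (rco E m).

Definition bicovariant (D : E -> tensA) : Prop :=
  left_covariant D /\ right_covariant D.

(* Meaningful for left-covariant [D], which preserves the coinvariants. *)
Definition conn0 (D : E -> tensA) :
    {linear lcoinv -> tens lcoinv lcoinv} :=
  @the {linear lcoinv -> tens lcoinv lcoinv} \0 (fun L =>
    forall w : lcoinv, lcoinv2_incl (L w) = D w).

(* Defined on coinvariants only: [g] is merely right linear, so [id ⊗ g] does
   not descend to the triple tensor product over [A]. *)
Definition id_g (g : tensA -> A) :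
    {linear tens (tens lcoinv lcoinv) lcoinv -> E} :=
  tlift (fun t w => tlift (fun u v : lcoinv =>
    ract u (g (lcoinv2_incl (v ⊗ w)))) t).

Definition Pi0 (g : tensA -> A) (D : E -> tensA) (t : tens lcoinv lcoinv) : E :=
  2%:R *: id_g g (tmap braiding0 id (tmap (conn0 D) id (psym0 t))).

Definition Pi (g : tensA -> A) (D : E -> tensA) : {linear tensA -> E} :=
  lin_ext (fun (t : tens lcoinv lcoinv) a => ract2 (lcoinv2_incl t) a)
    (fun t a => ract (Pi0 g D t) a + lact (g (lcoinv2_incl t)) (cd E a)).

Definition compatible (g : tensA -> A) (D : E -> tensA) : Prop :=
  forall t, Pi g D t = cd E (g t).

Definition levi_civita (g : tensA -> A) (D : E -> tensA) : Prop :=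
  [/\ is_connection D, left_covariant D, torsionless D & compatible g D].

End Connections.

Definition deformed_hopf (K : fieldType) (n : nat) (G : linAlgGroup K n)
    (Om : tens (rdual (coord_hopf G)) (rdual (coord_hopf G))) : hopfData K :=
  deform_hopf Om.

Definition deformed_calculus (K : fieldType) (n : nat) (G : linAlgGroup K n)
    (Om : tens (rdual (coord_hopf G)) (rdual (coord_hopf G))) :
    calculus (deformed_hopf Om) :=
  deform_calculus Om (classical_calculus (coord_hopf G)).

(* Main.v *)
(* Every structure involved (algebra, forms, tensor square, metric, connection) is a
   bicomodule, and the deformed operations are the classical ones precomposed with
   conjugation by the cocycle Om.  That conjugation is natural for bicovariant maps
   and satisfies the cocycle identity, so a bi-invariant metric and a bicovariant
   connection on the deformed calculus are the same maps as on the classical one,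
   the braiding is conjugate to the flip, and being torsionless or metric takes its
   classical form.  A bicovariant connection is determined by its restriction to the
   left-invariant forms, a finite-dimensional space on which the metric is a constant
   nondegenerate form; there Koszul's formula gives exactly one torsionless metric
   solution.  It is natural, hence bi-invariant, and extends by the Leibniz rule. *)

(* The structure maps of the statement (coproducts, braiding, symmetriser, exterior derivative,
   [Pi]) are definite descriptions with a default value. An equation for any of them is available
   only once a linear map with the defining property has been exhibited, which accounts for the many
   existence lemmas. Points of G separate regular functions, so a coaction is studied through the
   action of points: identities of coactions are tested pointwise, and a linear map that commutes
   with points commutes with every functional on A, in particular with those occurring in Om. This
   turns Om into an operator on M ⊗ N and the cocycle identity into an identity of operators. The
   twist disappears in the end because a normalised cocycle acts trivially next to an invariant
   vector: a bi-invariant metric is constant on left-invariant forms, hence a map to a trivial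
   bicomodule, through which twists cancel. The delicate point is nondegeneracy, which is given for
   deformed tensors and has to be recovered for classical ones. *)
Require Import Defs.
From HB Require Import structures.
From mathcomp Require Import all_boot all_order all_algebra.
From mathcomp Require Import boolp classical_sets functions.
From mathcomp Require Import reals complex.
From mathcomp Require Import finmap monalg mpoly.
From mathcomp Require Import ring.

Set Implicit Arguments.
Unset Strict Implicit.
Unset Printing Implicit Defensive.

Import GRing.Theory.
Local Open Scope ring_scope.

(* Failing unifications would otherwise unfold the quotient construction of the
   tensor product, so pure tensors and induced maps are used through sealed
   copies. *)
HB.lock Definition ptens (K : fieldType) (U V : lmodType K) (u : U) (v : V) : tens U V := tpure u v.
HB.lock Definition plift (K : fieldType) (U V P : lmodType K) (f : U -> V -> P) :
  {linear tens U V -> P} := tlift f.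

Lemma tpureE : @tpure = @ptens. Proof. by rewrite ptens.unlock. Qed.
Lemma tliftEp : @tlift = @plift. Proof. by rewrite plift.unlock. Qed.

Notation "u ⊗ v" := (ptens u v) (at level 40, left associativity) : ring_scope.

(** * Bilinear maps and pure tensors *)

Section Bilinear.
Variables (K : fieldType) (U V W : lmodType K).

Lemma mk_bilin (f : U -> V -> W) :
  (forall a x y z, f (a *: x + y) z = a *: f x z + f y z) ->
  (forall a x y z, f x (a *: y + z) = a *: f x y + f x z) ->
  bilinear_for *:%R *:%R f.
Proof. by move=> hl hr; split=> [z a x y|x a y z]; [exact: hl|exact: hr]. Qed.

Lemma bilinl (f : U -> V -> W) a x y z : bilinear_for *:%R *:%R f ->
  f (a *: x + y) z = a *: f x z + f y z.
Proof. by case=> h _; apply: h. Qed.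

Lemma bilinr (f : U -> V -> W) a x y z : bilinear_for *:%R *:%R f ->
  f z (a *: x + y) = a *: f z x + f z y.
Proof. by case=> _ h; apply: h. Qed.

Lemma pliftE (f : U -> V -> W) u v :
  bilinear_for *:%R *:%R f -> plift f (u ⊗ v) = f u v.
Proof. by rewrite plift.unlock ptens.unlock; exact: tliftE. Qed.

Lemma tpurePl a (x y : U) (z : V) : (a *: x + y) ⊗ z = a *: (x ⊗ z) + y ⊗ z.
Proof. by rewrite ptens.unlock tpureDl tpureZl. Qed.

Lemma tpurePr a (x : U) (y z : V) : x ⊗ (a *: y + z) = a *: (x ⊗ y) + x ⊗ z.
Proof. by rewrite ptens.unlock tpureDr tpureZr. Qed.

Lemma tens_seq (t : tens U V) :
  exists s : seq (U * V), t = \sum_(p <- s) p.1 ⊗ p.2.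
Proof.
rewrite ptens.unlock; elim/quot_ind: t => g; rewrite [g]monalg.monalgE linear_sum /=.
elim: (enum_fset _) => [|k s [s' IH]]; first by exists [::]; rewrite !big_nil.
exists ((monalg.mcoeff k g *: k.1, k.2) :: s'); rewrite [LHS]big_cons [RHS]big_cons -IH.
apply: (f_equal (fun x => x + _)).
rewrite tpureZl -[tpure k.1 k.2]/(qpi (@tens_rel K U V) (fpair k.1 k.2)) -linearZ /=; congr (qpi _ _).
apply/monalg.malgP => j; rewrite monalg.mcoeffZ !monalg.mcoeffU.
by case: k => a b /=; case: eqP => _; rewrite ?mulr1 ?mulr0.
Qed.

Lemma tens_ind (P : tens U V -> Prop) :
  (forall u v, P (u ⊗ v)) -> (forall s t, P s -> P t -> P (s + t)) ->
  forall t, P t.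
Proof.
move=> hp hD t; have [s ->] := tens_seq t.
apply: (big_ind P) => //.
suff -> : 0 = (0 : U) ⊗ (0 : V) by exact: hp.
(* Linearity at -1·0 + 0 gives t = -t + t for t = [0 ⊗ 0], hence t = 0. *)
by have := tpurePl (-1) (0 : U) 0 (0 : V); rewrite scaler0 addr0 scaleN1r addNr.
Qed.

End Bilinear.

Section Pure.
Variables (K : fieldType) (U V : lmodType K).
Implicit Types (u : U) (v : V).

Lemma tens0l v : (0 : U) ⊗ v = 0.
Proof. by have := tpurePl (-1) (0 : U) 0 v; rewrite scaler0 addr0 scaleN1r addNr. Qed.
Lemma tens0r u : u ⊗ (0 : V) = 0.
Proof. by have := tpurePr (-1) u (0 : V) 0; rewrite scaler0 addr0 scaleN1r addNr. Qed.
Lemma tensDl u u' v : (u + u') ⊗ v = u ⊗ v + u' ⊗ v.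
Proof. by rewrite -[u]scale1r tpurePl !scale1r. Qed.
Lemma tensDr u v v' : u ⊗ (v + v') = u ⊗ v + u ⊗ v'.
Proof. by rewrite -[v]scale1r tpurePr !scale1r. Qed.
Lemma tensZl c u v : (c *: u) ⊗ v = c *: (u ⊗ v).
Proof. by rewrite -[c *: u]addr0 tpurePl tens0l addr0. Qed.
Lemma tensZr c u v : u ⊗ (c *: v) = c *: (u ⊗ v).
Proof. by rewrite -[c *: v]addr0 tpurePr tens0r addr0. Qed.
End Pure.

HB.lock Definition ptmap (K : fieldType) (U V U' V' : lmodType K)
    (f : U -> U') (g : V -> V') : {linear tens U V -> tens U' V'} := tmap f g.

Lemma tmapEp : @tmap = @ptmap. Proof. by rewrite ptmap.unlock. Qed.

Lemma tmapE (K : fieldType) (U V U' V' : lmodType K) (f : U -> U') (g : V -> V')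
    (u : U) (v : V) : linear f -> linear g -> ptmap f g (u ⊗ v) = f u ⊗ g v.
Proof.
move=> hf hg; rewrite ptmap.unlock /tmap tpureE tliftEp pliftE //; apply: mk_bilin => a x y z.
  by rewrite hf tpurePl.
by rewrite hg tpurePr.
Qed.

Lemma bilin_assoc (K : fieldType) (U V W : lmodType K) (w' : W) :
  bilinear_for *:%R *:%R (fun (u' : U) (v' : V) => u' ⊗ (v' ⊗ w')).
Proof. by apply: mk_bilin => a x y z; rewrite ?(tpurePl, tpurePr). Qed.

HB.lock Definition passoc (K : fieldType) (U V W : lmodType K) :
  {linear tens (tens U V) W -> tens U (tens V W)} := tassoc U V W.

Lemma tassocEp : @tassoc = @passoc. Proof. by rewrite passoc.unlock. Qed.

Lemma tassocE (K : fieldType) (U V W : lmodType K) (u : U) (v : V) (w : W) :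
  passoc U V W ((u ⊗ v) ⊗ w) = u ⊗ (v ⊗ w).
Proof.
rewrite passoc.unlock /tassoc tpureE tliftEp pliftE ?pliftE; try exact: bilin_assoc.
  by [].
apply: mk_bilin => a x y z; first by rewrite linearP.
elim/tens_ind: x => [u' v'|s t hs ht].
  by rewrite !pliftE; try exact: bilin_assoc; rewrite !tpurePr.
by rewrite !linearD hs ht addrACA.
Qed.

(** Variants for scalar-valued maps, in which scaling on [K^o] already reads as multiplication in
    the field. *)
Lemma linZ (K : fieldType) (U : lmodType K) (f : {linear U -> K^o}) c u :
  f (c *: u) = c * f u.
Proof. exact: linearZ. Qed.

Lemma linP (K : fieldType) (U : lmodType K) (f : {linear U -> K^o}) c u v :
  f (c *: u + v) = c * f u + f v.
Proof. exact: linearP. Qed.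

(** * Detecting tensors by functionals *)

Section Separation.
Variables (K : fieldType) (U V : lmodType K).

Definition free_family (T : lmodType K) n (v : 'I_n -> T) :=
  forall c : 'I_n -> K, \sum_i c i *: v i = 0 -> forall i, c i = 0.

Lemma not_free_family (T : lmodType K) n (v : 'I_n -> T) :
  ~ free_family v -> exists j, exists c : 'I_n -> K, v j = \sum_(i | i != j) c i *: v i.
Proof.
move=> /existsNP[c /not_implyP[c0 /existsNP[j /eqP cj]]]; exists j.
exists (fun i => - (c j)^-1 * c i).
move: c0; rewrite (bigD1 j) //= => /eqP; rewrite addr_eq0 => /eqP e.
under eq_bigr do rewrite -scalerA.
by rewrite -scaler_sumr scaleNr -scalerN -e scalerA mulVf // scale1r.
Qed.

(** As long as the right factors are dependent, substituting one of them by a combination of the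
    others and collecting the left factors shortens the sum by one term. *)
Lemma tens_free n (u : 'I_n -> U) (v : 'I_n -> V) :
  exists m (u' : 'I_m -> U) (v' : 'I_m -> V),
    free_family v' /\ \sum_i u i ⊗ v i = \sum_i u' i ⊗ v' i.
Proof.
elim: n u v => [|n IH] u v; first by exists 0%N, u, v; split => // c _ [].
have [fv|/not_free_family[j [c vj]]] := pselect (free_family v).
  by exists n.+1, u, v.
have [m [u' [v' [fv' E]]]] := IH (fun i => u (lift j i) + c (lift j i) *: u j) (fun i => v (lift j i)).
exists m, u', v'; split=> //; rewrite -E (bigD1_ord j) //= vj.
rewrite (big_morph (fun x => u j ⊗ x) (tensDr _) (tens0r _ _)).

rewrite big_mkcond (bigD1_ord j) //= eqxx add0r -big_split /=.
apply: eq_bigr => i _; rewrite [lift j i == j]eq_sym (negPf (neq_lift _ _)).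
by rewrite tensDl tensZl tensZr addrC.
Qed.

(** With independent right factors, applying [phi i] on the left gives a vanishing combination of
    them, so each [phi i (u j)] is 0 and the left factors vanish by separation. *)
Lemma tens_sep (I : Type) (phi : I -> {linear U -> K^o}) (t : tens U V) :
  (forall u, (forall i, phi i u = 0) -> u = 0) ->
  (forall i, plift (fun u v => phi i u *: v) t = 0) -> t = 0.
Proof.
move=> sep h; have [s ts] := tens_seq t.
rewrite big_tnth in ts.
have [m [u [v [fv E]]]] := tens_free (fun i => (tnth (in_tuple s) i).1) (fun i => (tnth (in_tuple s) i).2).
rewrite {}E in ts; rewrite ts big1 // => j _.
suff -> : u j = 0 by rewrite tens0l.
apply: sep => i; apply: (fv (fun j => phi i (u j))).
rewrite -[RHS](h i) ts linear_sum; apply: eq_bigr => k _.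
rewrite pliftE //; apply: mk_bilin => a x y z; first by rewrite linearP scalerDl scalerA.
by rewrite scalerDr !scalerA [_ * a]mulrC.
Qed.
End Separation.

Lemma tens_sepr (K : fieldType) (U V : lmodType K) (I : Type)
    (phi : I -> {linear V -> K^o}) (t t' : tens U V) :
  (forall v, (forall i, phi i v = 0) -> v = 0) ->
  (forall i, plift (fun u v => phi i v *: u) t = plift (fun u v => phi i v *: u) t') ->
  t = t'.
Proof.
move=> sep h.
have bf : bilinear_for *:%R *:%R (fun (u : U) (v : V) => v ⊗ u).
  by apply: mk_bilin => a x y z; rewrite ?(tpurePl, tpurePr).
have bf' : bilinear_for *:%R *:%R (fun (v : V) (u : U) => u ⊗ v).
  by apply: mk_bilin => a x y z; rewrite ?(tpurePl, tpurePr).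
have fK z : plift (fun (v : V) (u : U) => u ⊗ v) (plift (fun (u : U) (v : V) => v ⊗ u) z) = z.
  elim/tens_ind: z => [u v|x y hx hy]; first by rewrite !pliftE.
  by rewrite !linearD hx hy.
have bp i : bilinear_for *:%R *:%R (fun (v : V) (u : U) => phi i v *: u).
  apply: mk_bilin => a x y z; first by rewrite linearP scalerDl scalerA.
  by rewrite scalerDr !scalerA [_ * a]mulrC.
have bp' i : bilinear_for *:%R *:%R (fun (u : U) (v : V) => phi i v *: u).
  apply: mk_bilin => a x y z; last by rewrite linearP scalerDl scalerA.
  by rewrite scalerDr !scalerA [_ * a]mulrC.
rewrite -[t]fK -[t']fK; congr (plift _ _).
apply/eqP; rewrite -subr_eq0 -linearB; apply/eqP.
apply: (tens_sep sep) => i.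
rewrite -[RHS](subrr (plift (fun u v => phi i v *: u) t)) {2}h -linearB /=.
elim/tens_ind: (t - t') => [u v|x y hx hy]; first by rewrite !pliftE.
by rewrite !linearD hx hy.
Qed.

(** Definite descriptions ask for a linear map, while existence is proved one element at a time. The
    separating family makes the chosen values unique, and uniqueness forces linearity. *)
Lemma linear_choice (K : fieldType) (U T : lmodType K) (I : Type)
    (e : I -> {linear T -> K^o}) (F : I -> {linear U -> K^o}) :
  (forall t, (forall i, e i t = 0) -> t = 0) ->
  (forall u, exists t, forall i, e i t = F i u) ->
  exists L : {linear U -> T}, forall u i, e i (L u) = F i u.
Proof.
move=> sep ex; pose f u := projT1 (cid (ex u)).
have fE u i : e i (f u) = F i u by rewrite /f; case: (cid _).
have fl : linear f.
  move=> a u v; apply/eqP; rewrite -subr_eq0; apply/eqP/sep => i.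
  by rewrite linearB linearP !fE linearP subrr.
by exists (HB.pack f (GRing.isLinear.Build _ _ _ _ _ fl) : {linear U -> T}) => u i; exact: fE.
Qed.

Lemma bilin_mul (K : fieldType) (U V : lmodType K) (f : {linear U -> K^o}) (g : {linear V -> K^o}) :
  bilinear_for *:%R *:%R (fun u v => (f u * g v : K^o)).
Proof.
apply: mk_bilin => a x y z; first by rewrite linearP mulrDl -scalerAl.
by rewrite linearP mulrDr -scalerAr.
Qed.

HB.lock Definition ev2 (K : fieldType) (U V : lmodType K) (f : {linear U -> K^o}) (g : {linear V -> K^o}) :
  {linear tens U V -> K^o} := plift (fun u v => (f u * g v : K^o)).

Lemma ev2E (K : fieldType) (U V : lmodType K) (f : {linear U -> K^o}) (g : {linear V -> K^o}) u v :
  ev2 f g (u ⊗ v) = f u * g v.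
Proof. by rewrite ev2.unlock pliftE //; exact: bilin_mul. Qed.

Lemma ev2_sep (K : fieldType) (U V : lmodType K) (I J : Type) (f : I -> {linear U -> K^o})
    (g : J -> {linear V -> K^o}) (t : tens U V) :
  (forall u, (forall i, f i u = 0) -> u = 0) ->
  (forall v, (forall j, g j v = 0) -> v = 0) ->
  (forall i j, ev2 (f i) (g j) t = 0) -> t = 0.
Proof.
move=> sf sg h; apply: (tens_sep sf) => i; apply: sg => j; rewrite -[RHS](h i j).
have bf : bilinear_for *:%R *:%R (fun (u : U) (v : V) => f i u *: v).
  apply: mk_bilin => a x y z; first by rewrite linearP scalerDl scalerA.
  by rewrite scalerDr !scalerA [_ * a]mulrC.
elim/tens_ind: t {h} => [u v|x y hx hy]; first by rewrite pliftE // ev2E linearZ.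
by rewrite !linearD hx hy.
Qed.

(** * Coordinate algebra and restricted dual *)

Section CoordinateAlgebra.
Variables (K : fieldType) (n : nat) (G : linAlgGroup K n).
Local Notation A := (regfun G).
Local Notation pt := (Defs.point G).

Lemma regfunP (f g : A) : (forall x, f x = g x) -> f = g.
Proof. by move=> h; apply/val_inj/funext. Qed.

Lemma regfunD (f g : A) x : (f + g) x = f x + g x. Proof. by []. Qed.
Lemma regfunZ c (f : A) x : (c *: f) x = c * f x. Proof. by []. Qed.

Fact ev_linear (x : pt) : linear (fun f : A => f x : K^o).
Proof. by []. Qed.
Definition ev (x : pt) : {linear A -> K^o} :=
  HB.pack (fun f : A => f x : K^o) (GRing.isLinear.Build _ _ _ _ _ (ev_linear x)).

Lemma ev_sep (f : A) : (forall x, ev x f = 0) -> f = 0.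
Proof. by move=> h; apply: regfunP => x; exact: h. Qed.

Definition polyfun (p : mpoly.mpoly (n * n + 1) K) : A.
Proof.
exists (fun x => gl_eval p (sval x)); apply/asboolP; by exists p.
Defined.

Lemma regfun_poly (f : A) : exists p, f = polyfun p.
Proof.
have /asboolP[p fp] := valP f; exists p; apply: regfunP => x; exact: fp.
Qed.

(** The coordinates, inverse determinant included, generate the algebra. Existence of coproduct and
    antipode and finiteness of the invariant forms are all reduced to generators in this way. *)
Lemma regfun_ind (P : A -> Prop) :
  P (regfun_one G) -> (forall k, P (polyfun ('X_k))) ->
  (forall f g, P f -> P g -> P (f + g)) -> (forall c f, P f -> P (c *: f)) ->
  (forall f g, P f -> P g -> P (regfun_mul f g)) -> forall f, P f.
Proof.
move=> P1 PX PD PZ PM f; have [p ->] := regfun_poly f.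
elim/mpolyind: p => [|c m p _ _ IH].
  have -> : polyfun 0 = 0 *: regfun_one G by apply: regfunP => x; rewrite regfunZ mul0r /= /gl_eval meval0.
  exact: PZ.
have -> : polyfun (c *: 'X_[m] + p) = c *: polyfun 'X_[m] + polyfun p.
  by apply: regfunP => x; rewrite regfunD regfunZ /= /gl_eval mevalD mevalZ.
apply: PD => //; apply: PZ => {IH c p}.
have PMp p q : P (polyfun p) -> P (polyfun q) -> P (polyfun (p * q)).
  move=> hp hq; have -> : polyfun (p * q) = regfun_mul (polyfun p) (polyfun q).
    by apply: regfunP => x; rewrite /= /gl_eval mevalM.
  exact: PM.
have P1p : P (polyfun 1).
  by have -> : polyfun 1 = regfun_one G by apply: regfunP => x; rewrite /= /gl_eval meval1.
rewrite mpolyXE_id; apply: (big_ind (fun p => P (polyfun p))) => // i _.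
by elim: (m i) => [|k IH]; rewrite ?expr0 // exprS; apply: PMp.
Qed.

(** Regularity as a predicate on arbitrary functions of points, so that minors and determinants can
    be assembled before any element of [regfun] is named. *)
Definition hasfun (f : pt -> K) := exists a : A, forall x, a x = f x.

Lemma hasfunM f g : hasfun f -> hasfun g -> hasfun (fun x => f x * g x).
Proof. by move=> [a ha] [b hb]; exists (regfun_mul a b) => x /=; rewrite ha hb. Qed.

Lemma hasfunC c : hasfun (fun=> c).
Proof. by exists (c *: regfun_one G) => x; rewrite regfunZ mulr1. Qed.

Lemma hasfun_sum (I : finType) (P : pred I) (f : I -> pt -> K) :
  (forall i, hasfun (f i)) -> hasfun (fun x => \sum_(i | P i) f i x).
Proof.
move=> h; pose a i := projT1 (cid (h i)); exists (\sum_(i | P i) a i) => x.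
rewrite -[LHS]/(ev x _) linear_sum; apply: eq_bigr => i _.
by rewrite /a; case: (cid _) => b /= ->.
Qed.

Lemma hasfun_prod (I : finType) (P : pred I) (f : I -> pt -> K) :
  (forall i, hasfun (f i)) -> hasfun (fun x => \prod_(i | P i) f i x).
Proof.
move=> h; elim: (index_enum I) => [|i s IH].
  by under [X in hasfun X]eq_fun do rewrite big_nil; exact: hasfunC.
under [X in hasfun X]eq_fun do rewrite big_cons.
by case: (P i) => //; apply: hasfunM.
Qed.

Lemma hasfun_coord k : hasfun (fun x => gl_coord (sval x) k).
Proof. by exists (polyfun 'X_k) => x /=; rewrite /gl_eval mevalXU. Qed.

Lemma hasfun_entry i j : hasfun (fun x => sval x i j).
Proof.
have [a ha] := hasfun_coord (lshift 1 (mxvec_index i j)); exists a => x.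
by rewrite ha /gl_coord row_mxEl mxvecE.
Qed.

Lemma hasfun_invdet : hasfun (fun x => (\det (sval x))^-1).
Proof.
have [a ha] := hasfun_coord (rshift (n * n) 0); exists a => x.
by rewrite ha /gl_coord row_mxEr mxE eqxx.
Qed.

Lemma coord_cases k :
  (exists i j, forall x : 'M[K]_n, gl_coord x k = x i j) \/
  (forall x : 'M[K]_n, gl_coord x k = (\det x)^-1).
Proof.
case: (split_ordP k) => j ->.
  left; case/mxvec_indexP: j => i j; exists i, j => x.
  by rewrite /gl_coord row_mxEl mxvecE.
by right => x; rewrite /gl_coord row_mxEr ord1 mxE eqxx.
Qed.

Lemma hasfun_det m (M : pt -> 'M[K]_m) :
  (forall i j, hasfun (fun x => M x i j)) -> hasfun (fun x => \det (M x)).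
Proof.
move=> h; apply: hasfun_sum => s; apply: hasfunM; first exact: hasfunC.
by apply: hasfun_prod => i.
Qed.

Lemma point_unit (x : pt) : sval x \in unitmx.
Proof. by case: x => x gx /=; have [S hS] := lag_closed G; move: gx; rewrite hS => -[]. Qed.

Definition pointV (x : pt) : pt := exist _ (invmx (sval x)) (lagV (svalP x)).

Lemma pointP (x y : pt) : sval x = sval y -> x = y.
Proof. by case: x y => x hx [y hy] /= e; subst y; congr (exist _ _ _); exact: Prop_irrelevance. Qed.

Lemma pointVM (x : pt) : pointM (pointV x) x = point1 G.
Proof. by apply: pointP; rewrite /= mulVmx // point_unit. Qed.
Lemma pointMV (x : pt) : pointM x (pointV x) = point1 G.
Proof. by apply: pointP; rewrite /= mulmxV // point_unit. Qed.
Lemma pointMA (x y z : pt) : pointM x (pointM y z) = pointM (pointM x y) z.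
Proof. by apply: pointP; rewrite /= mulmxA. Qed.
Lemma pointM1 (x : pt) : pointM x (point1 G) = x.
Proof. by apply: pointP; rewrite /= mulmx1. Qed.
Lemma point1M (x : pt) : pointM (point1 G) x = x.
Proof. by apply: pointP; rewrite /= mul1mx. Qed.

(** Entries of an inverse matrix are cofactors times the inverse determinant, and the inverse
    determinant of the inverse is the determinant. *)
Lemma hasfun_antipode (f : A) : hasfun (fun x => f (pointV x)).
Proof.
elim/regfun_ind: f => [|k|f g [a ha] [b hb]|c f [a ha]|f g [a ha] [b hb]].
- exact: hasfunC.
- rewrite /= /gl_eval; under [X in hasfun X]eq_fun do rewrite mevalXU.
  case: (coord_cases k) => [[i [j e]]|e]; under [X in hasfun X]eq_fun do rewrite e.
    under [X in hasfun X]eq_fun do rewrite /= /invmx point_unit !mxE.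
    apply: hasfunM; first exact: hasfun_invdet.
    apply: hasfunM; first exact: hasfunC.
    apply: hasfun_det => i' j'; under [X in hasfun X]eq_fun do rewrite !mxE.
    exact: hasfun_entry.
  under [X in hasfun X]eq_fun do rewrite /= det_inv invrK.
  by apply: hasfun_det => i j; exact: hasfun_entry.
- by exists (a + b) => x; rewrite regfunD ha hb.
- by exists (c *: a) => x; rewrite regfunZ ha.
- by exists (regfun_mul a b) => x /=; rewrite ha hb.
Qed.

Lemma ev2M (s t : tens A A) : exists u : tens A A, forall x y,
  ev2 (ev x) (ev y) u = ev2 (ev x) (ev y) s * ev2 (ev x) (ev y) t.
Proof.
elim/tens_ind: s => [a b|s s' [u hu] [u' hu']]; last first.
  by exists (u + u') => x y; rewrite !linearD /= hu hu' mulrDl.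
elim/tens_ind: t => [a' b'|t t' [u hu] [u' hu']]; last first.
  by exists (u + u') => x y; rewrite !linearD /= hu hu' mulrDr.
by exists (regfun_mul a a' ⊗ regfun_mul b b') => x y; rewrite !ev2E /= mulrACA.
Qed.

Lemma ev2_one x y : ev2 (ev x) (ev y) (regfun_one G ⊗ regfun_one G) = 1.
Proof. by rewrite ev2E mulr1. Qed.

(** On generators the tensor comes from the matrix product formula for entries and from
    multiplicativity of the determinant; the general case follows by algebra operations on
    tensors. *)
Lemma comul_ex (f : A) : exists t : tens A A,
  forall x y, ev2 (ev x) (ev y) t = f (pointM x y).
Proof.
elim/regfun_ind: f => [|k|f g [a ha] [b hb]|c f [a ha]|f g [a ha] [b hb]].
- by exists (regfun_one G ⊗ regfun_one G) => x y; rewrite ev2_one.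
- case: (coord_cases k) => [[i [j e]]|e].
    have h l : exists t : tens A A, forall x y,
        ev2 (ev x) (ev y) t = sval x i l * sval y l j.
      have [a ha] := hasfun_entry i l; have [b hb] := hasfun_entry l j.
      by exists (a ⊗ b) => x y; rewrite ev2E -ha -hb.
    exists (\sum_l projT1 (cid (h l))) => x y.
    rewrite linear_sum /= /gl_eval mevalXU e mxE; apply: eq_bigr => l _.
    by case: (cid _) => b /= ->.
  have [a ha] := hasfun_invdet; exists (a ⊗ a) => x y.
  by rewrite ev2E /= /gl_eval mevalXU e det_mulmx invfM -!ha.
- by exists (a + b) => x y; rewrite linearD /= ha hb.
- by exists (c *: a) => x y; rewrite linearZ /= ha.
- have [u hu] := ev2M a b; exists u => x y; by rewrite hu ha hb.
Qed.

Lemma ev2_ev_sep (t t' : tens A A) :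
  (forall x y, ev2 (ev x) (ev y) t = ev2 (ev x) (ev y) t') -> t = t'.
Proof.
move=> h; apply/eqP; rewrite -subr_eq0; apply/eqP.
by apply: (ev2_sep (@ev_sep) (@ev_sep)) => x y; rewrite linearB /= h subrr.
Qed.

Lemma comulE (f : A) x y :
  ev2 (ev x) (ev y) (hcomul (coord_hopf G) f) = f (pointM x y).
Proof.
move: f x y; rewrite /= /regfun_comul tliftEp.
have -> : (fun L : {linear A -> tens A A} => forall f x y, plift (fun a b : A => (a x * b y : K^o)) (L f) = f (pointM x y))
  = (fun L => forall f x y, ev2 (ev x) (ev y) (L f) = f (pointM x y)) by rewrite ev2.unlock.
apply: (@theP {linear A -> tens A A} _ (fun L => forall f x y, ev2 (ev x) (ev y) (L f) = f (pointM x y))).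
have [] := @linear_choice _ _ _ (pt * pt)%type (fun p => ev2 (ev p.1) (ev p.2))
    (fun p => ev (pointM p.1 p.2)).
- by move=> t h; apply: (ev2_sep (@ev_sep) (@ev_sep)) => x y; exact: (h (x, y)).
- by move=> u; have [t ht] := comul_ex u; exists t => -[x y]; exact: ht.
- by move=> L hL; exists L => f x y; exact: (hL f (x, y)).
Qed.

End CoordinateAlgebra.

Section LinearDual.
Variables (K : fieldType) (A : lmodType K).

Definition lindual_pred : {pred (A -> K^o)} := fun h => `[< linear h >].

Fact lindual_submod : submod_closed lindual_pred.
Proof.
split; first by apply/asboolP => c a b; rewrite /= scaler0 addr0.
move=> c g h /asboolP lg /asboolP lh; apply/asboolP => k a b.
by rewrite /= !fctE lg lh !scalerDr !scalerA [c * k]mulrC addrACA.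
Qed.

HB.instance Definition _ := GRing.isSubmodClosed.Build K (A -> K^o) lindual_pred
  lindual_submod.

(** The full linear dual as a module in its own right, so that [tens_free] applies to tensors of
    functionals before these are known to be representative. *)
Record lindual := LinDual { lindual_fun :> A -> K^o; _ : lindual_fun \in lindual_pred }.
HB.instance Definition _ := [isSub for lindual_fun].
HB.instance Definition _ := [Choice of lindual by <:].
HB.instance Definition _ := [SubChoice_isSubLmodule of lindual by <:].

Fact lindual_linear (h : lindual) : linear h.
Proof. by have /asboolP := valP h. Qed.

Definition dlin (h : lindual) : {linear A -> K^o} :=
  HB.pack (lindual_fun h) (GRing.isLinear.Build _ _ _ _ _ (lindual_linear h)).

Fact linear_lindual (h : {linear A -> K^o}) : (h : A -> K^o) \in lindual_pred.
Proof. by apply/asboolP => c a b; rewrite linearP. Qed.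

Fact evD_linear a : linear (fun h : lindual => h a : K^o).
Proof. by []. Qed.
Definition evD a : {linear lindual -> K^o} :=
  HB.pack (fun h : lindual => h a : K^o) (GRing.isLinear.Build _ _ _ _ _ (evD_linear a)).

End LinearDual.

Lemma free_dual (K : fieldType) (A : lmodType K) n (g : 'I_n -> {linear A -> K^o}) :
  (forall c : 'I_n -> K, (forall x, \sum_i c i * g i x = 0) -> forall i, c i = 0) ->
  exists b : 'I_n -> A, forall i j, g i (b j) = (i == j)%:R.
Proof.
elim: n g => [|n IH] g fr; first by exists (fun=> 0) => -[].
have [c c0|b hb] := IH (fun i => g (lift ord0 i)).
  pose c' (i : 'I_n.+1) := if unlift ord0 i is Some j then c j else 0.
  move=> i; have := fr c' _ (lift ord0 i); rewrite /c' liftK; apply => x.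
  rewrite big_ord_recl unlift_none mul0r add0r -[RHS](c0 x).
  by apply: eq_bigr => j _; rewrite liftK.
(* Otherwise the first functional would be the combination of the others with coefficients
   [g ord0 (b j)], against independence. *)
have [x gx] : exists x, g ord0 x - \sum_j g (lift ord0 j) x * g ord0 (b j) != 0.
  apply: contrapT => /forallNP h.
  pose c' (i : 'I_n.+1) := if unlift ord0 i is Some j then - g ord0 (b j) else 1.
  have := fr c' _ ord0; rewrite /c' unlift_none => h'.
  suff /eqP : (1 : K) = 0 by rewrite oner_eq0.
  apply: h' => x; rewrite big_ord_recl unlift_none mul1r.
  have /negP/negPn/eqP e := h x; rewrite -[RHS]e; congr (_ + _); rewrite -sumrN.
  by apply: eq_bigr => j _; rewrite liftK mulNr mulrC.
(* Removing the components along the vectors already found puts x in the kernel of all functionals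
   but the first. *)
pose x' := x - \sum_j g (lift ord0 j) x *: b j.
have gx' j : g (lift ord0 j) x' = 0.
  rewrite linearB linear_sum /= (bigD1 j) //= linZ hb eqxx big1 => [|i /negPf ij].
    by rewrite addr0 mulr1 subrr.
  by rewrite linZ hb eq_sym ij /= mulr0.
have g0x' : g ord0 x' != 0.
  rewrite linearB linear_sum /=; apply: contra_neq gx => e; rewrite -[RHS]e; congr (_ - _).
  by apply: eq_bigr => j _; rewrite linZ.
pose b0 := (g ord0 x')^-1 *: x'.
have gb0 : g ord0 b0 = 1 by rewrite /b0 linZ mulVf.
exists (fun i => if unlift ord0 i is Some j then b j - g ord0 (b j) *: b0 else b0).
move=> i j; case: (unliftP ord0 i) => [i' ->|->]; case: (unliftP ord0 j) => [j' ->|->].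
- rewrite linearB hb /b0 !linZ gx' /= oppr0 !mulr0 addr0.
  by rewrite (inj_eq (@lift_inj _ ord0)).
- by rewrite linZ gx' mulr0 eq_sym (negPf (neq_lift _ _)).
- by rewrite linearB [g ord0 (_ *: _)]linZ gb0 mulr1 subrr (negPf (neq_lift _ _)).
- by rewrite gb0 eqxx.
Qed.

Section TensorAlgebra.
Variables (K : fieldType) (B : hopfData K).
Hypothesis hb : bilinear_for *:%R *:%R (@hmul K B).

Lemma bilin_tmul2 (a b : B) :
  bilinear_for *:%R *:%R (fun a' b' : B => hmul a a' ⊗ hmul b b').
Proof.
by apply: mk_bilin => c x y z; rewrite (bilinr _ _ _ _ hb) ?(tpurePl, tpurePr).
Qed.

Lemma bilin_tmul2' (t : tens B B) : bilinear_for *:%R *:%R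
  (fun a b : B => plift (fun a' b' : B => hmul a a' ⊗ hmul b b') t).
Proof.
apply: mk_bilin => c x y z; elim/tens_ind: t => [u v|s t hs ht].
- rewrite !pliftE; try exact: bilin_tmul2.
  by rewrite (bilinl _ _ _ _ hb) tpurePl.
- by rewrite !linearD hs ht addrACA.
- rewrite !pliftE; try exact: bilin_tmul2.
  by rewrite (bilinl _ _ _ _ hb) tpurePr.
- by rewrite !linearD hs ht addrACA.
Qed.

Lemma tmul2E (a b a' b' : B) :
  tmul2 (a ⊗ b) (a' ⊗ b') = hmul a a' ⊗ hmul b b'.
Proof.
rewrite /tmul2 tpureE tliftEp pliftE; last exact: bilin_tmul2'.
by rewrite pliftE //; exact: bilin_tmul2.
Qed.

Lemma bilin_tmul2s : bilinear_for *:%R *:%R (@tmul2 K B).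
Proof.
rewrite /tmul2 tpureE tliftEp; apply: mk_bilin => c x y z; first by rewrite linearP.
elim/tens_ind: x => [u v|s t hs ht]; last by rewrite !linearD hs ht addrACA.
by rewrite !pliftE; try exact: bilin_tmul2'; rewrite linearP.
Qed.

Lemma tmul2Dl (s s' t : tens B B) : tmul2 (s + s') t = tmul2 s t + tmul2 s' t.
Proof. by rewrite -[s]scale1r (bilinl _ _ _ _ bilin_tmul2s) !scale1r. Qed.
Lemma tmul2Dr (s t t' : tens B B) : tmul2 s (t + t') = tmul2 s t + tmul2 s t'.
Proof. by rewrite -[t]scale1r (bilinr _ _ _ _ bilin_tmul2s) !scale1r. Qed.
End TensorAlgebra.

Section RestrictedDualFacts.
Variables (K : fieldType) (n : nat) (G : linAlgGroup K n).
Local Notation A := (coord_hopf G).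
Local Notation H := (rdual_type A).
Local Notation mulA := (@regfun_mul K n G).

Fact rdual_linear (h : H) : linear h.
Proof. by have /asboolP[] := valP h. Qed.

Definition rlin (h : H) : {linear A -> K^o} :=
  HB.pack (rdual_fun h) (GRing.isLinear.Build _ _ _ _ _ (rdual_linear h)).

Fact evH_linear (a : A) : linear (fun h : H => h a : K^o).
Proof. by []. Qed.
Definition evH (a : A) : {linear H -> K^o} :=
  HB.pack (fun h : H => h a : K^o) (GRing.isLinear.Build _ _ _ _ _ (evH_linear a)).

Lemma rdualP (h k : H) : (forall a, h a = k a) -> h = k.
Proof. by move=> e; apply/val_inj/funext. Qed.

Lemma evH_sep (h : H) : (forall a, evH a h = 0) -> h = 0.
Proof. by move=> e; apply: rdualP => a; exact: e. Qed.

Lemma tens_seqI (U V : lmodType K) (t : tens U V) :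
  exists m (u : 'I_m -> U) (v : 'I_m -> V), t = \sum_i u i ⊗ v i.
Proof.
have [s ->] := tens_seq t; rewrite big_tnth.
by exists (size s), (fun i => (tnth (in_tuple s) i).1), (fun i => (tnth (in_tuple s) i).2).
Qed.

(** Write h(ab) as a sum of f_i(a) g_i(b) with independent g_i. Vectors b_i dual to the g_i give
    f_i(a) = h(a b_i), and associativity makes such translates representative. The same argument
    with independent left factors treats the g_i. *)
Lemma rdual_comul_ex (h : H) : exists t : tens H H,
  forall a b, ev2 (evH a) (evH b) t = h (mulA a b).
Proof.
have /asboolP[lh [s hs]] := valP h.
have [t ht] : exists t : tens (lindual A) (lindual A),
    forall a b, ev2 (evD a) (evD b) t = h (mulA a b).
  exists (\sum_(p <- s) LinDual (linear_lindual p.1) ⊗ LinDual (linear_lindual p.2)).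
  move=> a b; rewrite linear_sum [RHS]hs; apply: eq_bigr => p _.
  by rewrite ev2E.
have [m0 [f0 [g0 t0]]] := tens_seqI t.
have [m [f [g [fg t1]]]] := tens_free f0 g0.
have E1 a b : h (mulA a b) = \sum_i f i a * g i b.
  rewrite -ht t0 t1 linear_sum; apply: eq_bigr => i _; by rewrite ev2E.
have [|bb hbb] := @free_dual _ _ _ (fun i => dlin (g i)).
  move=> c c0; apply: fg; apply: val_inj; apply/funext => x.
  rewrite -[RHS](c0 x) -[LHS]/(evD x _) linear_sum; apply: eq_bigr => i _.
  by rewrite linZ.
have fE i a : f i a = h (mulA a (bb i)).
  rewrite E1 (bigD1 i) //= [g i _]hbb eqxx mulr1 big1 ?addr0 // => j ji.
  by rewrite [g j _]hbb (negPf ji) mulr0.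
have fr i : (f i : A -> K^o) \in @rdual_pred K A.
  apply/asboolP; split; first exact: lindual_linear.
  have lm j : linear (fun a' : A => g j (mulA a' (bb i)) : K^o).
    move=> c x y; rewrite -[RHS](linP (dlin (g j))); congr (g j _).
    by apply: regfunP => z; rewrite /= !fctE /= mulrDl -scalerAl.
  exists [seq (dlin (f j), HB.pack_for {linear A -> K^o} (fun a' : A => g j (mulA a' (bb i)) : K^o)
    (GRing.isLinear.Build _ _ _ _ _ (lm j))) | j <- enum 'I_m] => a a'.
  rewrite big_map big_enum /= fE -[RHS]E1; congr (h _).
  by apply: regfunP => z /=; rewrite mulrA.
pose fH i : H := RDual (fr i).
have t2 a b : ev2 (evH a) (evD b) (\sum_i fH i ⊗ g i) = h (mulA a b).
  by rewrite E1 linear_sum; apply: eq_bigr => i _; rewrite ev2E.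
have fl (X Y : lmodType K) : bilinear_for *:%R *:%R (fun (x : X) (y : Y) => y ⊗ x).
  by apply: mk_bilin => c x y z; rewrite ?(tpurePl, tpurePr).
(* The second reduction takes place in [H], so the left factors become independent while staying
   representative. *)
have [m' [g' [f' [ff t3]]]] := tens_free g fH.
have E2 a b : h (mulA a b) = \sum_i f' i a * g' i b.
  rewrite -t2.
  have -> : \sum_i fH i ⊗ g i = plift (fun x y => y ⊗ x) (\sum_i g i ⊗ fH i).
    by rewrite linear_sum; apply: eq_bigr => i _; rewrite pliftE.
  rewrite t3 !linear_sum; apply: eq_bigr => i _; by rewrite pliftE // ev2E.
have [|aa haa] := @free_dual _ _ _ (fun i => rlin (f' i)).
  move=> c c0; apply: ff; apply: rdualP => x.
  rewrite -[RHS](c0 x) -[LHS]/(evH x _) linear_sum; apply: eq_bigr => i _.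
  by rewrite linZ.
have gE i b : g' i b = h (mulA (aa i) b).
  rewrite E2 (bigD1 i) //= [f' i _]haa eqxx mul1r big1 ?addr0 // => j ji.
  by rewrite [f' j _]haa (negPf ji) mul0r.
have gr i : (g' i : A -> K^o) \in @rdual_pred K A.
  apply/asboolP; split; first exact: lindual_linear.
  have lm j : linear (fun a' : A => f' j (mulA (aa i) a') : K^o).
    move=> c x y; rewrite -[RHS](linP (rlin (f' j))); congr (f' j _).
    by apply: regfunP => z; rewrite /= !fctE /= mulrDr -scalerAr.
  exists [seq (HB.pack_for {linear A -> K^o} (fun a' : A => f' j (mulA (aa i) a') : K^o)
    (GRing.isLinear.Build _ _ _ _ _ (lm j)), dlin (g' j)) | j <- enum 'I_m'] => a a'.
  rewrite big_map big_enum /= gE -[RHS]E2; congr (h _).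
  by apply: regfunP => z /=; rewrite mulrA.
exists (\sum_i f' i ⊗ (RDual (gr i) : H)) => a b.
by rewrite E2 linear_sum; apply: eq_bigr => i _; rewrite ev2E.
Qed.

Lemma rdual_comulE (h : H) a b :
  ev2 (evH a) (evH b) (hcomul (rdual A) h) = h (mulA a b).
Proof.
move: h a b; rewrite /= /rdual_comul tliftEp.
have -> : (fun L : {linear H -> tens H H} => forall h a b, plift (fun h k : H => (h a * k b : K^o)) (L h) = h (hmul a b))
  = (fun L => forall h a b, ev2 (evH a) (evH b) (L h) = h (mulA a b)) by rewrite ev2.unlock.
apply: (@theP {linear H -> tens H H} _ (fun L => forall h a b, ev2 (evH a) (evH b) (L h) = h (mulA a b))).
have [] := @linear_choice _ _ _ (A * A)%type (fun p => ev2 (evH p.1) (evH p.2))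
    (fun p => evH (mulA p.1 p.2)).
- by move=> t h; apply: (ev2_sep (@evH_sep) (@evH_sep)) => x y; exact: (h (x, y)).
- by move=> u; have [t ht] := rdual_comul_ex u; exists t => -[x y]; exact: ht.
- by move=> L hL; exists L => f x y; exact: (hL f (x, y)).
Qed.

Lemma rdual_oneE a : rdual_one A a = a (point1 G).
Proof.
(* For a non-representative functional [insubd] would return its default 0. Evaluation at the
   identity is multiplicative, so a single term suffices. *)
rewrite /rdual_one insubdK //; apply/asboolP; split; first by move=> c x y; rewrite linearP.
by exists [:: (ev (point1 G), ev (point1 G))] => x y; rewrite big_seq1.
Qed.

Lemma bilin_mulA : bilinear_for *:%R *:%R (@hmul K A).
Proof.
apply: mk_bilin => c x y z; apply: regfunP => p; rewrite /= !fctE /=.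
  by rewrite mulrDl -scalerAl.
by rewrite mulrDr -scalerAr.
Qed.

Lemma ev2_mul (x y : Defs.point G) (s t : tens A A) : ev2 (ev x) (ev y) (tmul2 s t) =
  ev2 (ev x) (ev y) s * ev2 (ev x) (ev y) t.
Proof.
elim/tens_ind: s => [a b|s s' hs hs']; last first.
  by rewrite (tmul2Dl bilin_mulA) !linearD mulrDl hs hs'.
elim/tens_ind: t => [a' b'|t t' ht ht']; last first.
  by rewrite (tmul2Dr bilin_mulA) !linearD mulrDr ht ht'.
by rewrite (tmul2E bilin_mulA) !ev2E /= mulrACA.
Qed.

Lemma comulM (a b : A) : hcomul A (mulA a b) = tmul2 (hcomul A a) (hcomul A b).
Proof. by apply: ev2_ev_sep => x y; rewrite ev2_mul !comulE. Qed.

(** The product stays representative because the coproduct of A is multiplicative: the terms for h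
    and those for k combine in pairs. *)
Lemma rdual_mulE (h k : H) a : rdual_mul h k a = ev2 (rlin h) (rlin k) (hcomul A a).
Proof.
have eh a' : ev2 (rlin h) (rlin k) (hcomul A a') = plift (fun x y : A => (h x * k y : K^o)) (hcomul A a').
  by rewrite ev2.unlock.
rewrite /rdual_mul tliftEp insubdK ?eh //; under [X in X \in _]eq_fun do rewrite -eh.
apply/asboolP; split; first by move=> c x y; rewrite !linearP.
have /asboolP[_ [s hs]] := valP h; have /asboolP[_ [t ht]] := valP k.
exists [seq ((ev2 p.1 q.1 \o hcomul A : {linear A -> K^o}), (ev2 p.2 q.2 \o hcomul A : {linear A -> K^o})) | p <- s, q <- t] => a' b'.
rewrite big_allpairs_dep /= [hcomul A _]comulM.
elim/tens_ind: (hcomul A a') => [x y|x y hx hy]; last first.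
  rewrite (tmul2Dl bilin_mulA) linearD hx hy -big_split; apply: eq_bigr => p _.
  by rewrite -big_split; apply: eq_bigr => q _; rewrite linearD mulrDl.
elim/tens_ind: (hcomul A b') => [x' y'|x' y' hx hy]; last first.
  rewrite (tmul2Dr bilin_mulA) linearD hx hy -big_split; apply: eq_bigr => p _.
  by rewrite -big_split; apply: eq_bigr => q _; rewrite linearD mulrDr.
rewrite (tmul2E bilin_mulA) ev2E [rlin h _]hs [rlin k _]ht mulr_suml.
apply: eq_bigr => p _; rewrite mulr_sumr; apply: eq_bigr => q _.
by rewrite !ev2E mulrACA.
Qed.

Lemma bilin_rdual_mul : bilinear_for *:%R *:%R (@hmul K (rdual A)).
Proof.
apply: mk_bilin => c x y z; apply: rdualP => a; rewrite /= !fctE !rdual_mulE.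
  elim/tens_ind: (regfun_comul _ _) => [u v|s t hs ht]; last by rewrite !linearD hs ht addrACA.
  by rewrite !ev2E /= mulrDl -scalerAl.
elim/tens_ind: (regfun_comul _ _) => [u v|s t hs ht]; last by rewrite !linearD hs ht addrACA.
by rewrite !ev2E /= mulrDr -scalerAr.
Qed.

End RestrictedDualFacts.

Lemma bilin_flip (K : fieldType) (U V : lmodType K) : bilinear_for *:%R *:%R (fun (u : U) (v : V) => v ⊗ u).
Proof. by apply: mk_bilin => a x y z; rewrite ?(tpurePl, tpurePr). Qed.

HB.lock Definition tflip (K : fieldType) (U V : lmodType K) : {linear tens U V -> tens V U} :=
  plift (fun u v => v ⊗ u).

Lemma tflipE (K : fieldType) (U V : lmodType K) (u : U) (v : V) : tflip U V (u ⊗ v) = v ⊗ u.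
Proof. by rewrite tflip.unlock pliftE //; exact: bilin_flip. Qed.

Lemma tflipK (K : fieldType) (U V : lmodType K) t : tflip V U (tflip U V t) = t.
Proof. by elim/tens_ind: t => [u v|s t hs ht]; rewrite ?tflipE // !linearD hs ht. Qed.

Lemma tmapLE (K : fieldType) (U V U' V' : lmodType K) (f : {linear U -> U'}) (g : {linear V -> V'}) u v :
  ptmap f g (u ⊗ v) = f u ⊗ g v.
Proof. by rewrite tmapE //; apply: linearP. Qed.

Lemma tmapIE (K : fieldType) (U V V' : lmodType K) (g : {linear V -> V'}) (u : U) v :
  ptmap id g (u ⊗ v) = u ⊗ g v.
Proof. by rewrite tmapE //; apply: linearP. Qed.

Lemma tmapEI (K : fieldType) (U U' V : lmodType K) (f : {linear U -> U'}) u (v : V) :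
  ptmap f id (u ⊗ v) = f u ⊗ v.
Proof. by rewrite tmapE //; apply: linearP. Qed.

Lemma tmap_id (K : fieldType) (U V : lmodType K) (t : tens U V) : ptmap id id t = t.
Proof.
by elim/tens_ind: t => [u v|s t hs ht]; rewrite ?linearD ?hs ?ht ?tmapE.
Qed.

Lemma bilin_ctr (K : fieldType) (A M : lmodType K) (phi : {linear A -> K^o}) :
  bilinear_for *:%R *:%R (fun (m : M) (a : A) => phi a *: m).
Proof.
apply: mk_bilin => a x y z; last by rewrite linP scalerDl scalerA.
by rewrite scalerDr !scalerA [_ * a]mulrC.
Qed.

(** With [phi] the evaluation at a point, this turns a coaction into the action of that point. *)
HB.lock Definition ctr (K : fieldType) (A M : lmodType K) (phi : {linear A -> K^o}) : {linear tens M A -> M} :=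
  plift (fun m a => phi a *: m).

Lemma ctrE (K : fieldType) (A M : lmodType K) (phi : {linear A -> K^o}) (m : M) a :
  ctr M phi (m ⊗ a) = phi a *: m.
Proof. by rewrite ctr.unlock pliftE //; exact: bilin_ctr. Qed.

Lemma ctr_ext (K : fieldType) (A M : lmodType K) (phi psi : {linear A -> K^o}) (z : tens M A) :
  phi =1 psi -> ctr M phi z = ctr M psi z.
Proof.
move=> e; elim/tens_ind: z => [m a|s t hs ht]; first by rewrite !ctrE e.
by rewrite !linearD hs ht.
Qed.

Lemma ctr_tmap (K : fieldType) (A M N : lmodType K) (phi : {linear A -> K^o}) (f : {linear M -> N}) z :
  ctr N phi (ptmap f id z) = f (ctr M phi z).
Proof.
elim/tens_ind: z => [m a|s t hs ht]; first by rewrite tmapEI !ctrE linearZ.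
by rewrite !linearD hs ht.
Qed.

Lemma ctr_tmapr (K : fieldType) (A A' M : lmodType K) (phi : {linear A' -> K^o}) (f : {linear A -> A'}) z :
  ctr M phi (ptmap id f z) = ctr M (phi \o f) z.
Proof.
elim/tens_ind: z => [m a|s t hs ht]; first by rewrite tmapIE !ctrE.
by rewrite !linearD hs ht.
Qed.

Lemma ctr_linl (K : fieldType) (A M : lmodType K) (phi psi chi : {linear A -> K^o}) c (z : tens M A) :
  (forall a, chi a = c * phi a + psi a) -> ctr M chi z = c *: ctr M phi z + ctr M psi z.
Proof.
move=> e; elim/tens_ind: z => [m a|s t hs ht].
  by rewrite !ctrE e scalerDl scalerA.
by rewrite !linearD hs ht addrACA.
Qed.

(** * Comodules *)

Section ComoduleAxioms.
Variables (K : fieldType) (n : nat) (G : linAlgGroup K n).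
Local Notation A := (coord_hopf G).
Local Notation pt := (Defs.point G).

Lemma tensA_sep (M : lmodType K) (z z' : tens M A) :
  (forall x, ctr M (ev x) z = ctr M (ev x) z') -> z = z'.
Proof. by rewrite ctr.unlock => h; apply: (tens_sepr (@ev_sep K n G)) => x; exact: h. Qed.

(* Left ([s = false]) and right ([s = true]) comodules are treated at once: the
   coaction is always written [M -> M ⊗ A], and the side decides in which order
   points act. *)
Definition smul (s : bool) (x y : pt) : pt := if s then pointM x y else pointM y x.

(** The axioms are stated after evaluation at points, where they read as a group action. Since
    points separate [A] this amounts to coassociativity, see [co_coassoc]. *)
Record comod_on (s : bool) (M : lmodType K) := Comod {
  co :> {linear M -> tens M A};
  co1 : forall m, ctr M (ev (point1 G)) (co m) = m;
  coM : forall x y m, ctr M (ev x) (co (ctr M (ev y) (co m))) = ctr M (ev (smul s x y)) (co m)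
}.

End ComoduleAxioms.

HB.lock Definition cact (K : fieldType) (n : nat) (G : linAlgGroup K n) (s : bool)
  (M : lmodType K) (c : comod_on G s M) (phi : {linear coord_hopf G -> K^o}) :
  {linear M -> M} := ctr M phi \o co c.

Section Comodules.
Variables (K : fieldType) (n : nat) (G : linAlgGroup K n).
Local Notation A := (coord_hopf G).
Local Notation H := (rdual_type A).
Local Notation pt := (Defs.point G).
Local Notation comod_on := (comod_on G).

Definition comulS (s : bool) : {linear A -> tens A A} :=
  if s then hcomul A else tflip A A \o hcomul A.

Lemma ev2_flip (U V : lmodType K) (f : {linear U -> K^o}) (g : {linear V -> K^o}) t :
  ev2 f g (tflip V U t) = ev2 g f t.
Proof.
elim/tens_ind: t => [u v|s t hs ht]; first by rewrite tflipE !ev2E mulrC.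
by rewrite !linearD hs ht.
Qed.

Lemma comulSE s (a : A) x y : ev2 (ev x) (ev y) (comulS s a) = ev (smul s x y) a.
Proof. by case: s; rewrite /= ?ev2_flip comulE. Qed.

Lemma ev_ctr (phi psi : {linear A -> K^o}) t : phi (ctr A psi t) = ev2 phi psi t.
Proof.
elim/tens_ind: t => [u v|s t hs ht]; first by rewrite ev2E ctrE linZ mulrC.
by rewrite !linearD hs ht.
Qed.

Section OneComodule.
Variables (s : bool) (M : lmodType K) (c : comod_on s M).

Local Notation act := (cact c).
Lemma actE phi m : act phi m = ctr M phi (co c m). Proof. by rewrite cact.unlock. Qed.
Definition pact (x : pt) : {linear M -> M} := act (ev x).

Lemma pact1 m : pact (point1 G) m = m. Proof. by rewrite /pact actE co1. Qed.
Lemma pactM x y m : pact x (pact y m) = pact (smul s x y) m. Proof. by rewrite /pact !actE coM. Qed.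

Lemma act_ext (phi psi : {linear A -> K^o}) m : phi =1 psi -> act phi m = act psi m.
Proof. by rewrite !actE; exact: ctr_ext. Qed.

Definition sh (psi : {linear A -> K^o}) : {linear A -> A} := ctr A psi \o comulS s.

(** A point acting on the module factor of [co c m] can be traded for a translation of the function
    factor ([E], tested at points). That identity may then be contracted with an arbitrary [psi],
    which need not be an evaluation. *)
Lemma co_ctr psi m : co c (act psi m) = ptmap id (sh psi) (co c m).
Proof.
pose sh' x : {linear A -> A} := ctr A (ev x) \o tflip A A \o comulS s.
have E x : ptmap (pact x) id (co c m) = ptmap id (sh' x) (co c m).
  apply: tensA_sep => y; rewrite ctr_tmap ctr_tmapr -[ctr M (ev y) _]actE [LHS]pactM /pact actE.
  by apply: ctr_ext => a; rewrite -[LHS]comulSE -[RHS]/(ev y (ctr A (ev x) (tflip A A (comulS s a)))) ev_ctr ev2_flip.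
apply: tensA_sep => x; rewrite -actE [act psi m]actE -[LHS]/(pact x _) -ctr_tmap E !ctr_tmapr.
apply: ctr_ext => a.
rewrite -[LHS]/(psi (ctr A (ev x) (tflip A A (comulS s a)))) ev_ctr ev2_flip.
exact/esym/ev_ctr.
Qed.

Lemma act_comp (phi psi chi : {linear A -> K^o}) m : (forall a, chi a = ev2 phi psi (comulS s a)) ->
  act phi (act psi m) = act chi m.
Proof.
move=> e; rewrite [LHS]actE co_ctr ctr_tmapr [RHS]actE; apply: ctr_ext => a.
by rewrite e; exact: ev_ctr.
Qed.

(** A right coaction gives a left module over the restricted dual and a left coaction a right
    module, whence the reversed order in [act_mull]. *)
Lemma act_mulr (h k : H) m : s = true ->
  act (rlin (rdual_mul h k)) m = act (rlin h) (act (rlin k) m).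
Proof. by move=> es; rewrite (act_comp _ (chi := rlin (rdual_mul h k))) // => a; rewrite es /= rdual_mulE. Qed.

Lemma act_mull (h k : H) m : s = false ->
  act (rlin (rdual_mul h k)) m = act (rlin k) (act (rlin h) m).
Proof. by move=> es; rewrite (act_comp _ (chi := rlin (rdual_mul h k))) // => a; rewrite es /= rdual_mulE ev2_flip. Qed.

Lemma act_one m : act (rlin (rdual_one A)) m = m.
Proof. by rewrite -[RHS]pact1; apply: act_ext => a; exact: rdual_oneE. Qed.

Lemma act_linl (a : K) (h k : H) m :
  act (rlin (a *: h + k)) m = a *: act (rlin h) m + act (rlin k) m.
Proof. by rewrite !actE; exact: ctr_linl. Qed.

End OneComodule.

(** Points detect the coefficients of [co c m], so vanishing on the orbit of m already kills the
    image of the whole coaction. This extends statements about translates to the functionals in the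
    cocycle. *)
Lemma act_kill s (M N : lmodType K) (c : comod_on s M) (f : {linear M -> N}) m :
  (forall x, f (pact c x m) = 0) -> forall phi, f (cact c phi m) = 0.
Proof.
move=> h phi; rewrite !actE -ctr_tmap.
suff -> : ptmap f id (co c m) = 0 by rewrite linear0.
by apply: tensA_sep => x; rewrite ctr_tmap linear0 -actE; exact: h.
Qed.

Definition equivariant s (M N : lmodType K) (c : comod_on s M) (d : comod_on s N) (f : M -> N) :=
  forall x m, f (pact c x m) = pact d x (f m).

Lemma equiv_co s (M N : lmodType K) (c : comod_on s M) (d : comod_on s N) (f : {linear M -> N}) :
  equivariant c d f -> forall m, ptmap f id (co c m) = co d (f m).
Proof. by move=> h m; apply: tensA_sep => x; rewrite ctr_tmap -!actE; exact: h. Qed.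

Lemma co_equiv s (M N : lmodType K) (c : comod_on s M) (d : comod_on s N) (f : {linear M -> N}) :
  (forall m, ptmap f id (co c m) = co d (f m)) -> equivariant c d f.
Proof. by move=> h x m; rewrite /pact !actE -h ctr_tmap. Qed.

Lemma act_equiv s (M N : lmodType K) (c : comod_on s M) (d : comod_on s N) (f : {linear M -> N}) :
  equivariant c d f -> forall phi m, f (cact c phi m) = cact d phi (f m).
Proof. by move=> h phi m; rewrite !actE -(equiv_co h) ctr_tmap. Qed.

End Comodules.

Lemma plift_ext (K : fieldType) (U V P : lmodType K) (f g : U -> V -> P) t :
  (forall u v, f u v = g u v) -> plift f t = plift g t.
Proof. by move=> e; congr (plift _ t); apply/funext => u; apply/funext => v. Qed.

(** * Tensors of functionals acting on tensor products *)

Section Op2Bilin.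
Variables (K : fieldType) (n : nat) (G : linAlgGroup K n).
Local Notation A := (coord_hopf G).
Local Notation H := (rdual_type A).
Variables (s : bool) (M N : lmodType K) (c : comod_on G s M) (d : comod_on G s N).

Lemma bilin_op2h m n' : bilinear_for *:%R *:%R
  (fun h k : H => cact c (rlin h) m ⊗ cact d (rlin k) n').
Proof. by apply: mk_bilin => a x y z; rewrite act_linl ?(tpurePl, tpurePr). Qed.

Lemma bilin_op2 (t : tens H H) : bilinear_for *:%R *:%R
  (fun m n' => plift (fun h k : H => cact c (rlin h) m ⊗ cact d (rlin k) n') t).
Proof.
apply: mk_bilin => a x y z.
all: elim/tens_ind: t => [h k|t t' ht ht']; last by rewrite !linearD ht ht' addrACA.
all: by rewrite !pliftE; try exact: bilin_op2h; rewrite linearP ?(tpurePl, tpurePr).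
Qed.

Lemma bilin_tco1 (v : tens N A) : bilinear_for *:%R *:%R
  (fun (m0 : M) (a : A) => plift (fun (n0 : N) b => (m0 ⊗ n0) ⊗ (hmul a b)) v).
Proof.
have b0 (m0 : M) (a : A) : bilinear_for *:%R *:%R (fun (n0 : N) b => (m0 ⊗ n0) ⊗ (hmul a b)).
  apply: mk_bilin => e x y z; first by rewrite tpurePr tpurePl.
  by rewrite (bilinr _ _ _ _ (bilin_mulA G)) tpurePr.
apply: mk_bilin => e x y z.
all: elim/tens_ind: v => [n0 b|t t' ht ht']; last by rewrite !linearD ht ht' addrACA.
all: rewrite !pliftE //.
  by rewrite !tpurePl.
by rewrite (bilinl _ _ _ _ (bilin_mulA G)) tpurePr.
Qed.

Lemma bilin_tco2 : bilinear_for *:%R *:%R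
  (fun (u : tens M A) (v : tens N A) =>
     plift (fun (m0 : M) (a : A) => plift (fun (n0 : N) b => (m0 ⊗ n0) ⊗ (hmul a b)) v) u).
Proof.
apply: mk_bilin => e x y z; first by rewrite linearP.
elim/tens_ind: x => [m0 a|t t' ht ht']; last by rewrite !linearD ht ht' addrACA.
by rewrite !pliftE; try exact: bilin_tco1; rewrite linearP.
Qed.
End Op2Bilin.

HB.lock Definition op2 (K : fieldType) (n : nat) (G : linAlgGroup K n) (s : bool)
    (M N : lmodType K) (c : comod_on G s M) (d : comod_on G s N)
    (t : tens (rdual_type (coord_hopf G)) (rdual_type (coord_hopf G))) :
    {linear tens M N -> tens M N} :=
  plift (fun m n' => plift (fun h k => cact c (rlin h) m ⊗ cact d (rlin k) n') t).

HB.lock Definition tco2 (K : fieldType) (n : nat) (G : linAlgGroup K n)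
    (M N : lmodType K) (u : tens M (coord_hopf G)) (v : tens N (coord_hopf G)) :
    tens (tens M N) (coord_hopf G) :=
  plift (fun m0 a => plift (fun n0 b => (m0 ⊗ n0) ⊗ (hmul a b)) v) u.

Section Op2.
Variables (K : fieldType) (n : nat) (G : linAlgGroup K n).
Local Notation A := (coord_hopf G).
Local Notation H := (rdual_type A).

Lemma tco2E (M N : lmodType K) (m : M) (n' : N) (a b : A) :
  tco2 (m ⊗ a) (n' ⊗ b) = (m ⊗ n') ⊗ (hmul a b).
Proof.
rewrite tco2.unlock pliftE; last exact: bilin_tco1.
rewrite pliftE //; apply: mk_bilin => e x y z; first by rewrite tpurePr tpurePl.
by rewrite (bilinr _ _ _ _ (bilin_mulA G)) tpurePr.
Qed.

Lemma tco2_bilin (M N : lmodType K) : bilinear_for *:%R *:%R (@tco2 K n G M N).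
Proof. by rewrite tco2.unlock; exact: bilin_tco2. Qed.
Lemma tco2Dl (M N : lmodType K) (u u' : tens M A) (v : tens N A) : tco2 (u + u') v = tco2 u v + tco2 u' v.
Proof. by rewrite -[u]scale1r (bilinl _ _ _ _ (tco2_bilin M N)) !scale1r. Qed.
Lemma tco2Dr (M N : lmodType K) (u : tens M A) (v v' : tens N A) : tco2 u (v + v') = tco2 u v + tco2 u v'.
Proof. by rewrite -[v]scale1r (bilinr _ _ _ _ (tco2_bilin M N)) !scale1r. Qed.

Lemma ctr_tco2 (M N : lmodType K) (u : tens M A) (v : tens N A) x :
  ctr _ (ev x) (tco2 u v) = ctr M (ev x) u ⊗ ctr N (ev x) v.
Proof.
elim/tens_ind: u => [m a|t t' ht ht']; last by rewrite tco2Dl !linearD tensDl ht ht'.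
elim/tens_ind: v => [n' b|t t' ht ht']; last by rewrite tco2Dr !linearD tensDr ht ht'.
by rewrite tco2E !ctrE tensZl tensZr scalerA.
Qed.

Section TwoComodules.
Variables (s : bool) (M N : lmodType K) (c : comod_on G s M) (d : comod_on G s N).

Lemma bilin_tco : bilinear_for *:%R *:%R (fun m n' => tco2 (co c m) (co d n')).
Proof.
apply: mk_bilin => a x y z; rewrite linearP.
  by rewrite (bilinl _ _ _ _ (tco2_bilin M N)).
by rewrite (bilinr _ _ _ _ (tco2_bilin M N)).
Qed.

Definition tco : {linear tens M N -> tens (tens M N) A} :=
  plift (fun m n' => tco2 (co c m) (co d n')).

Lemma tcoE m n' : tco (m ⊗ n') = tco2 (co c m) (co d n').
Proof. by rewrite /tco pliftE //; exact: bilin_tco. Qed.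

Fact tco_1 z : ctr _ (ev (point1 G)) (tco z) = z.
Proof.
elim/tens_ind: z => [m n'|t t' ht ht']; last by rewrite !linearD ht ht'.
by rewrite tcoE ctr_tco2 !co1.
Qed.

Fact tco_M x y z :
  ctr _ (ev x) (tco (ctr _ (ev y) (tco z))) = ctr _ (ev (smul s x y)) (tco z).
Proof.
elim/tens_ind: z => [m n'|t t' ht ht']; last by rewrite !linearD ht ht'.
by rewrite tcoE ctr_tco2 tcoE !ctr_tco2 !coM.
Qed.

Definition tcomod : comod_on G s (tens M N) := Comod tco_1 tco_M.

Lemma pact_tens x m n' : pact tcomod x (m ⊗ n') = pact c x m ⊗ pact d x n'.
Proof. by rewrite /pact !actE /= tcoE ctr_tco2. Qed.

Lemma op2E h k m n' :
  op2 c d (h ⊗ k) (m ⊗ n') = cact c (rlin h) m ⊗ cact d (rlin k) n'.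
Proof.
rewrite op2.unlock pliftE; last exact: bilin_op2.
by rewrite pliftE //; exact: bilin_op2h.
Qed.

Lemma op2_linl a t t' z : op2 c d (a *: t + t') z = a *: op2 c d t z + op2 c d t' z.
Proof.
elim/tens_ind: z => [m n'|x y hx hy]; last by rewrite !linearD hx hy addrACA.
rewrite op2.unlock !pliftE; try exact: bilin_op2.
by rewrite linearP.
Qed.

Lemma op2D t t' z : op2 c d (t + t') z = op2 c d t z + op2 c d t' z.
Proof. by rewrite -[t]scale1r op2_linl !scale1r. Qed.

Lemma op2_one z : op2 c d (rdual_one A ⊗ rdual_one A) z = z.
Proof.
elim/tens_ind: z => [m n'|x y hx hy]; last by rewrite !linearD hx hy.
by rewrite op2E !act_one.
Qed.

Lemma op2_mulr t t' z : s = true ->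
  op2 c d (tmul2 (H := rdual A) t t') z = op2 c d t (op2 c d t' z).
Proof.
move=> es; have bH := bilin_rdual_mul G.
elim/tens_ind: t => [h k|x y hx hy]; last by rewrite (tmul2Dl bH) !op2D hx hy.
elim/tens_ind: t' => [h' k'|x y hx hy]; last by rewrite (tmul2Dr bH) !op2D linearD hx hy.
elim/tens_ind: z => [m n'|x y hx hy]; last by rewrite !linearD hx hy.
by rewrite (tmul2E bH) !op2E !act_mulr.
Qed.

Lemma op2_mull t t' z : s = false ->
  op2 c d (tmul2 (H := rdual A) t t') z = op2 c d t' (op2 c d t z).
Proof.
move=> es; have bH := bilin_rdual_mul G.
elim/tens_ind: t => [h k|x y hx hy]; last by rewrite (tmul2Dl bH) !op2D linearD hx hy.
elim/tens_ind: t' => [h' k'|x y hx hy]; last by rewrite (tmul2Dr bH) !op2D hx hy.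
elim/tens_ind: z => [m n'|x y hx hy]; last by rewrite !linearD hx hy.
by rewrite (tmul2E bH) !op2E !act_mull.
Qed.

Definition ctr2 (t : tens H H) (u : tens M A) (v : tens N A) : tens M N :=
  plift (fun h k : H => ctr M (rlin h) u ⊗ ctr N (rlin k) v) t.

Lemma bilin_ctr2 (u : tens M A) (v : tens N A) : bilinear_for *:%R *:%R
  (fun h k : H => ctr M (rlin h) u ⊗ ctr N (rlin k) v).
Proof.
apply: mk_bilin => a x y z.
  by rewrite (@ctr_linl _ _ _ (rlin x) (rlin y) (rlin (a *: x + y)) a) // tpurePl.
by rewrite (@ctr_linl _ _ _ (rlin y) (rlin z) (rlin (a *: y + z)) a) // tpurePr.
Qed.

Lemma ctr2Dl t u u' v : ctr2 t (u + u') v = ctr2 t u v + ctr2 t u' v.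
Proof.
rewrite /ctr2; elim/tens_ind: t => [h' k'|x y hx hy]; last by rewrite !linearD hx hy addrACA.
by rewrite !pliftE; try exact: bilin_ctr2; rewrite linearD tensDl.
Qed.

Lemma ctr2Dr t u v v' : ctr2 t u (v + v') = ctr2 t u v + ctr2 t u v'.
Proof.
rewrite /ctr2; elim/tens_ind: t => [h' k'|x y hx hy]; last by rewrite !linearD hx hy addrACA.
by rewrite !pliftE; try exact: bilin_ctr2; rewrite linearD tensDr.
Qed.

Lemma ctr2E t m a n' b :
  ctr2 t (m ⊗ a) (n' ⊗ b) = (ev2 (evH a) (evH b) t : K) *: (m ⊗ n').
Proof.
rewrite /ctr2; elim/tens_ind: t => [h' k'|x y hx hy].
  by rewrite pliftE; last exact: bilin_ctr2; rewrite !ctrE ev2E tensZl tensZr scalerA.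
by rewrite !linearD [RHS]scalerDl hx hy.
Qed.

Lemma op2_ctr2 t m n' : op2 c d t (m ⊗ n') = ctr2 t (co c m) (co d n').
Proof.
rewrite op2.unlock pliftE; last exact: bilin_op2.
by apply: plift_ext => h' k'; rewrite !actE.
Qed.

(** The diagonal coaction multiplies the function factors, and the coproduct of the restricted dual
    is the transpose of this multiplication. *)
Lemma act_tens h z : cact tcomod (rlin h) z = op2 c d (hcomul (rdual A) h) z.
Proof.
elim/tens_ind: z => [m n'|x y hx hy]; last by rewrite !linearD hx hy.
rewrite actE /= tcoE op2_ctr2.
elim/tens_ind: (co c m) => [m' a|x y hx hy]; last by rewrite tco2Dl linearD ctr2Dl hx hy.
elim/tens_ind: (co d n') => [n'' b|x y hx hy]; last by rewrite tco2Dr linearD ctr2Dr hx hy.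
by rewrite tco2E ctrE -[rlin h _]rdual_comulE ctr2E.
Qed.

End TwoComodules.

Lemma op2_equiv s (M N M' N' : lmodType K) (c : comod_on G s M) (d : comod_on G s N)
    (c' : comod_on G s M') (d' : comod_on G s N') (f : {linear M -> M'}) (g : {linear N -> N'}) t z :
  equivariant c c' f -> equivariant d d' g ->
  ptmap f g (op2 c d t z) = op2 c' d' t (ptmap f g z).
Proof.
move=> ef eg; elim/tens_ind: t => [h k|x y hx hy]; last by rewrite !op2D linearD hx hy.
elim/tens_ind: z => [m n'|x y hx hy]; last by rewrite !linearD hx hy.
by rewrite tmapLE !op2E tmapLE (act_equiv ef) (act_equiv eg).
Qed.

Lemma op2_equivl s (M N M' : lmodType K) (c : comod_on G s M) (d : comod_on G s N)
    (c' : comod_on G s M') (f : {linear M -> M'}) t z :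
  equivariant c c' f -> ptmap f id (op2 c d t z) = op2 c' d t (ptmap f id z).
Proof. by move=> ef; exact: (op2_equiv (g := idfun)). Qed.

Lemma op2_equivr s (M N N' : lmodType K) (c : comod_on G s M) (d : comod_on G s N)
    (d' : comod_on G s N') (g : {linear N -> N'}) t z :
  equivariant d d' g -> ptmap id g (op2 c d t z) = op2 c d' t (ptmap id g z).
Proof. by move=> ef; exact: (op2_equiv (f := idfun)). Qed.

Lemma mulAC (a b : A) : hmul a b = hmul b a :> A.
Proof. by apply: regfunP => x /=; rewrite mulrC. Qed.

Lemma equivariant_flip s (M N : lmodType K) (c : comod_on G s M) (d : comod_on G s N) :
  equivariant (tcomod c d) (tcomod d c) (tflip M N).
Proof.
move=> x z; elim/tens_ind: z => [u p|t t' ht ht']; last by rewrite !linearD ht ht'.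
by rewrite pact_tens !tflipE pact_tens.
Qed.

End Op2.

(** * Threefold tensors and the cocycle identity as an identity of operators *)

Section Op3.
Variables (K : fieldType) (n : nat) (G : linAlgGroup K n).
Local Notation A := (coord_hopf G).
Local Notation H := (rdual_type A).
Let bH := bilin_rdual_mul G.

Lemma bilin_tmul3 (a : H) (u : tens H H) : bilinear_for *:%R *:%R
  (fun (a' : H) (u' : tens H H) => (hmul (a : rdual A) a' : H) ⊗ (@tmul2 K (rdual A) u u' : tens H H)).
Proof.
apply: mk_bilin => c x y z; first by rewrite (bilinr _ _ _ _ bH) tpurePl.
by rewrite (bilinr _ _ _ _ (bilin_tmul2s bH)) tpurePr.
Qed.

Lemma bilin_tmul3' (t : tens H (tens H H)) : bilinear_for *:%R *:%R
  (fun (a : H) (u : tens H H) => plift (fun (a' : H) (u' : tens H H) =>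
     (hmul (a : rdual A) a' : H) ⊗ (@tmul2 K (rdual A) u u' : tens H H)) t).
Proof.
apply: mk_bilin => c x y z.
all: elim/tens_ind: t => [a' u'|t t' ht ht']; last by rewrite !linearD ht ht' addrACA.
all: rewrite !pliftE; try exact: bilin_tmul3.
  by rewrite (bilinl _ _ _ _ bH) tpurePl.
by rewrite (bilinl _ _ _ _ (bilin_tmul2s bH)) tpurePr.
Qed.

Lemma tmul3E (a a' : H) (u u' : tens H H) :
  @tmul3 K (rdual A) (a ⊗ u) (a' ⊗ u') = (hmul (a : rdual A) a' : H) ⊗ (@tmul2 K (rdual A) u u').
Proof.
rewrite /tmul3 tpureE tliftEp pliftE; last exact: bilin_tmul3'.
by rewrite pliftE //; exact: bilin_tmul3.
Qed.

Lemma tmul3Dl (s s' t : tens H (tens H H)) :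
  @tmul3 K (rdual A) (s + s') t = @tmul3 K (rdual A) s t + @tmul3 K (rdual A) s' t.
Proof. by rewrite /tmul3 linearD. Qed.

Lemma tmul3Dr (s t t' : tens H (tens H H)) :
  @tmul3 K (rdual A) s (t + t') = @tmul3 K (rdual A) s t + @tmul3 K (rdual A) s t'.
Proof.
elim/tens_ind: s => [a u|s s' hs hs']; last by rewrite !tmul3Dl hs hs' addrACA.
by rewrite /tmul3 tpureE tliftEp !pliftE; try exact: bilin_tmul3'; rewrite linearD.
Qed.

Section ThreeComodules.
Variables (s : bool) (M N P : lmodType K).
Variables (c : comod_on G s M) (d : comod_on G s N) (e : comod_on G s P).

Lemma bilin_op3h m (u : tens N P) : bilinear_for *:%R *:%R
  (fun (h : H) (t : tens H H) => cact c (rlin h) m ⊗ op2 d e t u).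
Proof. by apply: mk_bilin => a x y z; rewrite ?act_linl ?op2_linl ?(tpurePl, tpurePr). Qed.

Lemma bilin_op3 t : bilinear_for *:%R *:%R
  (fun m (u : tens N P) => plift (fun (h : H) (t : tens H H) => cact c (rlin h) m ⊗ op2 d e t u) t).
Proof.
apply: mk_bilin => a x y z.
all: elim/tens_ind: t => [h k|t t' ht ht']; last by rewrite !linearD ht ht' addrACA.
all: by rewrite !pliftE; try exact: bilin_op3h; rewrite linearP ?(tpurePl, tpurePr).
Qed.

Definition op3 (t : tens H (tens H H)) : {linear tens M (tens N P) -> tens M (tens N P)} :=
  plift (fun m (u : tens N P) => plift (fun (h : H) (t : tens H H) => cact c (rlin h) m ⊗ op2 d e t u) t).

Lemma op3E h t m u : op3 (h ⊗ t) (m ⊗ u) = cact c (rlin h) m ⊗ op2 d e t u.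
Proof.
rewrite /op3 pliftE; last exact: bilin_op3.
by rewrite pliftE //; exact: bilin_op3h.
Qed.

Lemma op3D t t' z : op3 (t + t') z = op3 t z + op3 t' z.
Proof.
elim/tens_ind: z => [m u|x y hx hy]; last by rewrite !linearD hx hy addrACA.
by rewrite /op3 !pliftE; try exact: bilin_op3; rewrite linearD.
Qed.

Lemma op3_mulr t t' z : s = true ->
  op3 (@tmul3 K (rdual A) t t') z = op3 t (op3 t' z).
Proof.
move=> es.
elim/tens_ind: t => [h k|x y hx hy]; last by rewrite tmul3Dl !op3D hx hy.
elim/tens_ind: t' => [h' k'|x y hx hy]; last by rewrite tmul3Dr !op3D linearD hx hy.
elim/tens_ind: z => [m n'|x y hx hy]; last by rewrite !linearD hx hy.
by rewrite tmul3E !op3E act_mulr // op2_mulr.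
Qed.

Lemma op3_mull t t' z : s = false ->
  op3 (@tmul3 K (rdual A) t t') z = op3 t' (op3 t z).
Proof.
move=> es.
elim/tens_ind: t => [h k|x y hx hy]; last by rewrite tmul3Dl !op3D linearD hx hy.
elim/tens_ind: t' => [h' k'|x y hx hy]; last by rewrite tmul3Dr !op3D hx hy.
elim/tens_ind: z => [m n'|x y hx hy]; last by rewrite !linearD hx hy.
by rewrite tmul3E !op3E act_mull // op2_mull.
Qed.

(** This lemma and the next three interpret the four factors of the cocycle identity, namely Om ⊗ 1,
    (Δ ⊗ id)Om, 1 ⊗ Om and (id ⊗ Δ)Om, as twofold operators on grouped factors. *)
Lemma op3_12 t z : op3 (passoc H H H (t ⊗ rdual_one A)) (passoc M N P z) =
  passoc M N P (ptmap (op2 c d t) id z).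
Proof.
elim/tens_ind: t => [h k|x y hx hy]; last first.
  rewrite tensDl linearD op3D hx hy.
  elim/tens_ind: z {hx hy} => [u p|z z' hz hz']; last by rewrite !linearD -hz -hz' addrACA.
  by rewrite !tmapEI op2D tensDl linearD.
elim/tens_ind: z => [u p|z z' hz hz']; last by rewrite !linearD hz hz'.
elim/tens_ind: u => [m n'|u u' hu hu']; last by rewrite tensDl !linearD hu hu'.
by rewrite tmapEI op2E !tassocE op3E op2E act_one.
Qed.

Lemma op3_D12 t z :
  op3 (passoc H H H (ptmap (hcomul (rdual A)) id t)) (passoc M N P z) =
  passoc M N P (op2 (tcomod c d) e t z).
Proof.
elim/tens_ind: t => [h k|x y hx hy]; last by rewrite !linearD op3D hx hy op2D linearD.
elim/tens_ind: z => [u p|z z' hz hz']; last by rewrite !linearD hz hz'.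
rewrite tmapEI op2E act_tens; move: (hcomul (rdual A) h) => t.
elim/tens_ind: t => [h1 h2|x y hx hy]; last by rewrite tensDl linearD op3D hx hy op2D tensDl linearD.
elim/tens_ind: u => [m n'|u u' hu hu']; last by rewrite tensDl !linearD hu hu' tensDl linearD.
by rewrite op2E !tassocE op3E op2E.
Qed.

Lemma op3_23 t z : op3 (rdual_one A ⊗ t) z = ptmap id (op2 d e t) z.
Proof.
elim/tens_ind: z => [u p|z z' hz hz']; last by rewrite !linearD hz hz'.
by rewrite op3E tmapIE act_one.
Qed.

Lemma op3_D23 t z :
  op3 (ptmap id (hcomul (rdual A)) t) z = op2 c (tcomod d e) t z.
Proof.
elim/tens_ind: t => [h k|x y hx hy]; last by rewrite !linearD op3D hx hy op2D.
elim/tens_ind: z => [u p|z z' hz hz']; last by rewrite !linearD hz hz'.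
by rewrite tmapIE op3E op2E act_tens.
Qed.

Variable Om : tens H H.
Hypothesis cOm : @dual_2cocycle K A Om.

Lemma cocycleE : @tmul3 K (rdual A) (passoc H H H (Om ⊗ rdual_one A)) (passoc H H H (ptmap (hcomul (rdual A)) id Om))
  = @tmul3 K (rdual A) (rdual_one A ⊗ Om) (ptmap id (hcomul (rdual A)) Om).
Proof. by move: cOm; rewrite /dual_2cocycle tassocEp tmapEp tpureE. Qed.

Lemma op2_cocycler z : s = true ->
  passoc M N P (ptmap (op2 c d Om) id (op2 (tcomod c d) e Om z)) =
  ptmap id (op2 d e Om) (op2 c (tcomod d e) Om (passoc M N P z)).
Proof. by move=> es; rewrite -op3_12 -op3_D12 -op3_mulr // cocycleE op3_mulr // op3_23 op3_D23. Qed.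

(** For left coactions the threefold action is anti-multiplicative, so the same identity of tensors
    reads with the two operators applied in the opposite order. *)
Lemma op2_cocyclel z : s = false ->
  passoc M N P (op2 (tcomod c d) e Om (ptmap (op2 c d Om) id z)) =
  op2 c (tcomod d e) Om (ptmap id (op2 d e Om) (passoc M N P z)).
Proof. by move=> es; rewrite -op3_D12 -op3_12 -op3_mull // cocycleE op3_mull // op3_23 op3_D23. Qed.

End ThreeComodules.
End Op3.

(** * The cocycle twist *)

Record bicomod (K : fieldType) (n : nat) (G : linAlgGroup K n) := Bicomod {
  bcar :> lmodType K;
  bL : comod_on G false bcar;
  bR : comod_on G true bcar;
  bLR : forall x y m, pact bL x (pact bR y m) = pact bR y (pact bL x m)
}.

(* [Kmap] conjugates by the cocycle: the twisted operations are the classical ones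
   precomposed with it, e.g. [a *_Om b = mul (Kmap (a ⊗ b))].  [Om'] stands for the
   inverse of [Om]. *)
HB.lock Definition Kmap (K : fieldType) (n : nat) (G : linAlgGroup K n)
    (Om Om' : tens (rdual_type (coord_hopf G)) (rdual_type (coord_hopf G)))
    (M N : bicomod G) : {linear tens M N -> tens M N} :=
  op2 (bL M) (bL N) Om \o op2 (bR M) (bR N) Om'.

HB.lock Definition Kinv (K : fieldType) (n : nat) (G : linAlgGroup K n)
    (Om Om' : tens (rdual_type (coord_hopf G)) (rdual_type (coord_hopf G)))
    (M N : bicomod G) : {linear tens M N -> tens M N} :=
  op2 (bR M) (bR N) Om \o op2 (bL M) (bL N) Om'.

Section Bicomodules.
Variables (K : fieldType) (n : nat) (G : linAlgGroup K n).
Local Notation A := (coord_hopf G).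
Local Notation H := (rdual_type A).
Local Notation bicomod := (bicomod G).

Lemma pact_tensE s (M N : lmodType K) (c : comod_on G s M) (d : comod_on G s N) x z :
  pact (tcomod c d) x z = ptmap (pact c x) (pact d x) z.
Proof.
elim/tens_ind: z => [m n'|t t' ht ht']; last by rewrite !linearD ht ht'.
by rewrite pact_tens tmapLE.
Qed.

Definition biequiv (M N : bicomod) (f : M -> N) :=
  equivariant (bL M) (bL N) f /\ equivariant (bR M) (bR N) f.

(** Points on the two sides commute by [bLR]; [act_equiv] replaces first one point and then the
    other by a functional. *)
Lemma actLR (M : bicomod) phi psi (m : M) :
  cact (bL M) phi (cact (bR M) psi m) = cact (bR M) psi (cact (bL M) phi m).
Proof.
have e x m' : pact (bL M) x (cact (bR M) psi m') = cact (bR M) psi (pact (bL M) x m').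
  apply: (act_equiv (f := pact (bL M) x)) => y m''; exact: bLR.
by apply/esym/(act_equiv (f := cact (bR M) psi)) => x m'; exact/esym/e.
Qed.

Lemma op2_pact_equiv (M N : bicomod) t x z :
  op2 (bL M) (bL N) t (ptmap (pact (bR M) x) (pact (bR N) x) z) =
  ptmap (pact (bR M) x) (pact (bR N) x) (op2 (bL M) (bL N) t z).
Proof.
by apply/esym/op2_equiv => y m; exact/esym/bLR.
Qed.

Fact btens_LR (M N : bicomod) x y z :
  pact (tcomod (bL M) (bL N)) x (pact (tcomod (bR M) (bR N)) y z) =
  pact (tcomod (bR M) (bR N)) y (pact (tcomod (bL M) (bL N)) x z).
Proof.
elim/tens_ind: z => [m n'|t t' ht ht']; last by rewrite !linearD ht ht'.
by rewrite !pact_tens !bLR.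
Qed.

Definition btens (M N : bicomod) : bicomod := Bicomod (@btens_LR M N).

Lemma op2_LR (M N : bicomod) t t' z :
  op2 (bL M) (bL N) t (op2 (bR M) (bR N) t' z) = op2 (bR M) (bR N) t' (op2 (bL M) (bL N) t z).
Proof.
elim/tens_ind: t => [h k|x y hx hy]; last by rewrite !op2D linearD hx hy.
have e (u : tens M N) : op2 (bL M) (bL N) (h ⊗ k) u = ptmap (cact (bL M) (rlin h)) (cact (bL N) (rlin k)) u.
  elim/tens_ind: u => [m n'|u u' hu hu']; last by rewrite !linearD hu hu'.
  by rewrite op2E tmapLE.
rewrite !e; apply: op2_equiv => x m.
  by rewrite /pact actLR.
by rewrite /pact actLR.
Qed.

Lemma biequiv_comp (M N P : bicomod) (f : N -> P) (g : M -> N) :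
  biequiv f -> biequiv g -> biequiv (f \o g).
Proof. by move=> [fl fr] [gl gr]; split=> x m /=; rewrite ?gl ?gr ?fl ?fr. Qed.

Lemma biequiv_flip (M N : bicomod) : biequiv (M := btens M N) (N := btens N M) (tflip M N).
Proof. by split; apply: equivariant_flip. Qed.

Section Twist.
Variables (Om Om' : tens H H).
Local Notation Km := (Kmap Om Om').
Local Notation Ki := (Kinv Om Om').
Hypothesis OmV : @tmul2 K (rdual A) Om Om' = rdual_one A ⊗ rdual_one A.
Hypothesis VOm : @tmul2 K (rdual A) Om' Om = rdual_one A ⊗ rdual_one A.

Lemma op2R_K (M N : lmodType K) (c : comod_on G true M) (d : comod_on G true N) z :
  op2 c d Om (op2 c d Om' z) = z.
Proof. by rewrite -op2_mulr // OmV op2_one. Qed.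
Lemma op2R_VK (M N : lmodType K) (c : comod_on G true M) (d : comod_on G true N) z :
  op2 c d Om' (op2 c d Om z) = z.
Proof. by rewrite -op2_mulr // VOm op2_one. Qed.
(** By anti-multiplicativity on the left, the two halves of invertibility exchange their roles
    compared with the right-hand case. *)
Lemma op2L_K (M N : lmodType K) (c : comod_on G false M) (d : comod_on G false N) z :
  op2 c d Om (op2 c d Om' z) = z.
Proof. by rewrite -op2_mull // VOm op2_one. Qed.
Lemma op2L_VK (M N : lmodType K) (c : comod_on G false M) (d : comod_on G false N) z :
  op2 c d Om' (op2 c d Om z) = z.
Proof. by rewrite -op2_mull // OmV op2_one. Qed.

Lemma KmapE (M N : bicomod) z : Km M N z = op2 (bL M) (bL N) Om (op2 (bR M) (bR N) Om' z).
Proof. by rewrite Kmap.unlock. Qed.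
Lemma KinvE (M N : bicomod) z : Ki M N z = op2 (bR M) (bR N) Om (op2 (bL M) (bL N) Om' z).
Proof. by rewrite Kinv.unlock. Qed.

Lemma KmapK (M N : bicomod) z : Ki M N (Km M N z) = z.
Proof. by rewrite KmapE KinvE op2L_VK op2R_K. Qed.
Lemma KinvK (M N : bicomod) z : Km M N (Ki M N z) = z.
Proof. by rewrite KmapE KinvE op2R_VK op2L_K. Qed.

Lemma K_nat (M N M' N' : bicomod) (f : {linear M -> M'}) (g : {linear N -> N'}) z :
  biequiv f -> biequiv g -> ptmap f g (Km M N z) = Km M' N' (ptmap f g z).
Proof.
by move=> [fl fr] [gl gr]; rewrite !KmapE (op2_equiv _ _ fl gl) (op2_equiv _ _ fr gr).
Qed.

Lemma K_natl (M N M' : bicomod) (f : {linear M -> M'}) z :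
  biequiv f -> ptmap f id (Km M N z) = Km M' N (ptmap f id z).
Proof. by move=> ef; exact: (K_nat (g := idfun)). Qed.

Lemma K_natr (M N N' : bicomod) (f : {linear N -> N'}) z :
  biequiv f -> ptmap id f (Km M N z) = Km M N' (ptmap id f z).
Proof. by move=> ef; exact: (K_nat (f := idfun)). Qed.

Lemma Ki_nat (M N M' N' : bicomod) (f : {linear M -> M'}) (g : {linear N -> N'}) z :
  biequiv f -> biequiv g -> ptmap f g (Ki M N z) = Ki M' N' (ptmap f g z).
Proof. by move=> ef eg; rewrite -{2}[z]KinvK (K_nat _ ef eg) KmapK. Qed.

Lemma Ki_natl (M N M' : bicomod) (f : {linear M -> M'}) z :
  biequiv f -> ptmap f id (Ki M N z) = Ki M' N (ptmap f id z).
Proof. by move=> ef; exact: (Ki_nat (g := idfun)). Qed.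

Lemma Ki_natr (M N N' : bicomod) (f : {linear N -> N'}) z :
  biequiv f -> ptmap id f (Ki M N z) = Ki M N' (ptmap id f z).
Proof. by move=> ef; exact: (Ki_nat (f := idfun)). Qed.

Lemma op2L_equivR (M N : bicomod) t :
  equivariant (tcomod (bR M) (bR N)) (tcomod (bR M) (bR N)) (op2 (bL M) (bL N) t).
Proof. by move=> x z; rewrite !pact_tensE op2_pact_equiv. Qed.

Lemma tmap_compl (U U' U'' V : lmodType K) (f : {linear U' -> U''}) (g : {linear U -> U'}) (z : tens U V) :
  ptmap f id (ptmap g id z) = ptmap (f \o g) id z.
Proof.
elim/tens_ind: z => [u p|z z' hz hz']; last by rewrite !linearD hz hz'.
by rewrite !tmapEI.
Qed.

Lemma tmap_compr (U V V' V'' : lmodType K) (f : {linear V' -> V''}) (g : {linear V -> V'}) (z : tens U V) :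
  ptmap id f (ptmap id g z) = ptmap id (f \o g) z.
Proof.
elim/tens_ind: z => [u p|z z' hz hz']; last by rewrite !linearD hz hz'.
by rewrite !tmapIE.
Qed.

Lemma tmap_canl (U U' V : lmodType K) (f : {linear U' -> U}) (g : {linear U -> U'}) (z : tens U V) :
  cancel g f -> ptmap f id (ptmap g id z) = z.
Proof.
move=> gK; elim/tens_ind: z => [u p|z z' hz hz']; last by rewrite !linearD hz hz'.
by rewrite !tmapEI gK.
Qed.

Lemma tmap_canr (U V V' : lmodType K) (f : {linear V' -> V}) (g : {linear V -> V'}) (z : tens U V) :
  cancel g f -> ptmap id f (ptmap id g z) = z.
Proof.
move=> gK; elim/tens_ind: z => [u p|z z' hz hz']; last by rewrite !linearD hz hz'.
by rewrite !tmapIE gK.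
Qed.

Hypothesis cOm : @dual_2cocycle K A Om.

(** Writing z as the image under the [Om]-operators of some w reduces the identity for the inverse
    to the one for [Om], after which everything cancels. *)
Lemma op2R_cocycleV (M N P : bicomod) z :
  passoc M N P (op2 (tcomod (bR M) (bR N)) (bR P) Om' (ptmap (op2 (bR M) (bR N) Om') id z)) =
  op2 (bR M) (tcomod (bR N) (bR P)) Om' (ptmap id (op2 (bR N) (bR P) Om') (passoc M N P z)).
Proof.
set w := op2 (tcomod (bR M) (bR N)) (bR P) Om' _.
have -> : z = ptmap (op2 (bR M) (bR N) Om) id (op2 (tcomod (bR M) (bR N)) (bR P) Om w).
  by rewrite /w op2R_K tmap_canl // => u; rewrite op2R_K.
rewrite (op2_cocycler _ _ _ cOm) // tmap_canr ?op2R_VK // => u.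
by rewrite op2R_VK.
Qed.

(** The left half of [Kmap] contributes the identity for [Om] and the right half the one for [Om'];
    left operators are equivariant for the right coaction, so the halves can be separated. This
    coherence is what makes twisted products associative. *)
Lemma K_cocycle (M N P : bicomod) z :
  passoc M N P (Km (btens M N) P (ptmap (Km M N) id z)) =
  Km M (btens N P) (ptmap id (Km N P) (passoc M N P z)).
Proof.
have e1 : ptmap (Km M N) id z = ptmap (op2 (bL M) (bL N) Om) id (ptmap (op2 (bR M) (bR N) Om') id z).
  elim/tens_ind: z => [u p|z z' hz hz']; last by rewrite !linearD hz hz'.
  by rewrite !tmapEI KmapE.
have e2 y : ptmap id (Km N P) y = ptmap id (op2 (bL N) (bL P) Om) (ptmap id (op2 (bR N) (bR P) Om') y)
  :> tens M (tens N P).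
  elim/tens_ind: y => [u p|y y' hy hy']; last by rewrite !linearD hy hy'.
  by rewrite !tmapIE KmapE.
rewrite e1 e2 !KmapE /= -(op2_equivl _ _ _ (op2L_equivR _)) (op2_cocyclel _ _ _ cOm) //.
rewrite op2R_cocycleV; congr (op2 _ _ _ _).
exact: op2_equivr (op2L_equivR _).
Qed.

Lemma Ki_cocycle (M N P : bicomod) z :
  ptmap id (Ki N P) (Ki M (btens N P) (passoc M N P z)) =
  passoc M N P (ptmap (Ki M N) id (Ki (btens M N) P z)).
Proof.
set w := ptmap (Ki M N) id _.
have -> : z = Km (btens M N) P (ptmap (Km M N) id w).
  by rewrite /w tmap_canl ?KinvK // => u; rewrite KinvK.
by rewrite K_cocycle KmapK tmap_canr // => u; rewrite KmapK.
Qed.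

Hypothesis nOm : @normalised K A Om.

Lemma act_Z s (M : lmodType K) (c : comod_on G s M) a h m :
  cact c (rlin (a *: h)) m = a *: cact c (rlin h) m.
Proof.
have e : cact c (rlin 0) m = 0.
  by have := act_linl c (-1) 0 0 m; rewrite scaler0 addr0 scaleN1r addNr.
by rewrite -[a *: h]addr0 act_linl e addr0.
Qed.

Lemma act_inv s (M : lmodType K) (c : comod_on G s M) m h :
  (forall x, pact c x m = m) -> cact c (rlin h) m = (h (regfun_one G) : K) *: m.
Proof.
move=> hm; rewrite actE.
have -> : co c m = m ⊗ (regfun_one G : A).
  by apply: tensA_sep => x; rewrite -actE [LHS]hm ctrE scale1r.
by rewrite ctrE.
Qed.

Lemma bilin_rl : bilinear_for *:%R *:%R (fun h k : H => (h (regfun_one G) : K) *: k).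
Proof.
apply: mk_bilin => a x y z; first by rewrite [LHS]scalerDl scalerA.
by rewrite scalerDr !scalerA [_ * a]mulrC.
Qed.
Lemma bilin_lr : bilinear_for *:%R *:%R (fun h k : H => (k (regfun_one G) : K) *: h).
Proof.
apply: mk_bilin => a x y z; last by rewrite [LHS]scalerDl scalerA.
by rewrite scalerDr !scalerA [_ * a]mulrC.
Qed.

Lemma normalisedl : plift (fun h k : H => (h (regfun_one G) : K) *: k) Om = rdual_one A.
Proof. by case: nOm; rewrite tliftEp. Qed.
Lemma normalisedr : plift (fun h k : H => (k (regfun_one G) : K) *: h) Om = rdual_one A.
Proof. by case: nOm; rewrite tliftEp. Qed.

(** On an invariant vector a functional acts by its value at 1, that is by the counit, and
    normalisation then reduces Om to the unit on the other factor. *)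
Lemma op2_invl s (M N : lmodType K) (c : comod_on G s M) (d : comod_on G s N) m n' :
  (forall x, pact c x m = m) -> op2 c d Om (m ⊗ n') = m ⊗ n'.
Proof.
move=> hm.
have e t : op2 c d t (m ⊗ n') = m ⊗ cact d (rlin (plift (fun h k : H => (h (regfun_one G) : K) *: k) t)) n'.
  elim/tens_ind: t => [h k|x y hx hy]; last first.
    rewrite op2D hx hy linearD -[plift _ x]scale1r act_linl.
    by rewrite !scale1r tensDr.
  rewrite op2E (act_inv _ hm) pliftE; last exact: bilin_rl.
  by rewrite act_Z tensZl tensZr.
by rewrite e normalisedl act_one.
Qed.

Lemma op2_invr s (M N : lmodType K) (c : comod_on G s M) (d : comod_on G s N) m n' :
  (forall x, pact d x n' = n') -> op2 c d Om (m ⊗ n') = m ⊗ n'.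
Proof.
move=> hm.
have e t : op2 c d t (m ⊗ n') = cact c (rlin (plift (fun h k : H => (k (regfun_one G) : K) *: h) t)) m ⊗ n'.
  elim/tens_ind: t => [h k|x y hx hy]; last first.
    rewrite op2D hx hy linearD -[plift _ x]scale1r act_linl.
    by rewrite !scale1r tensDl.
  rewrite op2E (act_inv _ hm) pliftE; last exact: bilin_lr.
  by rewrite act_Z tensZl tensZr.
by rewrite e normalisedr act_one.
Qed.

Definition linv (M : bicomod) (m : M) := forall x, pact (bL M) x m = m.
Definition rinv (M : bicomod) (m : M) := forall x, pact (bR M) x m = m.

Lemma K_inv (M N : bicomod) (m : M) (n' : N) :
  linv m \/ linv n' -> rinv m \/ rinv n' -> Km M N (m ⊗ n') = m ⊗ n'.
Proof.
move=> hl hr; rewrite KmapE.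
(* [Om'] fixes the tensor because [Om] does and the two operators cancel. *)
have -> : op2 (bR M) (bR N) Om' (m ⊗ n') = m ⊗ n'.
  have <- : op2 (bR M) (bR N) Om (m ⊗ n') = m ⊗ n' by case: hr => h; [exact: op2_invl|exact: op2_invr].
  by rewrite op2R_VK; case: hr => h; [rewrite op2_invl|rewrite op2_invr].
by case: hl => h; [exact: op2_invl|exact: op2_invr].
Qed.

Lemma Ki_inv (M N : bicomod) (m : M) (n' : N) :
  linv m \/ linv n' -> rinv m \/ rinv n' -> Ki M N (m ⊗ n') = m ⊗ n'.
Proof. by move=> hl hr; rewrite -{1}(K_inv hl hr) KmapK. Qed.

End Twist.
End Bicomodules.

(** * Kähler differentials *)

Section Regular.
Variables (K : fieldType) (n : nat) (G : linAlgGroup K n).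
Local Notation A := (coord_hopf G).
Local Notation pt := (Defs.point G).

Lemma smulA s (x y z : pt) : smul s x (smul s y z) = smul s (smul s x y) z.
Proof. by case: s; rewrite /= pointMA. Qed.
Lemma smul1 s (x : pt) : smul s x (point1 G) = x.
Proof. by case: s; rewrite /= ?pointM1 ?point1M. Qed.

Lemma ctr_comulS s (a : A) x y : ev y (ctr A (ev x) (comulS G s a)) = ev (smul s y x) a.
Proof. by rewrite ev_ctr comulSE. Qed.

Fact reg_1 s (a : A) : ctr A (ev (point1 G)) (comulS G s a) = a.
Proof. by apply: regfunP => y; rewrite [LHS]ctr_comulS smul1. Qed.

Fact reg_M s x y (a : A) : ctr A (ev x) (comulS G s (ctr A (ev y) (comulS G s a))) =
  ctr A (ev (smul s x y)) (comulS G s a).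
Proof. by apply: regfunP => z; rewrite [LHS]ctr_comulS [LHS]ctr_comulS [RHS]ctr_comulS smulA. Qed.

Definition regcomod s : comod_on G s A := Comod (@reg_1 s) (@reg_M s).

Lemma pact_reg s x (a : A) y : pact (regcomod s) x a y = a (smul s y x).
Proof. by rewrite /pact actE; exact: ctr_comulS. Qed.

Fact reg_LR x y (a : A) : pact (regcomod false) x (pact (regcomod true) y a) =
  pact (regcomod true) y (pact (regcomod false) x a).
Proof. by apply: regfunP => z; rewrite !pact_reg /= pointMA. Qed.

Definition BA : bicomod G := Bicomod reg_LR.

Lemma pact_mul s x (a b : A) : pact (regcomod s) x (hmul a b) =
  hmul (pact (regcomod s) x a : A) (pact (regcomod s) x b : A).
Proof. by apply: regfunP => y; rewrite pact_reg /= !pact_reg. Qed.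

Lemma pact_one s x : pact (regcomod s) x (regfun_one G) = regfun_one G.
Proof. by apply: regfunP => y; rewrite pact_reg. Qed.

End Regular.

HB.lock Definition kq (K : fieldType) (A : hopfData K) : {linear tens A A -> kahler A} :=
  qpi (@leibniz_rel K A).

HB.lock Definition kact (K : fieldType) (A : hopfData K) (a : A) : {linear kahler A -> kahler A} :=
  kahler_act a.

Section Kahler.
Variables (K : fieldType) (n : nat) (G : linAlgGroup K n).
Local Notation A := (coord_hopf G).
Local Notation E := (kahler A).
Local Notation "a ∙ b" := (@hmul K A a b) (at level 35).

Lemma adbE (a b : A) : adb a b = kq A (a ⊗ b).
Proof. by rewrite kq.unlock /adb tpureE. Qed.

Lemma kq_leibniz (a b c : A) : kq A (a ⊗ (b ∙ c)) = kq A ((a ∙ b) ⊗ c) + kq A ((a ∙ c) ⊗ b).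
Proof.
rewrite kq.unlock -linearD; apply: (@qpi_eq _ _ _ _ _ _ (leibniz_rel_intro a b c)).
by rewrite tpureE.
Qed.

Lemma kah_ind (P : E -> Prop) : (forall a b, P (kq A (a ⊗ b))) ->
  (forall x y, P x -> P y -> P (x + y)) -> forall e, P e.
Proof.
move=> hp hD; elim/quot_ind => t; have -> : qpi _ t = kq A t by rewrite kq.unlock.
elim/tens_ind: t => [a b|s t hs ht]; first exact: hp.
by rewrite linearD; apply: hD.
Qed.

Lemma kq_univ (P : lmodType K) (f : {linear tens A A -> P}) :
  (forall a b c, f (a ⊗ (b ∙ c)) = f ((a ∙ b) ⊗ c) + f ((a ∙ c) ⊗ b)) ->
  exists L : {linear E -> P}, forall z, L (kq A z) = f z.
Proof.
move=> hf; have [|L hL] := @quot_lift_ex _ _ _ (@leibniz_rel K A) f.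
  by move=> w [a b c]; rewrite tpureE linearB linearD hf subrr.
by exists L => z; rewrite kq.unlock; exact: hL.
Qed.

Let mulB := bilin_mulA G.
Lemma mulAA (a b c : A) : a ∙ (b ∙ c) = (a ∙ b) ∙ c.
Proof. by apply: regfunP => x /=; rewrite mulrA. Qed.
Lemma mulA1 (a : A) : a ∙ (regfun_one G : A) = a.
Proof. by apply: regfunP => x /=; rewrite mulr1. Qed.
Lemma mul1A (a : A) : (regfun_one G : A) ∙ a = a.
Proof. by apply: regfunP => x /=; rewrite mul1r. Qed.
Lemma mulAPl a (x y z : A) : (a *: x + y) ∙ z = a *: (x ∙ z) + y ∙ z.
Proof. exact: (bilinl _ _ _ _ mulB). Qed.
Lemma mulAPr a (x y z : A) : z ∙ (a *: x + y) = a *: (z ∙ x) + z ∙ y.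
Proof. exact: (bilinr _ _ _ _ mulB). Qed.

Lemma kahler_actE (a b c : A) : kact a (kq A (b ⊗ c)) = kq A ((a ∙ b) ⊗ c).
Proof.
rewrite kact.unlock -!adbE; apply: lin_extE.
have bf : bilinear_for *:%R *:%R (fun b c : A => kq A ((a ∙ b) ⊗ c)).
  by apply: mk_bilin => e x y z; rewrite ?mulAPr ?(tpurePl, tpurePr) linearP.
have [|L hL] := @kq_univ _ (plift (fun b c : A => kq A ((a ∙ b) ⊗ c))).
  by move=> x y z; rewrite !pliftE // kq_leibniz !mulAA.
by exists L => x y; rewrite !adbE hL pliftE.
Qed.

Lemma kahler_act_bilin : bilinear_for *:%R *:%R (fun (a : A) (e : E) => kact a e).
Proof.
apply: mk_bilin => c x y z; last by rewrite linearP.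
elim/kah_ind: z => [b d|u v hu hv]; last by rewrite !linearD hu hv addrACA.
by rewrite !kahler_actE mulAPl tpurePl linearP.
Qed.

Lemma kahler_actA (a b : A) e : kact a (kact b e) = kact (a ∙ b) e.
Proof.
elim/kah_ind: e => [c d|u v hu hv]; last by rewrite !linearD hu hv.
by rewrite !kahler_actE mulAA.
Qed.

Lemma kahler_act1 e : kact (regfun_one G : A) e = e.
Proof.
elim/kah_ind: e => [c d|u v hu hv]; last by rewrite !linearD hu hv.
by rewrite kahler_actE mul1A.
Qed.

Section Side.
Variable s : bool.
Let R := regcomod G s.

(** Points act by algebra automorphisms ([pact_mul]), so the diagonal coaction on A ⊗ A respects the
    Leibniz relations. *)
Lemma kco_ex : exists L : {linear E -> tens E A},
  forall z, L (kq A z) = ptmap (kq A) id (co (tcomod R R) z).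
Proof.
have [|L hL] := @kq_univ _ (ptmap (kq A) id \o co (tcomod R R)); last by exists L.
move=> a b c; apply: tensA_sep => x.
rewrite linearD !ctr_tmap -!actE -!/(pact _ x) !pact_tens.
by rewrite !pact_mul kq_leibniz.
Qed.

Definition kco : {linear E -> tens E A} := projT1 (cid kco_ex).
Lemma kcoE z : kco (kq A z) = ptmap (kq A) id (co (tcomod R R) z).
Proof. by rewrite /kco; case: (cid _). Qed.

Lemma ctr_kco x z : ctr E (ev x) (kco (kq A z)) = kq A (pact (tcomod R R) x z).
Proof. by rewrite kcoE ctr_tmap -actE. Qed.

Fact kco_1 e : ctr E (ev (point1 G)) (kco e) = e.
Proof.
elim/kah_ind: e => [c d|u v hu hv]; last by rewrite !linearD hu hv.
by rewrite ctr_kco pact1.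
Qed.

Fact kco_M x y e : ctr E (ev x) (kco (ctr E (ev y) (kco e))) = ctr E (ev (smul s x y)) (kco e).
Proof.
elim/kah_ind: e => [c d|u v hu hv]; last by rewrite !linearD hu hv.
by rewrite !ctr_kco pactM.
Qed.

Definition kcomod : comod_on G s E := Comod kco_1 kco_M.

Lemma pact_kq x z : pact kcomod x (kq A z) = kq A (pact (tcomod R R) x z).
Proof. by rewrite /pact actE; exact: ctr_kco. Qed.

End Side.

Fact kah_LR x y e : pact (kcomod false) x (pact (kcomod true) y e) =
  pact (kcomod true) y (pact (kcomod false) x e).
Proof.
elim/kah_ind: e => [c d|u v hu hv]; last by rewrite !linearD hu hv.
by rewrite !pact_kq !pact_tens !reg_LR.
Qed.

Definition BE : bicomod G := Bicomod kah_LR.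

Lemma bilin_kr1 (a1 a2 : A) : bilinear_for *:%R *:%R (fun b1 b2 : A => kq A (a1 ⊗ b1) ⊗ (a2 ∙ b2)).
Proof.
by apply: mk_bilin => c x y z; rewrite ?mulAPr ?(tpurePl, tpurePr) ?linearP ?(tpurePl, tpurePr).
Qed.

Lemma bilin_kr2 (t : tens A A) : bilinear_for *:%R *:%R
  (fun a1 a2 : A => plift (fun b1 b2 : A => kq A (a1 ⊗ b1) ⊗ (a2 ∙ b2)) t).
Proof.
apply: mk_bilin => c x y z.
all: elim/tens_ind: t => [u v|t t' ht ht']; last by rewrite !linearD ht ht' addrACA.
all: rewrite !pliftE; try exact: bilin_kr1.
all: by rewrite ?mulAPl ?(tpurePl, tpurePr) ?linearP ?(tpurePl, tpurePr).
Qed.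

Lemma bilin_kl1 (a1 a2 : A) : bilinear_for *:%R *:%R (fun b1 b2 : A => (a1 ∙ b1) ⊗ kq A (a2 ⊗ b2)).
Proof.
by apply: mk_bilin => c x y z; rewrite ?mulAPr ?(tpurePl, tpurePr) ?linearP ?(tpurePl, tpurePr).
Qed.

Lemma bilin_kl2 (t : tens A A) : bilinear_for *:%R *:%R
  (fun a1 a2 : A => plift (fun b1 b2 : A => (a1 ∙ b1) ⊗ kq A (a2 ⊗ b2)) t).
Proof.
apply: mk_bilin => c x y z.
all: elim/tens_ind: t => [u v|t t' ht ht']; last by rewrite !linearD ht ht' addrACA.
all: rewrite !pliftE; try exact: bilin_kl1.
all: by rewrite ?mulAPl ?(tpurePl, tpurePr) ?linearP ?(tpurePl, tpurePr).
Qed.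

Lemma kco_r (a b : A) : kco true (kq A (a ⊗ b)) =
  plift (fun a1 a2 : A => plift (fun b1 b2 : A => kq A (a1 ⊗ b1) ⊗ (a2 ∙ b2)) (hcomul A b)) (hcomul A a).
Proof.
rewrite kcoE [co _]/= tcoE -[co _ a]/(hcomul A a) -[co _ b]/(hcomul A b).
elim/tens_ind: (hcomul A a) => [a1 a2|t t' ht ht']; last by rewrite tco2Dl !linearD -ht -ht'.
rewrite pliftE; last exact: bilin_kr2.
elim/tens_ind: (hcomul A b) => [c1 c2|t t' ht ht']; last by rewrite tco2Dr !linearD -ht -ht'.
by rewrite pliftE; [rewrite tco2E tmapEI|exact: bilin_kr1].
Qed.

Lemma kco_l (a b : A) : tflip _ _ (kco false (kq A (a ⊗ b))) =
  plift (fun a1 a2 : A => plift (fun b1 b2 : A => (a1 ∙ b1) ⊗ kq A (a2 ⊗ b2)) (hcomul A b)) (hcomul A a).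
Proof.
rewrite kcoE [co _]/= tcoE -[co _ a]/(tflip A A (hcomul A a)) -[co _ b]/(tflip A A (hcomul A b)).
elim/tens_ind: (hcomul A a) => [a1 a2|t t' ht ht']; last by rewrite linearD tco2Dl !linearD -ht -ht'.
rewrite pliftE; last exact: bilin_kl2.
elim/tens_ind: (hcomul A b) => [c1 c2|t t' ht ht']; last by rewrite linearD tco2Dr !linearD -ht -ht'.
by rewrite pliftE; [rewrite !tflipE tco2E tmapEI tflipE|exact: bilin_kl1].
Qed.

Lemma adbEf : @adb K A = (fun a b => kq A (a ⊗ b)).
Proof. by apply/funext => a; apply/funext => b; exact: adbE. Qed.

Lemma kahler_rcoE e : kahler_rco A e = kco true e.
Proof.
elim/kah_ind: e => [a b|u v hu hv]; last by rewrite !linearD hu hv.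
rewrite kco_r /kahler_rco tpureE tliftEp adbEf.
apply: (lin_extE (gen := fun a b : A => kq A (a ⊗ b))).
by exists (kco true) => x y; rewrite kco_r.
Qed.

Lemma kahler_lcoE e : kahler_lco A e = tflip _ _ (kco false e).
Proof.
elim/kah_ind: e => [a b|u v hu hv]; last by rewrite !linearD hu hv.
rewrite kco_l /kahler_lco tpureE tliftEp adbEf.
apply: (lin_extE (gen := fun a b : A => kq A (a ⊗ b))).
by exists (tflip _ _ \o kco false) => x y; rewrite -kco_l.
Qed.

End Kahler.

(** * The deformed calculus *)

Section CocyclePairing.
Variables (K : fieldType) (n : nat) (G : linAlgGroup K n).
Local Notation A := (coord_hopf G).
Local Notation H := (rdual_type A).
Local Notation RA := (regcomod G true).
Local Notation e0 := (ev (point1 G)).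

Lemma pairingE (t : tens H H) (a b : A) :
  cocycle_pairing (A := A) t (a ⊗ b) = ev2 (evH a) (evH b) t.
Proof.
rewrite /cocycle_pairing ev2.unlock tliftEp pliftE //.
apply: mk_bilin => c x y z.
all: elim/tens_ind: t => [h k|t t' ht ht']; last by rewrite !linearD ht ht' addrACA.
all: rewrite !pliftE; try exact: (bilin_mul (evH _) (evH _)).
  by rewrite (rdual_linear h) mulrDl -scalerAl.
by rewrite (rdual_linear k) mulrDr -scalerAr.
Qed.

Lemma act_e0 h (a : A) : e0 (cact RA (rlin h) a) = h a.
Proof.
by rewrite actE ev_ctr -[in RHS](reg_1 false a) [RHS](ev_ctr (rlin h)) ev2_flip.
Qed.

(** Evaluating at the identity after acting by h gives h back ([act_e0]). Convolution of pairings
    thereby becomes composition of operators. *)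
Lemma pairing_op2 (t : tens H H) z :
  cocycle_pairing (A := A) t z = ev2 e0 e0 (op2 RA RA t z).
Proof.
elim/tens_ind: z => [a b|x y hx hy]; last by rewrite !linearD hx hy.
rewrite pairingE; elim/tens_ind: t => [h k|x y hx hy]; last by rewrite op2D !linearD hx hy.
by rewrite op2E !ev2E !act_e0.
Qed.

Section Convolution.
Variables (f p : {linear tens A A -> K^o}).

Lemma bilin_conv1 (a1 a2 : A) : bilinear_for *:%R *:%R
  (fun b1 b2 : A => (f (a1 ⊗ b1) * p (a2 ⊗ b2) : K^o)).
Proof.
apply: mk_bilin => c x y z; rewrite tpurePr linP; first by rewrite mulrDl -scalerAl.
by rewrite mulrDr -scalerAr.
Qed.

Lemma bilin_conv2 (v : tens A A) : bilinear_for *:%R *:%R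
  (fun a1 a2 : A => plift (fun b1 b2 : A => (f (a1 ⊗ b1) * p (a2 ⊗ b2) : K^o)) v).
Proof.
apply: mk_bilin => c x y z.
all: elim/tens_ind: v => [b1 b2|v v' hv hv']; last by rewrite !linearD hv hv' addrACA.
all: rewrite !pliftE; try exact: bilin_conv1; rewrite tpurePl linP.
  by rewrite mulrDl -scalerAl.
by rewrite mulrDr -scalerAr.
Qed.
End Convolution.

Lemma convolution_op2 (f : {linear tens A A -> K^o}) t (a b : A) :
  convolution f (cocycle_pairing (A := A) t) a b = f (op2 RA RA t (a ⊗ b)).
Proof.
rewrite /convolution tpureE tliftEp op2_ctr2 -[co _ a]/(hcomul A a) -[co _ b]/(hcomul A b).
elim/tens_ind: (hcomul A a) => [a1 a2|u u' hu hu']; last by rewrite ctr2Dl !linearD -hu -hu'.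
rewrite pliftE; last exact: bilin_conv2.
elim/tens_ind: (hcomul A b) => [b1 b2|u u' hu hu']; last by rewrite ctr2Dr !linearD -hu -hu'.
rewrite pliftE; last exact: bilin_conv1.
by rewrite pairingE ctr2E linZ mulrC.
Qed.

Variables (Om Om' : tens H H).
Hypothesis OmV : @tmul2 K (rdual A) Om Om' = rdual_one A ⊗ rdual_one A.
Hypothesis VOm : @tmul2 K (rdual A) Om' Om = rdual_one A ⊗ rdual_one A.

Lemma conv_pairing t t' (a b : A) :
  @tmul2 K (rdual A) t t' = rdual_one A ⊗ rdual_one A ->
  convolution (cocycle_pairing (A := A) t) (cocycle_pairing (A := A) t') a b = hcounit A a * hcounit A b.
Proof.
move=> tV.
by rewrite convolution_op2 pairing_op2 -op2_mulr // tV op2_one ev2E.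
Qed.

Lemma gambarE z : convolution_inverse (cocycle_pairing (A := A) Om) z = cocycle_pairing (A := A) Om' z.
Proof.
set g := convolution_inverse _.
have [] : (forall a b : A, convolution (cocycle_pairing (A := A) Om) g a b = hcounit A a * hcounit A b /\
    convolution g (cocycle_pairing (A := A) Om) a b = hcounit A a * hcounit A b) /\ True.
  split => //; rewrite /g /convolution_inverse; apply: (@theP {linear tens A A -> K^o} _ (fun g => forall a b : A, convolution (cocycle_pairing (A := A) Om) g a b = hcounit A a * hcounit A b /\
    convolution g (cocycle_pairing (A := A) Om) a b = hcounit A a * hcounit A b)).
  exists (cocycle_pairing (A := A) Om') => a b; split; exact: conv_pairing.
(* Any convolution inverse composed with the operator of [Om] is the counit, and that operator is
   invertible, so the inverse is unique. *)
move=> h _; have h2 w : g (op2 RA RA Om w) = ev2 e0 e0 w.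
  elim/tens_ind: w => [a b|x y hx hy]; last by rewrite !linearD hx hy.
  by rewrite -convolution_op2 (h a b).2 ev2E.
by rewrite pairing_op2 -h2 -op2_mulr // OmV op2_one.
Qed.

End CocyclePairing.

Section TwistOp.
Variables (K : fieldType) (n : nat) (G : linAlgGroup K n).
Local Notation A := (coord_hopf G).
Local Notation H := (rdual_type A).
Variables (Om Om' : tens H H).
Hypothesis OmV : @tmul2 K (rdual A) Om Om' = rdual_one A ⊗ rdual_one A.
Hypothesis VOm : @tmul2 K (rdual A) Om' Om = rdual_one A ⊗ rdual_one A.
Let gam := cocycle_pairing (A := A) Om.
Let gambar := convolution_inverse gam.

Section Sandwich.
Variable X : lmodType K.

Lemma bilin_sandw (phi chi : {linear A -> K^o}) : bilinear_for *:%R *:%R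
  (fun (x1 : A) (u : tens X A) => (phi x1 : K) *: ctr X chi u).
Proof.
apply: mk_bilin => a x y z; first by rewrite linP scalerDl scalerA.
by rewrite linearP scalerDr !scalerA [_ * a]mulrC.
Qed.

(** Contracts both outer legs of x_1 ⊗ x_2 ⊗ x_3. On an iterated coaction this is the action of two
    functionals from the two sides. *)
Definition sandw (phi chi : {linear A -> K^o}) : {linear tens A (tens X A) -> X} :=
  plift (fun (x1 : A) (u : tens X A) => (phi x1 : K) *: ctr X chi u).

Lemma sandwE phi chi x1 x2 x3 : sandw phi chi (x1 ⊗ (x2 ⊗ x3)) = (phi x1 * chi x3 : K) *: x2.
Proof. by rewrite /sandw pliftE ?ctrE ?scalerA //; exact: bilin_sandw. Qed.
End Sandwich.

Variables (X Y Z : lmodType K) (op : X -> Y -> Z).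
Hypothesis bop : bilinear_for *:%R *:%R op.

Let cc (x1 x3 y1 y3 : A) : K := gam (x1 ⊗ y1) * gambar (x3 ⊗ y3).

Lemma bilin_tw1 x1 x2 x3 y1 : bilinear_for *:%R *:%R
  (fun (y2 : Y) (y3 : A) => cc x1 x3 y1 y3 *: op x2 y2).
Proof.
rewrite /cc; apply: mk_bilin => a x y z.
  by rewrite (bilinr _ _ _ _ bop) scalerDr !scalerA [_ * a]mulrC.
by rewrite tpurePr linP mulrDr scalerDl scalerA; congr (_ *: _ + _); rewrite mulrCA.
Qed.

Lemma bilin_tw2 x1 x2 x3 : bilinear_for *:%R *:%R
  (fun (y1 : A) (ty : tens Y A) => plift (fun (y2 : Y) (y3 : A) => cc x1 x3 y1 y3 *: op x2 y2) ty).
Proof.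
apply: mk_bilin => a x y z; last by rewrite linearP.
elim/tens_ind: z => [b1 b2|v v' hv hv']; last by rewrite !linearD hv hv' addrACA.
rewrite !pliftE; try exact: bilin_tw1.
by rewrite /cc tpurePr linP mulrDl scalerDl !scalerA mulrA.
Qed.

Lemma bilin_tw3 x1 ty : bilinear_for *:%R *:%R
  (fun (x2 : X) (x3 : A) => plift (fun (y1 : A) (ty : tens Y A) => plift (fun (y2 : Y) (y3 : A) => cc x1 x3 y1 y3 *: op x2 y2) ty) ty).
Proof.
apply: mk_bilin => a x y z.
all: elim/tens_ind: ty => [y1 ty|v v' hv hv']; last by rewrite !linearD hv hv' addrACA.
all: rewrite !pliftE; try exact: bilin_tw2.
all: elim/tens_ind: ty => [b1 b2|v v' hv hv']; last by rewrite !linearD hv hv' addrACA.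
all: rewrite !pliftE; try exact: bilin_tw1; rewrite /cc.
  by rewrite (bilinl _ _ _ _ bop) scalerDr !scalerA [_ * a]mulrC.
by rewrite tpurePl linP mulrDr scalerDl scalerA; congr (_ *: _ + _); rewrite mulrCA.
Qed.

Lemma bilin_tw4 ty : bilinear_for *:%R *:%R
  (fun (x1 : A) (tx : tens X A) => plift (fun (x2 : X) (x3 : A) => plift (fun (y1 : A) (ty : tens Y A) => plift (fun (y2 : Y) (y3 : A) => cc x1 x3 y1 y3 *: op x2 y2) ty) ty) tx).
Proof.
apply: mk_bilin => a x y z; last by rewrite linearP.
elim/tens_ind: z => [x2 x3|v v' hv hv']; last by rewrite !linearD hv hv' addrACA.
rewrite !pliftE; try exact: bilin_tw3.
elim/tens_ind: ty => [y1 ty|v v' hv hv']; last by rewrite !linearD hv hv' addrACA.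
rewrite !pliftE; try exact: bilin_tw2.
elim/tens_ind: ty => [b1 b2|v v' hv hv']; last by rewrite !linearD hv hv' addrACA.
rewrite !pliftE; try exact: bilin_tw1.
by rewrite /cc tpurePl linP mulrDl scalerDl !scalerA mulrA.
Qed.

Lemma sandwPl (V : lmodType K) a (h k : H) chi (t : tens A (tens V A)) :
  sandw V (rlin (a *: h + k)) chi t = a *: sandw V (rlin h) chi t + sandw V (rlin k) chi t.
Proof.
rewrite /sandw; elim/tens_ind: t => [b u|x y hx hy]; last by rewrite !linearD hx hy addrACA.
by rewrite !pliftE; try exact: bilin_sandw; rewrite [LHS]scalerDl scalerA.
Qed.

Lemma sandwPr (V : lmodType K) a (h k : H) chi (t : tens A (tens V A)) :
  sandw V chi (rlin (a *: h + k)) t = a *: sandw V chi (rlin h) t + sandw V chi (rlin k) t.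
Proof.
rewrite /sandw; elim/tens_ind: t => [b u|x y hx hy]; last by rewrite !linearD hx hy addrACA.
rewrite !pliftE; try exact: bilin_sandw.
rewrite (@ctr_linl _ _ _ (rlin h) (rlin k) (rlin (a *: h + k)) a) //.
by rewrite scalerDr !scalerA [_ * a]mulrC.
Qed.

Lemma bilin_op_sandw h k tx ty : bilinear_for *:%R *:%R (fun h' k' : H =>
  op (sandw X (rlin h) (rlin h') tx) (sandw Y (rlin k) (rlin k') ty)).
Proof.
by apply: mk_bilin => a x y z; rewrite sandwPr ?(bilinl _ _ _ _ bop) ?(bilinr _ _ _ _ bop).
Qed.

Lemma bilin_op_sandw2 t tx ty : bilinear_for *:%R *:%R (fun h k : H =>
  plift (fun h' k' : H => op (sandw X (rlin h) (rlin h') tx) (sandw Y (rlin k) (rlin k') ty)) t).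
Proof.
apply: mk_bilin => a x y z.
all: elim/tens_ind: t => [h k|t t' ht ht']; last by rewrite !linearD ht ht' addrACA.
all: rewrite !pliftE; try exact: bilin_op_sandw.
all: by rewrite sandwPl ?(bilinl _ _ _ _ bop) ?(bilinr _ _ _ _ bop).
Qed.

Definition op_sandw t t' tx ty := plift (fun h k : H => plift (fun h' k' : H =>
    op (sandw X (rlin h) (rlin h') tx) (sandw Y (rlin k) (rlin k') ty)) t') t.

Lemma opDl x x' y : op (x + x') y = op x y + op x' y.
Proof. by rewrite -[x]scale1r (bilinl _ _ _ _ bop) !scale1r. Qed.
Lemma opDr x y y' : op x (y + y') = op x y + op x y'.
Proof. by rewrite -[y]scale1r (bilinr _ _ _ _ bop) !scale1r. Qed.

Lemma op_sandwDl t t' tx tx' ty : op_sandw t t' (tx + tx') ty = op_sandw t t' tx ty + op_sandw t t' tx' ty.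
Proof.
rewrite /op_sandw; elim/tens_ind: t => [h k|x y hx hy]; last by rewrite !linearD hx hy addrACA.
rewrite !pliftE; try exact: bilin_op_sandw2.
elim/tens_ind: t' => [h' k'|x y hx hy]; last by rewrite !linearD hx hy addrACA.
by rewrite !pliftE; try exact: bilin_op_sandw; rewrite linearD opDl.
Qed.

Lemma op_sandwDr t t' tx ty ty' : op_sandw t t' tx (ty + ty') = op_sandw t t' tx ty + op_sandw t t' tx ty'.
Proof.
rewrite /op_sandw; elim/tens_ind: t => [h k|x y hx hy]; last by rewrite !linearD hx hy addrACA.
rewrite !pliftE; try exact: bilin_op_sandw2.
elim/tens_ind: t' => [h' k'|x y hx hy]; last by rewrite !linearD hx hy addrACA.
by rewrite !pliftE; try exact: bilin_op_sandw; rewrite linearD opDr.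
Qed.

Lemma op_sandwE t t' x1 x2 x3 y1 y2 y3 : op_sandw t t' (x1 ⊗ (x2 ⊗ x3)) (y1 ⊗ (y2 ⊗ y3)) =
  (ev2 (evH x1) (evH y1) t * ev2 (evH x3) (evH y3) t' : K) *: op x2 y2.
Proof.
have opZ a b x y : op (a *: x) (b *: y) = (a * b) *: op x y.
  have op0l z : op 0 z = 0 by have := bilinl (-1) 0 0 z bop; rewrite scaler0 addr0 scaleN1r addNr.
  have op0r z : op z 0 = 0 by have := bilinr (-1) 0 0 z bop; rewrite scaler0 addr0 scaleN1r addNr.
  rewrite -[a *: x]addr0 (bilinl _ _ _ _ bop) op0l addr0.
  by rewrite -[b *: y]addr0 (bilinr _ _ _ _ bop) op0r addr0 scalerA.
rewrite /op_sandw; elim/tens_ind: t => [h k|x y hx hy]; last first.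
  by rewrite !linearD hx hy mulrDl scalerDl.
rewrite pliftE; last exact: bilin_op_sandw2.
elim/tens_ind: t' => [h' k'|x y hx hy]; last by rewrite !linearD hx hy mulrDr scalerDl.
rewrite pliftE; last exact: bilin_op_sandw.
by rewrite !sandwE opZ !ev2E mulrACA.
Qed.

Lemma twist_opE tx ty : twist_op Om op tx ty = op_sandw Om Om' tx ty.
Proof.
rewrite /twist_op tpureE tliftEp -/gam -/gambar.
elim/tens_ind: tx => [x1 tx|u v hu hv]; last by rewrite op_sandwDl -hu -hv linearD.
rewrite pliftE; last exact: bilin_tw4.
elim/tens_ind: tx => [x2 x3|u v hu hv]; last by rewrite tensDr op_sandwDl -hu -hv linearD.
rewrite pliftE; last exact: bilin_tw3.
elim/tens_ind: ty => [y1 ty|u v hu hv]; last by rewrite op_sandwDr -hu -hv linearD.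
rewrite pliftE; last exact: bilin_tw2.
elim/tens_ind: ty => [y2 y3|u v hu hv]; last by rewrite tensDr op_sandwDr -hu -hv linearD.
rewrite pliftE; last exact: bilin_tw1.
by rewrite op_sandwE /cc /gam /gambar (gambarE OmV VOm) !pairingE.
Qed.

End TwistOp.

Section TwistK.
Variables (K : fieldType) (n : nat) (G : linAlgGroup K n).
Local Notation A := (coord_hopf G).
Local Notation H := (rdual_type A).
Variables (Om Om' : tens H H).
Hypothesis OmV : @tmul2 K (rdual A) Om Om' = rdual_one A ⊗ rdual_one A.
Hypothesis VOm : @tmul2 K (rdual A) Om' Om = rdual_one A ⊗ rdual_one A.
Variables (M N : bicomod G) (Z : lmodType K) (op : M -> N -> Z).
Hypothesis bop : bilinear_for *:%R *:%R op.

(** All that the twist formula uses of an iterated coaction; it covers [hcomul3] for functions and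
    [bico] for forms alike. *)
Definition sandwich_of (P : bicomod G) (p : P) (t : tens A (tens P A)) :=
  forall phi chi, sandw P phi chi t = cact (bL P) phi (cact (bR P) chi p).

Lemma twist_opK m n' tx ty : sandwich_of m tx -> sandwich_of n' ty ->
  twist_op Om op tx ty = plift op (Kmap Om Om' M N (m ⊗ n')).
Proof.
move=> hx hy; rewrite (twist_opE OmV VOm bop) KmapE.
move: Om Om' => t t'; rewrite /op_sandw.
elim/tens_ind: t => [h k|u v hu hv]; last by rewrite op2D !linearD hu hv.
rewrite pliftE; last exact: bilin_op_sandw2.
elim/tens_ind: t' => [h' k'|u v hu hv]; last by rewrite op2D !linearD hu hv.
rewrite pliftE; last exact: bilin_op_sandw.
by rewrite !op2E pliftE // hx hy.
Qed.

Lemma sandwich_bico (P : bicomod G) (p : P) (l : {linear P -> tens A P}) :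
  (forall p, l p = tflip P A (co (bL P) p)) -> sandwich_of p (ptmap id (co (bR P)) (l p)).
Proof.
move=> hl phi chi; rewrite hl [RHS]actLR [cact (bL P) phi p]actE.
elim/tens_ind: (co (bL P) p) => [q a|u v hu hv]; last by rewrite !linearD hu hv.
rewrite tflipE tmapIE /sandw pliftE; last exact: bilin_sandw.
by rewrite ctrE linearZ actE.
Qed.
End TwistK.

HB.lock Definition mulL (K : fieldType) (n : nat) (G : linAlgGroup K n) :
    {linear tens (coord_hopf G) (coord_hopf G) -> coord_hopf G} :=
  plift (fun a b : coord_hopf G => hmul a b).

HB.lock Definition actL (K : fieldType) (n : nat) (G : linAlgGroup K n) :
    {linear tens (coord_hopf G) (kahler (coord_hopf G)) -> kahler (coord_hopf G)} :=
  plift (fun (a : coord_hopf G) (e : kahler (coord_hopf G)) => kact a e).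

HB.lock Definition actR (K : fieldType) (n : nat) (G : linAlgGroup K n) :
    {linear tens (kahler (coord_hopf G)) (coord_hopf G) -> kahler (coord_hopf G)} :=
  plift (fun (e : kahler (coord_hopf G)) (a : coord_hopf G) => kact a e).

HB.lock Definition bq (K : fieldType) (n : nat) (G : linAlgGroup K n)
    (Om : tens (rdual (coord_hopf G)) (rdual (coord_hopf G))) :
    {linear tens (kahler (coord_hopf G)) (kahler (coord_hopf G)) -> tensA (deformed_calculus Om)} :=
  qpi (@balanced_rel _ _ (deformed_calculus Om)).

(* Twisting identifies the tensor square over the deformed algebra with the classical
   one; [odot (m ⊗ n)] is the element corresponding to the classical [m ⊗ n]. *)
HB.lock Definition odot (K : fieldType) (n : nat) (G : linAlgGroup K n)
    (Om Om' : tens (rdual (coord_hopf G)) (rdual (coord_hopf G))) :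
    {linear tens (kahler (coord_hopf G)) (kahler (coord_hopf G)) -> tensA (deformed_calculus Om)} :=
  bq Om \o Kinv Om Om' (BE G) (BE G).

Section Deformed.
Variables (K : fieldType) (n : nat) (G : linAlgGroup K n).
Local Notation A := (coord_hopf G).
Local Notation H := (rdual_type A).
Local Notation E := (kahler A).
Local Notation BE := (BE G).
Local Notation BA := (BA G).

Lemma mulLE (a b : A) : mulL G (a ⊗ b) = hmul a b.
Proof. by rewrite mulL.unlock pliftE //; exact: bilin_mulA. Qed.
Lemma actLE (a : A) (e : E) : actL G (a ⊗ e) = kact a e.
Proof. by rewrite actL.unlock pliftE //; exact: kahler_act_bilin. Qed.
Lemma actRE (a : A) (e : E) : actR G (e ⊗ a) = kact a e.
Proof.
rewrite actR.unlock pliftE //; apply: mk_bilin => c x y z; first by rewrite linearP.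
exact: (bilinl _ _ _ _ (kahler_act_bilin G)).
Qed.

Lemma pact_kact s x (a : A) (e : E) : pact (kcomod G s) x (kact a e) =
  kact (pact (regcomod G s) x a) (pact (kcomod G s) x e).
Proof.
elim/kah_ind: e => [b c|u v hu hv]; last by rewrite !linearD hu hv.
by rewrite kahler_actE !pact_kq !pact_tens pact_mul kahler_actE.
Qed.

Lemma biequiv_bilin (M N P : bicomod G) (f : {linear tens M N -> P}) :
  (forall x m n, f (pact (bL M) x m ⊗ pact (bL N) x n) = pact (bL P) x (f (m ⊗ n))) ->
  (forall x m n, f (pact (bR M) x m ⊗ pact (bR N) x n) = pact (bR P) x (f (m ⊗ n))) ->
  biequiv (M := btens M N) f.
Proof.
move=> hl hr; split=> x z.
all: elim/tens_ind: z => [m n'|u v hu hv]; last by rewrite !linearD hu hv.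
all: by rewrite pact_tens.
Qed.

Lemma biequiv_actL : biequiv (M := btens BA BE) (N := BE) (actL G).
Proof. by apply: biequiv_bilin => x m n'; rewrite !actLE pact_kact. Qed.
Lemma biequiv_actR : biequiv (M := btens BE BA) (N := BE) (actR G).
Proof. by apply: biequiv_bilin => x m n'; rewrite !actRE pact_kact. Qed.

Variables (Om Om' : tens H H).
Hypothesis OmV : @tmul2 K (rdual A) Om Om' = rdual_one A ⊗ rdual_one A.
Hypothesis VOm : @tmul2 K (rdual A) Om' Om = rdual_one A ⊗ rdual_one A.
Hypothesis cOm : @dual_2cocycle K A Om.
Local Notation Km := (Kmap Om Om').
Local Notation Ki := (Kinv Om Om').
Local Notation EB := (deformed_calculus Om).
Local Notation B := (deformed_hopf Om).
Local Notation T := (tensA EB).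
Local Notation q := (bq Om).
Local Notation od := (odot Om Om').

Section Trilinear.
Variables (M N P Q P' : bicomod G) (R : lmodType K).
Variables (f : {linear tens M N -> P}) (g : {linear tens P Q -> R}).
Variables (f' : {linear tens N Q -> P'}) (g' : {linear tens M P' -> R}).
Hypothesis ef : biequiv (M := btens M N) f.
Hypothesis ef' : biequiv (M := btens N Q) f'.

(** Transfer of associativity-type identities to the twisted operations: equivariant inner maps pass
    through [Kmap], and [K_cocycle] regroups the two twists. *)
Lemma trilinear : (forall z, g (ptmap f id z) = g' (ptmap id f' (passoc M N Q z))) ->
  forall z, g (Km P Q (ptmap (f \o Km M N) id z)) = g' (Km M P' (ptmap id (f' \o Km N Q) (passoc M N Q z))).
Proof.
move=> h z; rewrite -tmap_compl -tmap_compr.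
rewrite -(K_natl _ _ _ ef) -(K_natr _ _ _ ef') h.
by rewrite (K_cocycle OmV VOm cOm).
Qed.

(** The transfer in the opposite direction, removing the twist from identities of the deformed
    operations by [Ki_cocycle]. *)
Lemma trilinear_inv :
  (forall z, g (ptmap (f \o Km M N) id z) = g' (ptmap id (f' \o Km N Q) (passoc M N Q z))) ->
  forall z, g (Ki P Q (ptmap f id z)) = g' (Ki M P' (ptmap id f' (passoc M N Q z))).
Proof.
move=> h z; rewrite -(Ki_natl OmV VOm _ ef) -(Ki_natr OmV VOm _ ef').
have -> : ptmap f id (Ki (btens M N) Q z) = ptmap (f \o Km M N) id (ptmap (Ki M N) id (Ki (btens M N) Q z)).
  by rewrite -tmap_compl tmap_canl // => u; rewrite (KinvK VOm).
rewrite h -(Ki_cocycle OmV VOm cOm) -tmap_compr tmap_canr // => u.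
by rewrite (KinvK VOm).
Qed.
End Trilinear.

Lemma sandwich_hcomul3 (a : A) : sandwich_of (P := BA) a (hcomul3 a).
Proof.
rewrite /hcomul3 tmapEp; apply: (sandwich_bico (P := BA)) => b.
by rewrite /= tflipK.
Qed.

Lemma sandwich_bicoE (e : E) : sandwich_of (P := BE) e (bico (M := kahler_bimod A) e).
Proof.
rewrite /bico tmapEp /=.
have -> : (kahler_rco A : E -> tens E A) = kco G true by apply/funext => x; exact: kahler_rcoE.
by apply: (sandwich_bico (P := BE)) => b; rewrite kahler_lcoE.
Qed.

Lemma hmulBE (a b : B) : hmul a b = mulL G (Km BA BA ((a : A) ⊗ (b : A))).
Proof.
rewrite mulL.unlock -(twist_opK OmV VOm (M := BA) (N := BA) (op := @hmul K A) (bilin_mulA G) (sandwich_hcomul3 a) (sandwich_hcomul3 b)).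
by [].
Qed.

Lemma lactBE (a : B) (e : EB) : lact a e = actL G (Km BA BE ((a : A) ⊗ (e : E))).
Proof.
rewrite actL.unlock -(twist_opK OmV VOm (M := BA) (N := BE) (kahler_act_bilin G) (sandwich_hcomul3 a) (sandwich_bicoE e)).
by rewrite kact.unlock.
Qed.

Lemma ractBE (a : B) (e : EB) : ract e a = actR G (Km BE BA ((e : E) ⊗ (a : A))).
Proof.
have bl : bilinear_for *:%R *:%R (fun (e : E) (a : A) => kact a e).
  apply: mk_bilin => c x y z; first by rewrite linearP.
  exact: (bilinl _ _ _ _ (kahler_act_bilin G)).
rewrite actR.unlock -(twist_opK OmV VOm (M := BE) (N := BA) bl (sandwich_bicoE e) (sandwich_hcomul3 a)).
by rewrite kact.unlock.
Qed.

Lemma tpureAE (m n' : EB) : tpureA m n' = q ((m : E) ⊗ (n' : E)).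
Proof. by rewrite bq.unlock /tpureA tpureE. Qed.

Lemma tensA_ind (P : T -> Prop) : (forall m n', P (q (m ⊗ n'))) ->
  (forall x y, P x -> P y -> P (x + y)) -> forall t, P t.
Proof.
move=> hp hD; elim/quot_ind => t; have -> : qpi _ t = q t by rewrite bq.unlock.
elim/tens_ind: t => [a b|s t hs ht]; first exact: hp.
by rewrite linearD; apply: hD.
Qed.

Lemma odE z : od z = q (Ki BE BE z).
Proof. by rewrite odot.unlock. Qed.

Lemma qE z : q z = od (Km BE BE z).
Proof. by rewrite odE (KmapK OmV). Qed.

Lemma od_surj t : exists z, t = od z.
Proof.
elim/tensA_ind: t => [m n'|x y [z ->] [z' ->]]; first by exists (Km BE BE (m ⊗ n')); rewrite qE.
by exists (z + z'); rewrite linearD.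
Qed.

Lemma od_ind (P : T -> Prop) : (forall m n', P (od (m ⊗ n'))) ->
  (forall x y, P x -> P y -> P (x + y)) -> forall t, P t.
Proof.
move=> hp hD t; have [z ->] := od_surj t.
elim/tens_ind: z => [a b|s t' hs ht]; first exact: hp.
by rewrite linearD; apply: hD.
Qed.

(** The deformed tensor square is defined by balancedness for the twisted actions; [trilinear_inv]
    converts this into balancedness for the classical ones. *)
Lemma od_balanced (m e : E) (a : A) : od (kact a m ⊗ e) = od (m ⊗ kact a e).
Proof.
have hyp z : q (ptmap (actR G \o Km BE BA) id z) =
    q (ptmap id (actL G \o Km BA BE) (passoc BE BA BE z)).
  elim/tens_ind: z => [u p|u v hu hv]; last by rewrite !linearD hu hv.
  elim/tens_ind: u => [m' a'|u v hu hv]; last by rewrite tensDl !linearD hu hv.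
  rewrite tmapEI tassocE tmapIE /= -(lactBE a' p) -(ractBE a' m').
  rewrite bq.unlock; apply: (@qpi_eq _ _ _ _ _ _ (balanced_rel_intro (E := EB) m' a' p)).
  by rewrite tpureE.
have := @trilinear_inv BE BA BE BE BE T (actR G) q (actL G) q biequiv_actR biequiv_actL hyp ((m ⊗ a) ⊗ e).
by rewrite tmapEI tassocE tmapIE actRE actLE !odE.
Qed.

(** A classically balanced map precomposed with [Kmap] is balanced for the twisted actions. With
    [od_balanced] this gives the deformed square the universal property of the classical one. *)
Lemma od_univ (Z : lmodType K) (f : {linear tens E E -> Z}) :
  (forall (m e : E) (a : A), f (kact a m ⊗ e) = f (m ⊗ kact a e)) ->
  exists L : {linear T -> Z}, forall z, L (od z) = f z.
Proof.
move=> hf.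
have [|L hL] := @quot_lift_ex _ _ _ (@balanced_rel _ _ EB) (f \o Km BE BE).
  move=> w [m a e]; rewrite tpureE ractBE lactBE linearB /=.
  have hyp z : f (ptmap (actR G) id z) = f (ptmap id (actL G) (passoc BE BA BE z)).
    elim/tens_ind: z => [u p|u v hu hv]; last by rewrite !linearD hu hv.
    elim/tens_ind: u => [m' a'|u v hu hv]; last by rewrite tensDl !linearD hu hv.
    by rewrite tmapEI tassocE tmapIE actRE actLE.
  have := @trilinear BE BA BE BE BE Z (actR G) f (actL G) f biequiv_actR biequiv_actL hyp ((m ⊗ a) ⊗ e).
  by rewrite tmapEI tassocE tmapIE /= => ->; rewrite subrr.
by exists L => z; rewrite odE bq.unlock [LHS]hL /= (KinvK VOm).
Qed.

End Deformed.

(** * Compatibility of the twist with diagonal coactions *)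

Section MidBilin.
Variables (K : fieldType) (M N A B : lmodType K).

Lemma bilin_mid1 (m : M) (a : A) : bilinear_for *:%R *:%R (fun (n : N) (b : B) => (m ⊗ n) ⊗ (a ⊗ b)).
Proof. by apply: mk_bilin => e x y z; rewrite ?(tpurePl, tpurePr). Qed.

Lemma bilin_mid2 (v : tens N B) : bilinear_for *:%R *:%R
  (fun (m : M) (a : A) => plift (fun (n : N) (b : B) => (m ⊗ n) ⊗ (a ⊗ b)) v).
Proof.
apply: mk_bilin => e x y z.
all: elim/tens_ind: v => [n0 b|t t' ht ht']; last by rewrite !linearD ht ht' addrACA.
all: rewrite !pliftE; try exact: bilin_mid1.
all: by rewrite ?(tpurePl, tpurePr).
Qed.

Lemma bilin_mid3 : bilinear_for *:%R *:%R
  (fun (u : tens M A) (v : tens N B) => plift (fun (m : M) (a : A) => plift (fun (n : N) (b : B) => (m ⊗ n) ⊗ (a ⊗ b)) v) u).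
Proof.
apply: mk_bilin => e x y z; first by rewrite linearP.
elim/tens_ind: x => [m0 a|t t' ht ht']; last by rewrite !linearD ht ht' addrACA.
by rewrite !pliftE; try exact: bilin_mid2; rewrite linearP.
Qed.
End MidBilin.

(** Middle-four interchange, which collects the function factors of two coactions without
    multiplying them yet. *)
HB.lock Definition mid (K : fieldType) (M N A B : lmodType K) :
    {linear tens (tens M A) (tens N B) -> tens (tens M N) (tens A B)} :=
  plift (fun (u : tens M A) (v : tens N B) =>
    plift (fun (m : M) (a : A) => plift (fun (n : N) (b : B) => (m ⊗ n) ⊗ (a ⊗ b)) v) u).

Lemma midE (K : fieldType) (M N A B : lmodType K) (m : M) (a : A) (n : N) (b : B) :
  mid M N A B ((m ⊗ a) ⊗ (n ⊗ b)) = (m ⊗ n) ⊗ (a ⊗ b).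
Proof.
rewrite mid.unlock pliftE; last exact: bilin_mid3.
rewrite pliftE; last exact: bilin_mid2.
by rewrite pliftE //; exact: bilin_mid1.
Qed.

Section MiddleFour.
Variables (K : fieldType) (n : nat) (G : linAlgGroup K n).
Local Notation A := (coord_hopf G).
Local Notation H := (rdual_type A).

Lemma mid_tco2 (M N : lmodType K) (u : tens M A) (v : tens N A) :
  tco2 u v = ptmap id (mulL G) (mid M N A A (u ⊗ v)).
Proof.
elim/tens_ind: u => [m a|u u' hu hu']; last by rewrite tco2Dl hu hu' tensDl !linearD.
elim/tens_ind: v => [n' b|v v' hv hv']; last by rewrite tco2Dr hv hv' tensDr !linearD.
by rewrite tco2E midE tmapIE mulLE.
Qed.

Lemma co_act s (M : lmodType K) (c : comod_on G s M) phi m : co c (cact c phi m) = ptmap id (cact (regcomod G s) phi) (co c m).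
Proof.
rewrite co_ctr; elim/tens_ind: (co c m) => [u a|u v hu hv]; last by rewrite !linearD hu hv.
by rewrite !tmapIE actE.
Qed.

(** By coassociativity, acting on the module factor of a coaction translates its function factor
    from the opposite side, hence [~~ s]. In [co_act] the action precedes the coaction and the side
    is kept. *)
Lemma act_co s (M : lmodType K) (c : comod_on G s M) phi m : ptmap (cact c phi) id (co c m) =
  ptmap id (cact (regcomod G (~~ s)) phi) (co c m).
Proof.
apply: tensA_sep => x; rewrite ctr_tmap ctr_tmapr -actE.
rewrite [RHS]/= -actE.
apply: act_comp => a.
rewrite -[LHS]/(ev x (cact (regcomod G (~~ s)) phi a)) actE ev_ctr.
by rewrite -[co _ a]/(comulS G (~~ s) a); case: s c; rewrite /= ?ev2_flip.
Qed.

Section OneSide.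
Variables (s : bool) (M N : lmodType K) (c : comod_on G s M) (d : comod_on G s N).

Definition co4 : {linear tens M N -> tens (tens M N) (tens A A)} :=
  mid M N A A \o ptmap (co c) (co d).

Lemma co4E m n' : co4 (m ⊗ n') = mid M N A A (co c m ⊗ co d n').
Proof. by rewrite /co4 /= tmapLE. Qed.

Lemma tcomod_co4 z : co (tcomod c d) z = ptmap id (mulL G) (co4 z).
Proof.
elim/tens_ind: z => [m n'|u v hu hv]; last by rewrite !linearD hu hv.
by rewrite co4E -mid_tco2 /= tcoE.
Qed.

Lemma mid_tmapr (f g : {linear A -> A}) (u : tens M A) (v : tens N A) :
  mid M N A A (ptmap id f u ⊗ ptmap id g v) = ptmap id (ptmap f g) (mid M N A A (u ⊗ v)).
Proof.
elim/tens_ind: u => [m a|u u' hu hu']; last by rewrite linearD !tensDl !linearD hu hu'.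
elim/tens_ind: v => [n' b|v v' hv hv']; last by rewrite linearD !tensDr !linearD hv hv'.
by rewrite !tmapIE !midE tmapIE tmapLE.
Qed.

Lemma mid_tmapl (f : {linear M -> M}) (g : {linear N -> N}) (u : tens M A) (v : tens N A) :
  mid M N A A (ptmap f id u ⊗ ptmap g id v) = ptmap (ptmap f g) id (mid M N A A (u ⊗ v)).
Proof.
elim/tens_ind: u => [m a|u u' hu hu']; last by rewrite linearD !tensDl !linearD hu hu'.
elim/tens_ind: v => [n' b|v v' hv hv']; last by rewrite linearD !tensDr !linearD hv hv'.
by rewrite !tmapEI !midE tmapEI tmapLE.
Qed.

Lemma op2_pure s' (M' N' : lmodType K) (c' : comod_on G s' M') (d' : comod_on G s' N') h k z :
  op2 c' d' (h ⊗ k) z = ptmap (cact c' (rlin h)) (cact d' (rlin k)) z.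
Proof.
elim/tens_ind: z => [m n'|u v hu hv]; last by rewrite !linearD hu hv.
by rewrite op2E tmapLE.
Qed.

Lemma tmapr_op2D (U V W : lmodType K) s' (c' : comod_on G s' V) (d' : comod_on G s' W) t t' (z : tens U (tens V W)) :
  ptmap id (op2 c' d' (t + t')) z = ptmap id (op2 c' d' t) z + ptmap id (op2 c' d' t') z.
Proof.
elim/tens_ind: z => [m n'|u v hu hv]; last by rewrite !linearD hu hv addrACA.
by rewrite !tmapIE op2D tensDr.
Qed.

Lemma tmapl_op2D (U V W : lmodType K) s' (c' : comod_on G s' V) (d' : comod_on G s' W) t t' (z : tens (tens V W) U) :
  ptmap (op2 c' d' (t + t')) id z = ptmap (op2 c' d' t) id z + ptmap (op2 c' d' t') id z.
Proof.
elim/tens_ind: z => [m n'|u v hu hv]; last by rewrite !linearD hu hv addrACA.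
by rewrite !tmapEI op2D tensDl.
Qed.

Lemma tmapr_ext (U V W : lmodType K) (f g : {linear V -> W}) (z : tens U V) :
  f =1 g -> ptmap id f z = ptmap id g z.
Proof.
move=> e; elim/tens_ind: z => [m n'|u v hu hv]; last by rewrite !linearD hu hv.
by rewrite !tmapIE e.
Qed.

Lemma tmapl_ext (U V W : lmodType K) (f g : {linear V -> W}) (z : tens V U) :
  f =1 g -> ptmap f id z = ptmap g id z.
Proof.
move=> e; elim/tens_ind: z => [m n'|u v hu hv]; last by rewrite !linearD hu hv.
by rewrite !tmapEI e.
Qed.

Lemma co4_op2 t z : co4 (op2 c d t z) =
  ptmap id (op2 (regcomod G s) (regcomod G s) t) (co4 z).
Proof.
elim/tens_ind: t => [h k|u v hu hv]; last by rewrite op2D linearD hu hv tmapr_op2D.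
rewrite (tmapr_ext _ (op2_pure _ _ h k)).
elim/tens_ind: z => [m n'|u v hu hv]; last by rewrite !linearD hu hv.
by rewrite op2E !co4E !co_act mid_tmapr.
Qed.

Lemma op2_co4 t z : ptmap (op2 c d t) id (co4 z) =
  ptmap id (op2 (regcomod G (~~ s)) (regcomod G (~~ s)) t) (co4 z).
Proof.
elim/tens_ind: t => [h k|u v hu hv]; last by rewrite tmapr_op2D tmapl_op2D hu hv.
rewrite (tmapr_ext _ (op2_pure _ _ h k)) (tmapl_ext _ (op2_pure _ _ h k)).
elim/tens_ind: z => [m n'|u v hu hv]; last by rewrite !linearD hu hv.
by rewrite !co4E -mid_tmapr -!act_co mid_tmapl.
Qed.

Lemma co4_op2' s' (c' : comod_on G s' M) (d' : comod_on G s' N) t z :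
  (forall x y m, pact c x (pact c' y m) = pact c' y (pact c x m)) ->
  (forall x y m, pact d x (pact d' y m) = pact d' y (pact d x m)) ->
  co4 (op2 c' d' t z) = ptmap (op2 c' d' t) id (co4 z).
Proof.
move=> hc hd; elim/tens_ind: t => [h k|u v hu hv]; last by rewrite op2D linearD hu hv tmapl_op2D.
rewrite (tmapl_ext _ (op2_pure _ _ h k)).
elim/tens_ind: z => [m n'|u v hu hv]; last by rewrite !linearD hu hv.
rewrite op2E !co4E -mid_tmapl; congr (mid _ _ _ _ (_ ⊗ _)).
  apply/esym/equiv_co => x m'; apply/esym/(act_equiv (f := pact c x)) => y m''; exact: hc.
apply/esym/equiv_co => x m'; apply/esym/(act_equiv (f := pact d x)) => y m''; exact: hd.
Qed.

End OneSide.

Section BothSides.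
Variables (Om Om' : tens H H).
Hypothesis OmV : @tmul2 K (rdual A) Om Om' = rdual_one A ⊗ rdual_one A.
Hypothesis VOm : @tmul2 K (rdual A) Om' Om = rdual_one A ⊗ rdual_one A.
Local Notation Km := (Kmap Om Om').
Variables (M N : bicomod G).

Lemma tmap_swap (U V U' V' : lmodType K) (f : {linear U -> U'}) (g : {linear V -> V'}) z :
  ptmap f id (ptmap id g z) = ptmap id g (ptmap f id z).
Proof.
elim/tens_ind: z => [m n'|u v hu hv]; last by rewrite !linearD hu hv.
by rewrite !(tmapIE, tmapEI).
Qed.

Lemma Km_comp (P Q : bicomod G) (U : lmodType K) (z : tens U (tens P Q)) :
  ptmap id (Km P Q) z = ptmap id (op2 (bL P) (bL Q) Om) (ptmap id (op2 (bR P) (bR Q) Om') z).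
Proof. by rewrite tmap_compr; apply: tmapr_ext => u; rewrite KmapE. Qed.

(** The deformed diagonal coaction multiplies functions after their own [Kmap]. One half of that
    twist passes through the coaction onto z; the other becomes an operator on the module factors
    and cancels a half of [Kmap M N]. What remains is [Kmap] applied before the coaction. *)
Lemma co4_KmL z :
  ptmap (Km M N) id (ptmap id (Km (BA G) (BA G)) (co4 (bL M) (bL N) z)) = co4 (bL M) (bL N) (Km M N z).
Proof.
rewrite Km_comp -(op2_co4 (bL M) (bL N)) -tmap_swap -(co4_op2 (bL M) (bL N)) tmap_compl.
rewrite (tmapl_ext (g := op2 (bR M) (bR N) Om')); last first.
  by move=> u /=; rewrite KmapE op2_LR (op2L_K VOm).
rewrite -co4_op2'; last 2 first.
- by move=> x y m; rewrite bLR.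
- by move=> x y m; rewrite bLR.
by rewrite KmapE op2_LR.
Qed.

Lemma co4_KmR z :
  ptmap (Km M N) id (ptmap id (Km (BA G) (BA G)) (co4 (bR M) (bR N) z)) = co4 (bR M) (bR N) (Km M N z).
Proof.
rewrite Km_comp -(co4_op2 (bR M) (bR N)) -(op2_co4 (bR M) (bR N)) tmap_compl.
rewrite (tmapl_ext (g := op2 (bL M) (bL N) Om)); last first.
  by move=> u /=; rewrite KmapE (op2R_VK VOm).
rewrite -co4_op2'; last 2 first.
- by move=> x y m; rewrite bLR.
- by move=> x y m; rewrite bLR.
by rewrite KmapE.
Qed.

End BothSides.
End MiddleFour.

Section TensorSquare.
Variables (K : fieldType) (n : nat) (G : linAlgGroup K n).
Local Notation A := (coord_hopf G).
Local Notation H := (rdual_type A).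
Local Notation E := (kahler A).
Local Notation BE := (BE G).
Local Notation BA := (BA G).
Variables (Om Om' : tens H H).
Hypothesis OmV : @tmul2 K (rdual A) Om Om' = rdual_one A ⊗ rdual_one A.
Hypothesis VOm : @tmul2 K (rdual A) Om' Om = rdual_one A ⊗ rdual_one A.
Hypothesis cOm : @dual_2cocycle K A Om.
Local Notation Km := (Kmap Om Om').
Local Notation EB := (deformed_calculus Om).
Local Notation B := (deformed_hopf Om).
Local Notation T := (tensA EB).
Local Notation q := (bq Om).
Local Notation od := (odot Om Om').

Section Side.
Variable s : bool.
Let kE := kcomod G s.

Lemma coT_ex : exists L : {linear T -> tens T A}, forall z, L (od z) = ptmap od id (co (tcomod kE kE) z).
Proof.
have [|L hL] := @od_univ K n G Om Om' OmV VOm cOm _ (ptmap od id \o co (tcomod kE kE)); last by exists L.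
move=> m e a; apply: tensA_sep => x.
rewrite !ctr_tmap -!actE -!/(pact _ x) !pact_tens !pact_kact.
exact: od_balanced.
Qed.

Definition coT : {linear T -> tens T A} := projT1 (cid coT_ex).
Lemma coTE z : coT (od z) = ptmap od id (co (tcomod kE kE) z).
Proof. by rewrite /coT; case: (cid _). Qed.

Lemma ctr_coT x z : ctr T (ev x) (coT (od z)) = od (pact (tcomod kE kE) x z).
Proof. by rewrite coTE ctr_tmap -actE. Qed.

Fact coT_1 t : ctr T (ev (point1 G)) (coT t) = t.
Proof. by have [z ->] := od_surj OmV t; rewrite ctr_coT pact1. Qed.

Fact coT_M x y t : ctr T (ev x) (coT (ctr T (ev y) (coT t))) = ctr T (ev (smul s x y)) (coT t).
Proof. by have [z ->] := od_surj OmV t; rewrite !ctr_coT pactM. Qed.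

Definition comodT : comod_on G s T := Comod coT_1 coT_M.

Lemma pact_od x z : pact comodT x (od z) = od (pact (tcomod kE kE) x z).
Proof. by rewrite /pact actE; exact: ctr_coT. Qed.
End Side.

Fact T_LR x y t : pact (comodT false) x (pact (comodT true) y t) =
  pact (comodT true) y (pact (comodT false) x t).
Proof. by have [z ->] := od_surj OmV t; rewrite !pact_od (@btens_LR _ _ _ BE BE). Qed.

Definition BT : bicomod G := Bicomod T_LR.

Lemma biequiv_od : biequiv (M := btens BE BE) (N := BT) od.
Proof. by split=> x z; rewrite /= pact_od. Qed.

Lemma coT_bq s (m e : E) :
  (forall z, ptmap (Km BE BE) id (ptmap id (Km BA BA) (co4 (kcomod G s) (kcomod G s) z)) =
     co4 (kcomod G s) (kcomod G s) (Km BE BE z)) ->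
  coT s (q (m ⊗ e)) = ptmap q (mulL G \o Km BA BA) (mid E E A A (kco G s m ⊗ kco G s e)).
Proof.
move=> hs; rewrite (qE OmV) coTE tcomod_co4 -hs -[mid _ _ _ _ _](co4E (kcomod G s) (kcomod G s)).
move: (co4 _ _ _) => w.
elim/tens_ind: w => [u p|z z' hz hz']; last by rewrite !linearD hz hz'.
by rewrite !(tmapEI, tmapIE, tmapLE) (qE OmV).
Qed.

Lemma lcoE (e : EB) : lco EB e = tflip _ _ (kco G false e).
Proof. exact: kahler_lcoE. Qed.
Lemma rcoE (e : EB) : rco EB e = kco G true e.
Proof. exact: kahler_rcoE. Qed.

Let phiL (a b : B) (m e : EB) : tens B T := hmul a b ⊗ q ((m : E) ⊗ (e : E)).
Let phiR (a b : B) (m e : EB) : tens T B := q ((m : E) ⊗ (e : E)) ⊗ hmul a b.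

Lemma lco2_gen (u v : tens E A) :
  plift (fun (a : B) (m0 : EB) => plift (fun (b : B) (n0 : EB) => phiL a b m0 n0) (tflip E A v)) (tflip E A u)
  = tflip _ _ (ptmap q (mulL G \o Km BA BA) (mid E E A A (u ⊗ v))).
Proof.
have b1 (a : B) (m0 : EB) : bilinear_for *:%R *:%R (fun (b : B) (n0 : EB) => phiL a b m0 n0).
  apply: mk_bilin => c x y z; rewrite /phiL.
    by rewrite !(hmulBE OmV VOm) tpurePr linearP linearP tpurePl.
  by rewrite tpurePr linearP tpurePr.
have b2 (t : tens A E) : bilinear_for *:%R *:%R (fun (a : B) (m0 : EB) => plift (fun (b : B) (n0 : EB) => phiL a b m0 n0) t).
{ apply: mk_bilin => c x y z.
  all: elim/tens_ind: t => [b e|t t' ht ht']; last by rewrite !linearD ht ht' addrACA.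
  all: rewrite !pliftE //; try exact: b1; rewrite /phiL.
    by rewrite !(hmulBE OmV VOm) tpurePl linearP linearP tpurePl.
  by rewrite tpurePl linearP tpurePr. }
elim/tens_ind: u => [m a|u u' hu hu']; last by rewrite tensDl !linearD hu hu'.
rewrite tflipE pliftE; last exact: b2.
elim/tens_ind: v => [e b|v v' hv hv']; last by rewrite tensDr !linearD hv hv'.
rewrite tflipE pliftE; last exact: b1.
by rewrite midE tmapLE tflipE /phiL (hmulBE OmV VOm).
Qed.

Lemma rco2_gen (u v : tens E A) :
  plift (fun (m0 : EB) (a : B) => plift (fun (n0 : EB) (b : B) => phiR a b m0 n0) v) u
  = ptmap q (mulL G \o Km BA BA) (mid E E A A (u ⊗ v)).
Proof.
have b1 (a : B) (m0 : EB) : bilinear_for *:%R *:%R (fun (n0 : EB) (b : B) => phiR a b m0 n0).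
  apply: mk_bilin => c x y z; rewrite /phiR.
    by rewrite tpurePr linearP tpurePl.
  by rewrite !(hmulBE OmV VOm) tpurePr linearP linearP tpurePr.
have b2 (t : tens E A) : bilinear_for *:%R *:%R (fun (m0 : EB) (a : B) => plift (fun (n0 : EB) (b : B) => phiR a b m0 n0) t).
{ apply: mk_bilin => c x y z.
  all: elim/tens_ind: t => [b e|t t' ht ht']; last by rewrite !linearD ht ht' addrACA.
  all: rewrite !pliftE //; try exact: b1; rewrite /phiR.
    by rewrite tpurePl linearP tpurePl.
  by rewrite !(hmulBE OmV VOm) tpurePl linearP linearP tpurePr. }
elim/tens_ind: u => [m a|u u' hu hu']; last by rewrite tensDl !linearD hu hu'.
rewrite pliftE; last exact: b2.
elim/tens_ind: v => [e b|v v' hv hv']; last by rewrite tensDr !linearD hv hv'.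
rewrite pliftE; last exact: b1.
by rewrite midE tmapLE /phiR (hmulBE OmV VOm).
Qed.

Lemma tpureAf : @tpureA K B EB = (fun m e => q ((m : E) ⊗ (e : E))).
Proof. by apply/funext => m; apply/funext => e; exact: tpureAE. Qed.

(** [coT] is the classical diagonal coaction carried over by [odot]; [co4_KmL] shows that on
    deformed pure tensors it takes the values prescribed for [lco2]. *)
Lemma lco2E t : lco2 EB t = tflip T A (coT false t).
Proof.
have F (m e : E) : tflip T A (coT false (q (m ⊗ e))) =
   plift (fun (a : B) (m0 : EB) => plift (fun (b : B) (n0 : EB) => phiL a b m0 n0) (lco EB e)) (lco EB m).
  rewrite !lcoE lco2_gen -coT_bq // => z.
  exact: (co4_KmL VOm).
elim/tensA_ind: t => [m e|x y hx hy]; last by rewrite !linearD hx hy.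
rewrite F /lco2 tpureE tliftEp tpureAf.
apply: (lin_extE (gen := fun m e : EB => q ((m : E) ⊗ (e : E)))).
by exists (tflip T A \o coT false) => x y; rewrite -F.
Qed.

Lemma rco2E t : rco2 EB t = coT true t.
Proof.
have F (m e : E) : coT true (q (m ⊗ e)) =
   plift (fun (m0 : EB) (a : B) => plift (fun (n0 : EB) (b : B) => phiR a b m0 n0) (rco EB e)) (rco EB m).
  rewrite !rcoE rco2_gen -coT_bq // => z.
  exact: (co4_KmR VOm).
elim/tensA_ind: t => [m e|x y hx hy]; last by rewrite !linearD hx hy.
rewrite F /rco2 tpureE tliftEp tpureAf.
apply: (lin_extE (gen := fun m e : EB => q ((m : E) ⊗ (e : E)))).
by exists (coT true) => x y; rewrite -F.
Qed.

End TensorSquare.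

(** * Actions and flip on the deformed tensor square *)

Section SquareActions.
Variables (K : fieldType) (n : nat) (G : linAlgGroup K n).
Local Notation A := (coord_hopf G).
Local Notation H := (rdual_type A).
Local Notation E := (kahler A).
Local Notation BE := (BE G).
Local Notation BA := (BA G).
Variables (Om Om' : tens H H).
Hypothesis OmV : @tmul2 K (rdual A) Om Om' = rdual_one A ⊗ rdual_one A.
Hypothesis VOm : @tmul2 K (rdual A) Om' Om = rdual_one A ⊗ rdual_one A.
Hypothesis cOm : @dual_2cocycle K A Om.
Local Notation Km := (Kmap Om Om').
Local Notation EB := (deformed_calculus Om).
Local Notation B := (deformed_hopf Om).
Local Notation T := (tensA EB).
Local Notation q := (bq Om).
Local Notation od := (odot Om Om').
Local Notation BT := (BT OmV VOm cOm).

Lemma lcT_ex : exists L : {linear tens A T -> T},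
  forall a m e, L (a ⊗ od (m ⊗ e)) = od (kact a m ⊗ e).
Proof.
have h (a : A) : exists L : {linear T -> T}, forall z, L (od z) = od (ptmap (kact a) id z).
  apply: (od_univ OmV VOm cOm (f := od \o ptmap (kact a) id)) => m e b /=.
  rewrite !tmapEI -(od_balanced OmV VOm cOm); congr (od (_ ⊗ _)).
  by rewrite !kahler_actA mulAC.
pose La a := projT1 (cid (h a)).
have LE a z : La a (od z) = od (ptmap (kact a) id z) by rewrite /La; case: (cid _).
have bl : bilinear_for *:%R *:%R (fun a t => La a t).
  apply: mk_bilin => c x y z; last by rewrite linearP.
  have [w ->] := od_surj OmV z; rewrite !LE.
  elim/tens_ind: w => [m e|w w' hw hw']; last by rewrite !linearD hw hw' addrACA.
  by rewrite !tmapEI (bilinl _ _ _ _ (kahler_act_bilin G)) tpurePl linearP.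
exists (plift (fun a t => La a t)) => a m e.
by rewrite pliftE // LE tmapEI.
Qed.

(** Classical multiplication carried over by [odot]; unlike [lact2] and [ract2], its left and right
    versions agree ([lcT_rcT]). *)
Definition lcT := projT1 (cid lcT_ex).
Lemma lcTE a m e : lcT (a ⊗ od (m ⊗ e)) = od (kact a m ⊗ e).
Proof. by rewrite /lcT; case: (cid _). Qed.

Lemma rcT_ex : exists L : {linear tens T A -> T},
  forall a m e, L (od (m ⊗ e) ⊗ a) = od (m ⊗ kact a e).
Proof.
exists (lcT \o tflip T A) => a m e /=.
by rewrite tflipE lcTE (od_balanced OmV VOm cOm).
Qed.

Definition rcT := projT1 (cid rcT_ex).
Lemma rcTE a m e : rcT (od (m ⊗ e) ⊗ a) = od (m ⊗ kact a e).
Proof. by rewrite /rcT; case: (cid _). Qed.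

Lemma sig_ex : exists L : {linear T -> T}, forall z, L (od z) = od (tflip E E z).
Proof.
apply: (od_univ OmV VOm cOm (f := od \o tflip E E)) => m e a /=.
by rewrite !tflipE (od_balanced OmV VOm cOm).
Qed.

(** The classical flip seen on the deformed square; it turns out to be the canonical braiding
    ([braidingE]). *)
Definition sig := projT1 (cid sig_ex).
Lemma sigE z : sig (od z) = od (tflip E E z).
Proof. by rewrite /sig; case: (cid _). Qed.

Lemma sigK t : sig (sig t) = t.
Proof. by have [z ->] := od_surj OmV t; rewrite !sigE tflipK. Qed.

Lemma pact_odE s x m e : pact (comodT OmV VOm cOm s) x (od (m ⊗ e)) =
  od (pact (kcomod G s) x m ⊗ pact (kcomod G s) x e).
Proof. by rewrite pact_od pact_tens. Qed.

Lemma biequiv_rcT : biequiv (M := btens BT BA) (N := BT) rcT.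
Proof.
apply: biequiv_bilin => x t a.
all: elim/(od_ind OmV): t => [m e|u v hu hv]; last by rewrite linearD !tensDl !linearD hu hv.
all: by rewrite pact_odE !rcTE pact_odE pact_kact.
Qed.

Lemma biequiv_sig : biequiv (M := BT) (N := BT) sig.
Proof.
split=> x t.
all: elim/(od_ind OmV): t => [m e|u v hu hv]; last by rewrite !linearD hu hv.
all: by rewrite pact_odE !sigE !tflipE pact_odE.
Qed.

Lemma q_lact (a : B) (m e : E) : q ((lact a (m : EB) : E) ⊗ e) = lcT (Km BA BT ((a : A) ⊗ q (m ⊗ e))).
Proof.
have hyp z : od (ptmap (actL G) id z) = lcT (ptmap id od (passoc A E E z)).
  elim/tens_ind: z => [u p|u v hu hv]; last by rewrite !linearD hu hv.
  elim/tens_ind: u => [b m'|u v hu hv]; last by rewrite tensDl !linearD hu hv.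
  by rewrite tmapEI tassocE tmapIE actLE lcTE.
have := @trilinear K n G Om Om' OmV VOm cOm BA BE BE BE BT T (actL G) od od lcT (biequiv_actL G) (biequiv_od OmV VOm cOm) hyp (((a : A) ⊗ m) ⊗ e).
rewrite tmapEI tassocE tmapIE /= -(qE OmV) -(qE OmV) => <-.
by rewrite -(lactBE OmV VOm).
Qed.

Lemma q_ract (a : B) (m e : E) : q (m ⊗ (ract (e : EB) a : E)) = rcT (Km BT BA (q (m ⊗ e) ⊗ (a : A))).
Proof.
have hyp z : rcT (ptmap od id z) = od (ptmap id (actR G) (passoc E E A z)).
  elim/tens_ind: z => [u p|u v hu hv]; last by rewrite !linearD hu hv.
  elim/tens_ind: u => [b m'|u v hu hv]; last by rewrite tensDl !linearD hu hv.
  by rewrite tmapEI tassocE tmapIE actRE rcTE.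
have := @trilinear K n G Om Om' OmV VOm cOm BE BE BT BA BE T od rcT (actR G) od (biequiv_od OmV VOm cOm) (biequiv_actR G) hyp ((m ⊗ e) ⊗ (a : A)).
rewrite tmapEI tassocE tmapIE /= -(qE OmV) -(qE OmV) => ->.
by rewrite -(ractBE OmV VOm).
Qed.

Lemma lact2E (a : B) t : lact2 EB a t = lcT (Km BA BT ((a : A) ⊗ t)).
Proof.
have bl : linear (fun t : T => lcT (Km BA BT ((a : A) ⊗ t))).
  by move=> c x y; rewrite tpurePr !linearP.
pose L : {linear T -> T} := HB.pack (fun t : T => lcT (Km BA BT ((a : A) ⊗ t))) (GRing.isLinear.Build _ _ _ _ _ bl).
rewrite -[RHS]/(L t).
elim/tensA_ind: t => [m e|x y hx hy]; last by rewrite !linearD hx hy.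
rewrite /lact2 tpureAf [RHS]/= -q_lact.
apply: (lin_extE (gen := fun m e : EB => q ((m : E) ⊗ (e : E))) (f := fun m e : EB => q ((lact a m : E) ⊗ (e : E)))).
by exists L => x y; rewrite q_lact.
Qed.

Lemma ract2E (a : B) t : ract2 t a = rcT (Km BT BA (t ⊗ (a : A))).
Proof.
have bl : linear (fun t : T => rcT (Km BT BA (t ⊗ (a : A)))).
  by move=> c x y; rewrite tpurePl !linearP.
pose L : {linear T -> T} := HB.pack (fun t : T => rcT (Km BT BA (t ⊗ (a : A)))) (GRing.isLinear.Build _ _ _ _ _ bl).
rewrite -[RHS]/(L t) /ract2 tpureAf.
elim/tensA_ind: t => [m e|x y hx hy]; last by rewrite !linearD hx hy.
rewrite [RHS]/= -q_ract.
apply: (lin_extE (gen := fun m e : EB => q ((m : E) ⊗ (e : E))) (f := fun m e : EB => q ((m : E) ⊗ (ract e a : E)))).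
by exists L => x y; rewrite q_ract.
Qed.

Lemma ract2_q (a : B) (m e : E) : ract2 (q (m ⊗ e)) a = q (m ⊗ (ract (e : EB) a : E)).
Proof. by rewrite ract2E q_ract. Qed.

Lemma q_balanced (a : B) (m e : EB) : q ((ract m a : E) ⊗ (e : E)) = q ((m : E) ⊗ (lact a e : E)).
Proof.
rewrite bq.unlock; apply: (@qpi_eq _ _ _ _ _ _ (balanced_rel_intro (E := EB) m a e)).
by rewrite tpureE.
Qed.

Lemma sig_lcT a t : sig (lcT (a ⊗ t)) = lcT (a ⊗ sig t).
Proof.
elim/(od_ind OmV): t => [m e|u v hu hv]; last by rewrite tensDr !linearD tensDr !linearD hu hv.
by rewrite lcTE !sigE !tflipE lcTE (od_balanced OmV VOm cOm).
Qed.

Lemma sig_rcT a t : sig (rcT (t ⊗ a)) = rcT (sig t ⊗ a).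
Proof.
elim/(od_ind OmV): t => [m e|u v hu hv]; last by rewrite tensDl !linearD tensDl !linearD hu hv.
by rewrite rcTE !sigE !tflipE rcTE (od_balanced OmV VOm cOm).
Qed.

Lemma sig_bimod : is_bimod_endo (E := EB) sig.
Proof.
split=> a t.
  rewrite !lact2E.
  have e z : sig (lcT z) = lcT (ptmap id sig z).
    elim/tens_ind: z => [u p|u v hu hv]; last by rewrite !linearD hu hv.
    by rewrite sig_lcT tmapIE.
  by rewrite e [X in lcT X](K_natr Om Om' (M := BA) _ biequiv_sig) tmapIE.
rewrite !ract2E.
have e z : sig (rcT z) = rcT (ptmap sig id z).
  elim/tens_ind: z => [u p|u v hu hv]; last by rewrite !linearD hu hv.
  by rewrite sig_rcT tmapEI.
by rewrite e [X in rcT X](K_natl Om Om' (N := BA) _ biequiv_sig) tmapEI.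
Qed.

Hypothesis nOm : @normalised K A Om.

Lemma linvP (e : EB) : (e \in lcoinv_pred (E := EB)) <-> linv (M := BE) e.
Proof.
split=> [/eqP|] h.
  move=> x; rewrite /pact actE.
  suff -> : co (bL BE) e = (e : E) ⊗ (regfun_one G : A) by rewrite ctrE scale1r.
  by rewrite -[LHS]tflipK -[tflip _ _ (co _ e)](lcoE e) h tpureE tflipE.
apply/eqP; rewrite lcoE tpureE -[RHS]tflipK tflipE; congr (tflip _ _ _).
by apply: tensA_sep => x; rewrite -[LHS](actE (bL BE)) [LHS]h ctrE scale1r.
Qed.

Lemma rinvP (e : EB) : rcoinvariant e <-> rinv (M := BE) e.
Proof.
rewrite /rcoinvariant rcoE tpureE; split=> h.
  by move=> x; rewrite /pact actE [co _ _]h ctrE scale1r.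
by apply: tensA_sep => x; rewrite -[LHS](actE (bR BE)) [LHS]h ctrE scale1r.
Qed.

(** One factor is left- and the other right-invariant, so [Kmap] fixes the tensor in either order
    and the deformed tensors coincide with classical ones. *)
Lemma sig_coinv (w : lcoinv EB) (e : EB) : rcoinvariant e ->
  sig (tpureA w e) = tpureA e w.
Proof.
move=> /rinvP he; have hw : linv (M := BE) (lcoinv_val w) by apply/linvP; case: w.
rewrite !tpureAE !(qE OmV) (K_inv VOm nOm (M := BE) (N := BE)); [|by left|by right].
by rewrite sigE tflipE (K_inv VOm nOm (M := BE) (N := BE)); [|by right|by left].
Qed.

End SquareActions.

(** * Invariant forms *)

Section Antipode.
Variables (K : fieldType) (n : nat) (G : linAlgGroup K n).
Local Notation A := (coord_hopf G).
Local Notation E := (kahler A).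
Local Notation pt := (Defs.point G).
Local Notation one := (regfun_one G : A).

Lemma apt_ex : exists L : {linear A -> A}, forall a x, L a x = a (pointV x).
Proof.
have [] := @linear_choice K A A pt (@ev K n G) (fun x => ev (pointV x)).
- by move=> a; exact: ev_sep.
- by move=> a; have [b hb] := hasfun_antipode a; exists b.
- by move=> L hL; exists L => a x; exact: hL.
Qed.

Definition apt : {linear A -> A} := projT1 (cid apt_ex).
Lemma aptE (a : A) x : apt a x = a (pointV x).
Proof. by rewrite /apt; case: (cid _). Qed.

Lemma smulV s (x : pt) : smul s x (pointV x) = point1 G.
Proof. by case: s; rewrite /= ?pointMV ?pointVM. Qed.
Lemma smulVV s (x : pt) : smul s (pointV x) x = point1 G.
Proof. by case: s; rewrite /= ?pointMV ?pointVM. Qed.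
Lemma smul1l s (x : pt) : smul s (point1 G) x = x.
Proof. by case: s; rewrite /= ?pointM1 ?point1M. Qed.

Lemma pointV_uniq s (x y : pt) : smul s x y = point1 G -> y = pointV x.
Proof. by move=> h; rewrite -[y](smul1l s) -(smulVV s x) -smulA h smul1. Qed.

Lemma pointVmul s (x y : pt) : pointV (smul s x y) = smul s (pointV y) (pointV x).
Proof.
apply/esym/(@pointV_uniq s).
by rewrite smulA -(smulA s x y) smulV smul1 smulV.
Qed.

Lemma antipode_l s (a : A) : mulL G (ptmap apt id (comulS G s a)) = (a (point1 G) : K) *: one.
Proof.
apply: regfunP => x; rewrite regfunZ mulr1.
have -> : mulL G (ptmap apt id (comulS G s a)) x = ev2 (ev (pointV x)) (ev x) (comulS G s a).
  rewrite -[LHS]/(ev x _).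
  elim/tens_ind: (comulS G s a) => [u v|u v hu hv]; last by rewrite !linearD hu hv.
  by rewrite tmapEI mulLE ev2E /= aptE.
by rewrite comulSE /= smulVV.
Qed.

Lemma antipode_r s (a : A) : mulL G (ptmap id apt (comulS G s a)) = (a (point1 G) : K) *: one.
Proof.
apply: regfunP => x; rewrite regfunZ mulr1.
have -> : mulL G (ptmap id apt (comulS G s a)) x = ev2 (ev x) (ev (pointV x)) (comulS G s a).
  rewrite -[LHS]/(ev x _).
  elim/tens_ind: (comulS G s a) => [u v|u v hu hv]; last by rewrite !linearD hu hv.
  by rewrite tmapIE mulLE ev2E /= aptE.
by rewrite comulSE /= smulV.
Qed.

Lemma apt_one : apt one = one.
Proof. by apply: regfunP => x; rewrite aptE. Qed.

Section Projection.
Variable s : bool.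
Local Notation kE := (kcomod G s).

(** The map e ↦ e_(0) S(e_(1)), the projection onto invariants in the structure theorem for Hopf
    modules. *)
Definition cproj : {linear E -> E} := actR G \o (ptmap id apt \o co kE).

Lemma cprojE e : cproj e = actR G (ptmap id apt (co kE e)). Proof. by []. Qed.

(** A translation of the module factor passes by [act_co] to the function factor, where the antipode
    turns it into the inverse of the translation already present. *)
Lemma cproj_inv x e : pact kE x (cproj e) = cproj e.
Proof.
rewrite cprojE.
have h z : pact kE x (actR G (ptmap id apt z)) =
    actR G (ptmap id (pact (regcomod G s) x \o apt) (ptmap (pact kE x) id z)).
  elim/tens_ind: z => [u a|u v hu hv]; last by rewrite !linearD hu hv.
  by rewrite tmapEI !tmapIE !actRE pact_kact.
rewrite h act_co tmap_compr; congr (actR G _); apply: tmapr_ext => a.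
apply: regfunP => y; rewrite /= pact_reg !aptE.
rewrite [LHS](pact_reg (~~ s)) pointVmul.
by congr (a _); rewrite -[RHS](smul1l s) -(smulV s x) -smulA; case: (s) => /=; rewrite ?pointMA.
Qed.

Lemma co_coassoc (M : lmodType K) (c : comod_on G s M) m :
  passoc M A A (ptmap (co c) id (co c m)) = ptmap id (comulS G s) (co c m).
Proof.
have sep (t t' : tens M (tens A A)) :
    (forall x y, ctr M (ev2 (ev x) (ev y)) t = ctr M (ev2 (ev x) (ev y)) t') -> t = t'.
  rewrite ctr.unlock => h.
  apply: (tens_sepr (phi := fun p : pt * pt => ev2 (ev p.1) (ev p.2))) => [v hv|p]; last exact: h.
  by apply: (ev2_sep (@ev_sep K n G) (@ev_sep K n G)) => x y; exact: (hv (x, y)).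
apply: sep => x y.
have e1 w : ctr M (ev2 (ev x) (ev y)) (passoc M A A w) = ctr M (ev x) (ctr _ (ev y) w).
  elim/tens_ind: w => [u b|u v hu hv]; last by rewrite !linearD hu hv.
  elim/tens_ind: u => [u a|u v hu hv]; last by rewrite tensDl !linearD hu hv.
  by rewrite tassocE !ctrE ev2E linearZ /= ctrE scalerA mulrC.
rewrite e1 ctr_tmap coM ctr_tmapr; apply: ctr_ext => a.
by rewrite -comulSE.
Qed.

(** Coassociativity brings the leg under the antipode next to the remaining function leg, and
    [antipode_l] collapses the pair to the counit. *)
Lemma cproj_rec e : actR G (ptmap cproj id (co kE e)) = e.
Proof.
have h w : actR G (ptmap (actR G \o ptmap id apt) id w) =
    actR G (ptmap id (mulL G \o ptmap apt id) (passoc E A A w)).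
  elim/tens_ind: w => [u b|u v hu hv]; last by rewrite !linearD hu hv.
  elim/tens_ind: u => [u a|u v hu hv]; last by rewrite tensDl !linearD hu hv.
  have e1 : (actR G \o ptmap id apt) (u ⊗ a) = kact (apt a) u by rewrite /= tmapIE actRE.
  have e2 : (mulL G \o ptmap apt id) (a ⊗ b) = hmul (apt a : A) b by rewrite /= tmapEI mulLE.
  rewrite tassocE tmapEI tmapIE.
  rewrite -[LHS]/(actR G ((actR G \o ptmap id apt) (u ⊗ a) ⊗ b)) -[RHS]/(actR G (u ⊗ (mulL G \o ptmap apt id) (a ⊗ b))).
  by rewrite e1 e2 !actRE kahler_actA mulAC.
have -> : ptmap cproj id (co kE e) = ptmap (actR G \o ptmap id apt) id (ptmap (co kE) id (co kE e)).
  by rewrite tmap_compl; apply: tmapl_ext.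
rewrite h co_coassoc tmap_compr.
rewrite -[RHS](pact1 kE) /pact actE.
elim/tens_ind: (co kE e) => [u a|u v hu hv]; last by rewrite !linearD hu hv.
rewrite tmapIE /= antipode_l actRE ctrE.
have := bilinl (a (point1 G) : K) one 0 u (kahler_act_bilin G).
have -> : kact (0 : A) u = 0.
  by have := bilinl (-1) (0 : A) 0 u (kahler_act_bilin G); rewrite scaler0 addr0 scaleN1r addNr.
by rewrite !addr0 kahler_act1.
Qed.

(** The contribution of b is b_(0) S(b_(1)), which [antipode_r] turns into its value at the
    identity. *)
Lemma cproj_act (b : A) e : cproj (kact b e) = (b (point1 G) : K) *: cproj e.
Proof.
have h u v : actR G (ptmap id apt (ptmap (actL G) id (tco2 u v))) =
    kact (mulL G (ptmap id apt u)) (actR G (ptmap id apt v)).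
  have Dl (x y : A) e' : kact (x + y) e' = kact x e' + kact y e'.
    by rewrite -[x]scale1r (bilinl _ _ _ _ (kahler_act_bilin G)) !scale1r.
  elim/tens_ind: u => [b0 b1|x y hx hy]; last by rewrite tco2Dl !linearD Dl hx hy.
  elim/tens_ind: v => [e0 a1|x y hx hy]; last by rewrite tco2Dr !linearD hx hy.
  rewrite tco2E tmapEI !tmapIE !actRE actLE mulLE !kahler_actA.
  congr (kact _ _); apply: regfunP => x /=; rewrite !aptE /=.
  by rewrite mulrC mulrA.
rewrite cprojE.
have -> : co kE (kact b e) = ptmap (actL G) id (tco2 (comulS G s b) (co kE e)).
  rewrite -actLE -[tco2 _ _](tcoE (regcomod G s) kE).
  apply/esym/(@equiv_co K n G s _ _ (tcomod (regcomod G s) kE) kE) => x z.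
  by case: (biequiv_actL G) => hl hr; case: (s); [exact: hr|exact: hl].
rewrite h antipode_r.
have := bilinl (b (point1 G) : K) one 0 (cproj e) (kahler_act_bilin G).
have -> : kact (0 : A) (cproj e) = 0.
  by have := bilinl (-1) (0 : A) 0 (cproj e) (kahler_act_bilin G); rewrite scaler0 addr0 scaleN1r addNr.
by rewrite !addr0 kahler_act1.
Qed.

Lemma co_inv (M : lmodType K) (c : comod_on G s M) m : (forall x, pact c x m = m) -> co c m = m ⊗ one.
Proof. by move=> h; apply: tensA_sep => x; rewrite -actE [LHS]h ctrE scale1r. Qed.

Lemma cproj_id e : (forall x, pact kE x e = e) -> cproj e = e.
Proof. by move=> h; rewrite cprojE (co_inv h) tmapIE actRE apt_one kahler_act1. Qed.

Lemma kah_inv_ind (P : E -> Prop) :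
  (forall a v, (forall x, pact kE x v = v) -> P (kact a v)) ->
  (forall x y, P x -> P y -> P (x + y)) -> forall e, P e.
Proof.
move=> hp hD e; rewrite -[e]cproj_rec.
elim/tens_ind: (co kE e) => [u a|u v hu hv]; last by rewrite !linearD; apply: hD.
by rewrite tmapEI actRE; apply: hp => x; rewrite cproj_inv.
Qed.

End Projection.
End Antipode.

Section Coinvariants.
Variables (K : fieldType) (n : nat) (G : linAlgGroup K n).
Local Notation A := (coord_hopf G).
Local Notation H := (rdual_type A).
Local Notation E := (kahler A).
Local Notation BE := (BE G).
Local Notation BA := (BA G).
Local Notation one := (regfun_one G : A).
Variables (Om Om' : tens H H).
Hypothesis OmV : @tmul2 K (rdual A) Om Om' = rdual_one A ⊗ rdual_one A.
Hypothesis VOm : @tmul2 K (rdual A) Om' Om = rdual_one A ⊗ rdual_one A.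
Hypothesis cOm : @dual_2cocycle K A Om.
Hypothesis nOm : @normalised K A Om.
Local Notation Km := (Kmap Om Om').
Local Notation EB := (deformed_calculus Om).
Local Notation B := (deformed_hopf Om).
Local Notation T := (tensA EB).
Local Notation q := (bq Om).
Local Notation od := (odot Om Om').
Local Notation BT := (BT OmV VOm cOm).
Local Notation rcT := (rcT OmV VOm cOm).
Local Notation sig := (sig OmV VOm cOm).
Local Notation V := (lcoinv EB).
Local Notation L := (kcomod G false).
Local Notation R := (kcomod G true).
Local Notation odb := (od_balanced OmV VOm cOm).

Fact iV_linear : linear (fun v : V => (v : EB) : E).
Proof. by []. Qed.
Lemma iV_ex : exists f : {linear V -> E}, forall v, f v = (v : EB).
Proof. by exists (HB.pack (fun v : V => (v : EB) : E) (GRing.isLinear.Build _ _ _ _ _ iV_linear) : {linear V -> E}). Qed.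
Definition iV := projT1 (cid iV_ex).
Lemma iVE v : iV v = (v : EB). Proof. by rewrite /iV; case: (cid _). Qed.

Lemma iV_inj : injective iV.
Proof. by move=> u v; rewrite !iVE => e; apply: val_inj. Qed.

Lemma iV_inv v x : pact L x (iV v) = iV v.
Proof. by rewrite iVE; have /linvP h : lcoinv_val v \in lcoinv_pred (E := EB) by case: v. Qed.

Lemma pV_ex : exists f : {linear E -> V}, forall e, iV (f e) = cproj G false e.
Proof.
have m e : (cproj G false e : EB) \in lcoinv_pred (E := EB).
  by apply/linvP => x; exact: cproj_inv.
have fl : linear (fun e => LCoinv (m e) : V).
  by move=> a x y; apply: val_inj; exact: linearP.
exists (HB.pack (fun e => LCoinv (m e) : V) (GRing.isLinear.Build _ _ _ _ _ fl) : {linear E -> V}) => e.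
by rewrite iVE.
Qed.

Definition pV : {linear E -> V} := projT1 (cid pV_ex).
Lemma iV_pV e : iV (pV e) = cproj G false e.
Proof. by rewrite /pV; case: (cid _). Qed.

Lemma pV_iV v : pV (iV v) = v.
Proof. by apply: iV_inj; rewrite iV_pV cproj_id // => x; exact: iV_inv. Qed.

Lemma iV_pV_inv e : (forall x, pact L x e = e) -> iV (pV e) = e.
Proof. by move=> h; rewrite iV_pV cproj_id. Qed.

Lemma pV_act (a : A) e : pV (kact a e) = (a (point1 G) : K) *: pV e.
Proof. by apply: iV_inj; rewrite iV_pV cproj_act linearZ /= iV_pV. Qed.

Lemma kahV_ind (P : E -> Prop) : (forall a v, P (kact a (iV v))) ->
  (forall x y, P x -> P y -> P (x + y)) -> forall e, P e.
Proof.
move=> hp hD; apply: (@kah_inv_ind K n G false) => // a v hv.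
by rewrite -(iV_pV_inv hv).
Qed.

Section TrivialComodule.
Variables (s : bool) (M : lmodType K).
Fact triv_linear : linear (fun m : M => m ⊗ one).
Proof. by move=> a x y; rewrite tpurePl. Qed.
Definition triv_co : {linear M -> tens M A} :=
  HB.pack (fun m : M => m ⊗ one) (GRing.isLinear.Build _ _ _ _ _ triv_linear).
Fact triv_1 m : ctr M (ev (point1 G)) (triv_co m) = m.
Proof. by rewrite /= ctrE scale1r. Qed.
Fact triv_M x y m : ctr M (ev x) (triv_co (ctr M (ev y) (triv_co m))) = ctr M (ev (smul s x y)) (triv_co m).
Proof. by rewrite /= !ctrE !scale1r. Qed.
Definition trivc : comod_on G s M := Comod triv_1 triv_M.
Lemma pact_triv x m : pact trivc x m = m.
Proof. by rewrite /pact actE /= ctrE scale1r. Qed.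
End TrivialComodule.

Definition coV : {linear V -> tens V A} := ptmap pV id \o (kco G true \o iV).

Lemma iV_ctr x v : iV (ctr V (ev x) (coV v)) = pact R x (iV v).
Proof.
rewrite /coV ctr_tmap -[ctr _ _ (kco _ _ _)](actE R) iV_pV_inv // => y.
by rewrite -/(pact R x (iV v)) (bLR (b := BE)) iV_inv.
Qed.

Fact coV_1 v : ctr V (ev (point1 G)) (coV v) = v.
Proof. by apply: iV_inj; rewrite iV_ctr pact1. Qed.
Fact coV_M x y v : ctr V (ev x) (coV (ctr V (ev y) (coV v))) = ctr V (ev (smul true x y)) (coV v).
Proof. by apply: iV_inj; rewrite !iV_ctr pactM. Qed.
Definition comodV : comod_on G true V := Comod coV_1 coV_M.

Lemma iV_pact x v : iV (pact comodV x v) = pact R x (iV v).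
Proof. by rewrite {1}/pact actE; exact: iV_ctr. Qed.

Fact V_LR x y v : pact (trivc false V) x (pact comodV y v) = pact comodV y (pact (trivc false V) x v).
Proof. by rewrite !pact_triv. Qed.
(** The left coaction is trivial on left-invariant forms, so for a normalised cocycle only the right
    half of [Kmap] moves anything here. *)
Definition BV : bicomod G := Bicomod V_LR.

Lemma biequiv_iV : biequiv (M := BV) (N := BE) iV.
Proof. by split=> x v; rewrite /= ?pact_triv ?iV_inv ?iV_pact. Qed.

Definition mu : {linear tens V A -> E} := actR G \o ptmap iV id.
Lemma muE v a : mu (v ⊗ a) = kact a (iV v).
Proof. by rewrite /mu /= tmapEI actRE. Qed.
Definition nu : {linear E -> tens V A} := ptmap pV id \o co L.
Lemma nu_mu z : nu (mu z) = z.
Proof.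
elim/tens_ind: z => [v a|x y hx hy]; last by rewrite !linearD hx hy.
apply: tensA_sep => x; rewrite muE /nu ctr_tmap -(actE L) -/(pact L x _) pact_kact pV_act iV_inv.
by rewrite pV_iV ctrE pact_reg /= pointM1.
Qed.

Definition inclV : {linear tens V V -> T} := od \o ptmap iV iV.
Lemma inclVE v w : inclV (v ⊗ w) = od (iV v ⊗ iV w).
Proof. by rewrite /inclV /= tmapLE. Qed.

(** Projecting both factors is balanced because the projection sees a coefficient only through its
    value at the identity. *)
Lemma vp_ex : exists f : {linear T -> tens V V}, forall m e, f (od (m ⊗ e)) = pV m ⊗ pV e.
Proof.
have [|f hf] := @od_univ K n G Om Om' OmV VOm cOm _ (ptmap pV pV).
  by move=> m e a; rewrite !tmapLE !pV_act tensZl tensZr.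
by exists f => m e; rewrite hf tmapLE.
Qed.
Definition vp := projT1 (cid vp_ex).
Lemma vpE m e : vp (od (m ⊗ e)) = pV m ⊗ pV e.
Proof. by rewrite /vp; case: (cid _). Qed.

Lemma vp_incl z : vp (inclV z) = z.
Proof.
elim/tens_ind: z => [v a|x y hx hy]; last by rewrite !linearD hx hy.
by rewrite inclVE vpE !pV_iV.
Qed.

Lemma inclV_inj : injective inclV.
Proof. exact: can_inj vp_incl. Qed.

Lemma biequiv_incl : biequiv (M := btens BV BV) (N := BT) inclV.
Proof.
by apply: biequiv_bilin => x v w; rewrite !inclVE pact_odE /= ?pact_triv ?iV_inv ?iV_pact.
Qed.

Lemma T_ind (P : T -> Prop) : (forall z a, P (rcT (inclV z ⊗ a))) ->
  (forall x y, P x -> P y -> P (x + y)) -> forall t, P t.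
Proof.
move=> hp hD; apply: (od_ind OmV) => // m e.
elim/kahV_ind: m => [a v|x y hx hy]; last by rewrite tensDl linearD; apply: hD.
elim/kahV_ind: e => [b w|x y hx hy]; last by rewrite tensDr linearD; apply: hD.
by rewrite odb kahler_actA -rcTE -inclVE; exact: hp.
Qed.

(** Inverse of z ⊗ a ↦ [rcT (inclV z ⊗ a)]: the tensor square is free over its left-invariant
    part. *)
Definition theta : {linear T -> tens (tens V V) A} := ptmap vp id \o coT OmV VOm cOm false.
Lemma theta_rcT z a : theta (rcT (inclV z ⊗ a)) = z ⊗ a.
Proof.
elim/tens_ind: z => [v w|x y hx hy]; last by rewrite linearD !tensDl !linearD hx hy.
apply: tensA_sep => x; rewrite inclVE rcTE /theta ctr_tmap.
rewrite -[ctr _ _ (coT _ _ _ _ _)](actE (comodT OmV VOm cOm false)) -/(pact _ x _) pact_odE pact_kact !iV_inv.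
by rewrite -rcTE rcTE vpE pV_act !pV_iV ctrE pact_reg /= pointM1 tensZr.
Qed.

Lemma rcT1 t : rcT (t ⊗ one) = t.
Proof.
elim/(od_ind OmV): t => [m e|x y hx hy]; last by rewrite tensDl linearD hx hy.
by rewrite rcTE kahler_act1.
Qed.

Lemma theta_rec t : rcT (ptmap inclV id (theta t)) = t.
Proof.
elim/T_ind: t => [z a|x y hx hy]; last by rewrite !linearD hx hy.
by rewrite theta_rcT tmapEI.
Qed.

Lemma incl_vp t : (forall x, pact (bL BT) x t = t) -> inclV (vp t) = t.
Proof.
move=> h; rewrite -[RHS]theta_rec /theta /=.
by rewrite [coT _ _ _ _ _](co_inv h) !tmapEI rcT1.
Qed.

(** [lcoinv2_incl] forms deformed tensors and [inclV] classical ones; naturality of the twist for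
    [iV] lets them be compared already on V ⊗ V. *)
Lemma lcoinv2_inclE z : lcoinv2_incl EB z = inclV (Km BV BV z).
Proof.
elim/tens_ind: z => [v w|x y hx hy]; last by rewrite !linearD hx hy.
rewrite /lcoinv2_incl tliftEp tpureAf.
have -> : (fun u v : V => q (((u : EB) : E) ⊗ ((v : EB) : E))) = (fun u v => q (iV u ⊗ iV v)).
  by apply/funext => u; apply/funext => u'; rewrite !iVE.
rewrite pliftE; last first.
  by apply: mk_bilin => a x y z; rewrite linearP ?(tpurePl, tpurePr) linearP.
rewrite (qE OmV) /inclV /= [ptmap iV iV _](K_nat Om Om' (M := BV) (N := BV) _ biequiv_iV biequiv_iV).
by rewrite tmapLE.
Qed.

Section RactInd.
Variable P : E -> Prop.
Hypothesis hD : forall x y, P x -> P y -> P (x + y).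

(** The inverse twist of v ⊗ b stays in V ⊗ A: its left half is trivial since v is left-invariant,
    and right functionals preserve V. Hence classical multiples of v are sums of deformed ones. *)
Lemma ract_ind_l : (forall (v : V) (a : A), P (ract (v : EB) (a : B))) -> forall e, P e.
Proof.
move=> hp; apply: kahV_ind => // b v.
rewrite -actRE -[iV v ⊗ b](KinvK VOm (M := BE) (N := BA)) KinvE.
have e0 : op2 (bL BE) (bL BA) Om (iV v ⊗ b) = iV v ⊗ b.
  by apply: (op2_invl nOm); exact: iV_inv.
have -> : op2 (bL BE) (bL BA) Om' (iV v ⊗ b) = iV v ⊗ b by rewrite -{1}e0 (op2L_VK OmV).
have : forall t, P (actR G (Km BE BA (op2 (bR BE) (bR BA) t (iV v ⊗ b)))); last exact.
elim/tens_ind => [h k|x y hx hy]; last by rewrite op2D !linearD; apply: hD.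
rewrite op2E -(act_equiv (c := comodV) (f := iV)); last by move=> x w; rewrite iV_pact.
have := hp (cact comodV (rlin h) v) (cact (regcomod G true) (rlin k) b).
by rewrite (ractBE OmV VOm) -iVE.
Qed.

Lemma ract_ind_r : (forall (e : E) (a : A), (forall x, pact R x e = e) -> P (ract (e : EB) (a : B))) ->
  forall e, P e.
Proof.
move=> hp; apply: (@kah_inv_ind K n G true) => // b e he.
rewrite -actRE -[e ⊗ b](KinvK VOm (M := BE) (N := BA)) KinvE.
have e0 : op2 (bR BE) (bR BA) Om (e ⊗ b) = e ⊗ b by apply: (op2_invl nOm).
rewrite -op2_LR e0.
have : forall t, P (actR G (Km BE BA (op2 (bL BE) (bL BA) t (e ⊗ b)))); last exact.
elim/tens_ind => [h k|x y hx hy]; last by rewrite op2D !linearD; apply: hD.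
rewrite op2E -(ractBE OmV VOm); apply: hp => x.
transitivity (cact (bL BE) (rlin h) (pact (bR BE) x e)); first exact/esym/(actLR (M := BE)).
by congr (cact _ _ _); exact: he.
Qed.
End RactInd.

(** Deformed bilinearity reduces everything to w ⊗ e with w left- and e right-invariant: the
    coefficient of the first factor moves across the tensor sign and that of the second moves out to
    the right. *)
Lemma braiding_unique (s s' : {linear T -> T}) :
  is_bimod_endo (E := EB) s -> is_bimod_endo (E := EB) s' ->
  (forall (w : V) (e : EB), rcoinvariant e -> s (tpureA w e) = s' (tpureA w e)) ->
  forall t, s t = s' t.
Proof.
move=> [sl sr] [sl' sr'] h t.
elim/tensA_ind: t => [m e|x y hx hy]; last by rewrite !linearD hx hy.
elim/ract_ind_l: m e => [x y hx hy e|v a e]; first by rewrite tensDl !linearD hx hy.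
have -> : q ((ract (v : EB) (a : B) : E) ⊗ e) = q (((v : EB) : E) ⊗ (lact (a : B) (e : EB) : E)).
  exact: q_balanced.
move: (lact (a : B) (e : EB)) => {}e; move: (e : E) => {}e.
elim/ract_ind_r: e => [x y hx hy|e b he]; first by rewrite tensDr !linearD hx hy.
rewrite -(ract2_q OmV VOm cOm (b : B)) sr sr'; congr (ract2 _ _).
by have := h v e; rewrite !tpureAE; apply; apply/rinvP.
Qed.

Lemma braidingE t : braiding EB t = sig t.
Proof.
have [hb hs] := @theP {linear T -> T} \0 (fun s => is_bimod_endo (E := EB) s /\
    forall (w : V) (e : EB), rcoinvariant e -> s (tpureA w e) = tpureA e w)
    (ex_intro _ sig (conj (sig_bimod OmV VOm cOm) (sig_coinv OmV VOm cOm nOm))).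
apply: (braiding_unique hb (sig_bimod OmV VOm cOm)) => w e he.
by rewrite hs //; exact/esym/(sig_coinv OmV VOm cOm nOm).
Qed.

End Coinvariants.

(** * Symmetriser of an involution *)

Section Involution.
Variables (K : fieldType) (W : lmodType K) (s : {linear W -> W}).
Hypothesis h2 : (2%:R : K) != 0.
Hypothesis sK : forall t, s (s t) = t.

Lemma scale_half_double (t : W) : (2%:R^-1 : K) *: (t + t) = t.
Proof. by rewrite -mulr2n -scaler_nat scalerA mulVf // scale1r. Qed.

Lemma m1_neq1 : (-1 : K) != 1.
Proof. by rewrite eq_sym -subr_eq0 opprK. Qed.

Definition is_psym (P : W -> W) :=
  [/\ forall t, P (P t) = P t,
      forall t, (exists u, P u = t) <-> s t = t
    & forall t, P t = 0 <-> Defs.span [set u | exists2 c : K, c != 1 & s u = c *: u]%classic t].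

(** Split t into symmetric and antisymmetric halves: P fixes the first, and the second is an
    eigenvector for -1, hence killed. *)
Lemma psym_unique (P : {linear W -> W}) : is_psym P -> forall t, P t = 2%:R^-1 *: (t + s t).
Proof.
move=> [PP Pr Pk] t.
rewrite -{1}[t]scale_half_double.
have -> : t + t = (t + s t) + (t - s t) by rewrite addrACA subrr addr0.
rewrite scalerDr linearD.
have -> : P (2%:R^-1 *: (t - s t)) = 0.
  apply/Pk/span_gen; exists (-1); first exact: m1_neq1.
  by rewrite linearZ linearB /= sK scaleN1r -scalerN opprB.
have /Pr [u <-] : s (2%:R^-1 *: (t + s t)) = 2%:R^-1 *: (t + s t).
  by rewrite linearZ linearD /= sK addrC.
by rewrite PP addr0.
Qed.

Lemma psym_exists : exists P : {linear W -> W}, is_psym P.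
Proof.
have Pl : linear (fun t => 2%:R^-1 *: (t + s t)).
  move=> a x y; rewrite linearP addrACA -(scalerDr a) (scalerDr 2%:R^-1).
  by rewrite !scalerA mulrC.
pose P : {linear W -> W} := HB.pack (fun t => 2%:R^-1 *: (t + s t)) (GRing.isLinear.Build _ _ _ _ _ Pl).
have PE t : P t = 2%:R^-1 *: (t + s t) by [].
have sP t : s (P t) = P t by rewrite !PE linearZ linearD /= sK addrC.
have Pf t : s t = t -> P t = t by move=> h; rewrite PE h scale_half_double.
exists P; split=> t.
- exact/Pf/sP.
- by split=> [[u <-]|h]; [exact: sP|exists t; exact: Pf].
split=> [h|].
  apply: span_gen; exists (-1); first exact: m1_neq1.
  have : t + s t = 0.
    have h' : 2%:R^-1 *: (t + s t) = 0 := h.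
    by move: h' => /(congr1 (fun x => 2%:R *: x)); rewrite scalerA mulfV // scale1r scaler0.
  by rewrite scaleN1r => /eqP; rewrite addrC addr_eq0 => /eqP.
elim=> [|c u x [e e1 eu] _ hx]; first exact: linear0.
rewrite linearP hx addr0.
have [->|u0] := eqVneq u 0; first by rewrite linear0 scaler0.
(* An eigenvalue of an involution squares to 1, so -1 is the only one different from 1. *)
have : (e * e - 1) *: u = 0.
  by rewrite scalerBl scale1r -scalerA -eu -linearZ -eu sK subrr.
move/eqP; rewrite scaler_eq0 (negPf u0) orbF -expr2 subr_sqr_1 mulf_eq0 subr_eq0 (negPf e1) /=.
rewrite addr_eq0 => /eqP ee.
suff Pu0 : P u = 0 by rewrite -[LHS]/(c *: P u) Pu0 scaler0.
by rewrite PE eu ee scaleN1r subrr scaler0.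
Qed.
End Involution.

Section Braiding0.
Variables (K : fieldType) (n : nat) (G : linAlgGroup K n).
Hypothesis h2 : (2%:R : K) != 0.
Local Notation A := (coord_hopf G).
Local Notation H := (rdual_type A).
Local Notation E := (kahler A).
Variables (Om Om' : tens H H).
Hypothesis OmV : @tmul2 K (rdual A) Om Om' = rdual_one A ⊗ rdual_one A.
Hypothesis VOm : @tmul2 K (rdual A) Om' Om = rdual_one A ⊗ rdual_one A.
Hypothesis cOm : @dual_2cocycle K A Om.
Hypothesis nOm : @normalised K A Om.
Local Notation EB := (deformed_calculus Om).
Local Notation T := (tensA EB).
Local Notation BT := (BT OmV VOm cOm).
Local Notation sig := (sig OmV VOm cOm).
Local Notation V := (lcoinv EB).
Local Notation BV := (BV Om).
Local Notation Km := (Kmap Om Om' BV BV).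
Local Notation Ki := (Kinv Om Om' BV BV).
Local Notation inclV := (inclV Om Om').
Local Notation vp := (vp OmV VOm cOm).
Local Notation iV := (iV Om).

Lemma sig_incl z : sig (inclV z) = inclV (tflip V V z).
Proof.
elim/tens_ind: z => [v w|x y hx hy]; last by rewrite !linearD hx hy.
by rewrite tflipE !inclVE sigE tflipE.
Qed.

Lemma lcoinv2_incl_inj : injective (lcoinv2_incl EB).
Proof.
move=> x y; rewrite !(lcoinv2_inclE OmV) => /(inclV_inj OmV VOm cOm) /(congr1 Ki).
by rewrite !(KmapK OmV).
Qed.

Lemma braiding0E t : braiding0 EB t = Ki (tflip V V (Km t)).
Proof.
have h : exists s : {linear tens V V -> tens V V}, forall t, lcoinv2_incl EB (s t) = braiding EB (lcoinv2_incl EB t).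
  exists (Ki \o tflip V V \o Km) => z.
  by rewrite (braidingE OmV VOm cOm nOm) !(lcoinv2_inclE OmV) sig_incl /= (KinvK VOm).
apply: lcoinv2_incl_inj; rewrite (theP _ h).
by rewrite (braidingE OmV VOm cOm nOm) !(lcoinv2_inclE OmV) sig_incl (KinvK VOm).
Qed.

Lemma braiding0K t : braiding0 EB (braiding0 EB t) = t.
Proof. by rewrite !braiding0E (KinvK VOm) tflipK (KmapK OmV). Qed.

Lemma psym0E t : psym0 EB t = 2%:R^-1 *: (t + braiding0 EB t).
Proof.
apply: (psym_unique h2 braiding0K).
exact: (@theP {linear tens V V -> tens V V} \0 (is_psym (braiding0 EB)) (psym_exists h2 braiding0K)).
Qed.

Variable D : E -> T.
Hypothesis Dlin : linear D.
Hypothesis Dl : equivariant (kcomod G false) (bL BT) D.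

Definition connc_fun (v : V) : tens V V := vp (D (iV v)).
Fact connc_linear : linear connc_fun.
Proof. by move=> a x y; rewrite /connc_fun linearP Dlin linearP. Qed.

Lemma connc_ex : exists L : {linear V -> tens V V}, forall v, inclV (L v) = D (iV v).
Proof.
exists (HB.pack connc_fun (GRing.isLinear.Build _ _ _ _ _ connc_linear) : {linear V -> tens V V}) => v.
rewrite -[LHS]/(inclV (vp (D (iV v)))) incl_vp // => x.
by rewrite -Dl iV_inv.
Qed.

Definition connc := projT1 (cid connc_ex).
Lemma conncE v : inclV (connc v) = D (iV v).
Proof. by rewrite /connc; case: (cid _). Qed.

Lemma conn0E v : conn0 (E := EB) D v = Ki (connc v).
Proof.
have h : exists L : {linear V -> tens V V}, forall w : V, lcoinv2_incl EB (L w) = D (w : EB).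
  by exists (Ki \o connc) => w; transitivity (lcoinv2_incl EB (Ki (connc w))); rewrite // (lcoinv2_inclE OmV) (KinvK VOm) conncE iVE.
apply: lcoinv2_incl_inj; rewrite (theP _ h).
by rewrite (lcoinv2_inclE OmV) (KinvK VOm) conncE iVE.
Qed.

End Braiding0.

(** * Koszul's formula *)

Section DualBasis.
Variables (K : fieldType) (V : lmodType K).

Definition spanning n (v : 'I_n -> V) := forall x, exists c : 'I_n -> K, x = \sum_i c i *: v i.

Lemma spanning_free n (v : 'I_n -> V) : spanning v ->
  exists m (b : 'I_m -> V), free_family b /\ spanning b.
Proof.
elim: n v => [|n IH] v sv; first by exists 0%N, v; split=> // c _ [].
have [fv|/not_free_family[j [c vj]]] := pselect (free_family v).
  by exists n.+1, v.
apply: (IH (fun i => v (lift j i))) => x; have [e ->] := sv x.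
exists (fun i => e (lift j i) + e j * c (lift j i)).
rewrite (bigD1_ord j) //= vj scaler_sumr.
rewrite big_mkcond (bigD1_ord j) //= eqxx add0r -big_split /=.
apply: eq_bigr => i _; rewrite [lift j i == j]eq_sym (negPf (neq_lift _ _)).
by rewrite scalerDl scalerA addrC.
Qed.

Variable g : {linear tens V V -> K^o}.
Hypothesis gC : forall z, g (tflip V V z) = g z.
Hypothesis gnd : forall v, (forall w, g (v ⊗ w) = 0) -> v = 0.

Fact pair_linear (x : V) : linear (fun v => g (x ⊗ v) : K^o).
Proof. by move=> a u v; rewrite tpurePr linearP. Qed.
Definition pair (x : V) : {linear V -> K^o} :=
  HB.pack (fun v => g (x ⊗ v) : K^o) (GRing.isLinear.Build _ _ _ _ _ (pair_linear x)).

Lemma pairC x y : pair x y = pair y x.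
Proof. by rewrite /= -gC tflipE. Qed.

Lemma pair_sep v : (forall x, pair x v = 0) -> v = 0.
Proof. by move=> h; apply: gnd => w; rewrite -[LHS]/(pair v w) pairC. Qed.

(** Nondegeneracy makes the functionals [pair (b i)] of a basis independent, so [free_dual] applies
    to them. *)
Lemma dual_basis n (v : 'I_n -> V) : spanning v ->
  exists m (b d : 'I_m -> V), forall x, x = \sum_i pair (d i) x *: b i.
Proof.
move=> /spanning_free [m [b [fb sb]]].
have psum c x : \sum_i c i * pair (b i) x = pair x (\sum_i c i *: b i).
  by rewrite linear_sum; apply: eq_bigr => i _; rewrite linZ pairC.
have [|d hd] := @free_dual _ _ m (fun i => pair (b i)).
  by move=> c h; apply: fb; apply: pair_sep => x; rewrite -psum.
exists m, b, d => x.
have [c hc] := sb x; rewrite {1}hc; apply: eq_bigr => i _; congr (_ *: _).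
rewrite hc -psum (bigD1 i) // hd eqxx mulr1.
rewrite big1 => [|j ji]; last by rewrite hd (negPf ji) mulr0.
by rewrite /= addr0.
Qed.

End DualBasis.

Section Koszul.
Variables (K : fieldType) (V : lmodType K).
Hypothesis h2 : (2%:R : K) != 0.
Variable g : {linear tens V V -> K^o}.
Hypothesis gC : forall z, g (tflip V V z) = g z.
Hypothesis gnd : forall v, (forall w, g (v ⊗ w) = 0) -> v = 0.
Variables (m : nat) (b d : 'I_m -> V).
Hypothesis bd : forall x, x = \sum_i pair g (d i) x *: b i.
Variable del : {linear V -> tens V V}.
Hypothesis delA : forall v, tflip V V (del v) = - del v.

(** Both indices of t lowered by the metric. *)
Definition frm (t : tens V V) (x y : V) : K := ev2 (pair g x) (pair g y) t.

Lemma frm_sep t t' : (forall x y, frm t x y = frm t' x y) -> t = t'.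
Proof.
move=> h; apply/eqP; rewrite -subr_eq0; apply/eqP.
apply: (ev2_sep (pair_sep gC gnd) (pair_sep gC gnd)) => x y.
by rewrite linearB /= -!/(frm _ _ _) h subrr.
Qed.

Lemma frm_flip t x y : frm (tflip V V t) x y = frm t y x.
Proof. by rewrite /frm ev2_flip. Qed.

Lemma frmD t t' x y : frm (t + t') x y = frm t x y + frm t' x y.
Proof. by rewrite /frm linearD. Qed.
Lemma frmN t x y : frm (- t) x y = - frm t x y.
Proof. by rewrite /frm linearN. Qed.
Lemma frmZ a t x y : frm (a *: t) x y = a * frm t x y.
Proof. by rewrite /frm linZ. Qed.

Lemma frm_sumx t (I : finType) (c : I -> K) (u : I -> V) y :
  frm t (\sum_i c i *: u i) y = \sum_i c i * frm t (u i) y.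
Proof.
rewrite /frm; elim/tens_ind: t => [v w|s t hs ht]; last first.
  rewrite linearD hs ht -big_split; apply: eq_bigr => i _.
  by rewrite linearD mulrDr.
rewrite ev2E [pair g _ v]pairC // linear_sum mulr_suml; apply: eq_bigr => i _.
by rewrite ev2E linZ mulrA [pair g v _]pairC.
Qed.

Lemma frm_sumy t (I : finType) (c : I -> K) (u : I -> V) x :
  frm t x (\sum_i c i *: u i) = \sum_i c i * frm t x (u i).
Proof. by rewrite -frm_flip frm_sumx; apply: eq_bigr => i _; rewrite frm_flip. Qed.

Let dl v x y := frm (del v) x y.
Lemma dlA v x y : dl v x y = - dl v y x.
Proof. by rewrite /dl -frmN -delA frm_flip. Qed.

Definition torsion_free (L : {linear V -> tens V V}) := forall v, L v - tflip V V (L v) = - del v.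
(** The shape that [Pi0] takes once it is untwisted. By [compatE] it is the familiar rule g(∇v, w) +
    g(v, ∇w) = 0 for a metric that is constant on invariant forms. *)
Definition metric_compat (L : {linear V -> tens V V}) := forall z : tens V V,
  ctr V g (passoc V V V (ptmap (tflip V V \o L) id (z + tflip V V z))) = 0.

(* Koszul's formula: on invariant forms the metric has constant coefficients, so only
   the structure constants [dl] enter. *)
Definition koszul v x y : K := 2%:R^-1 * (dl x v y + dl y v x - dl v x y).

Lemma pair_ctr (u : tens V V) w y : pair g y (ctr V g (passoc V V V (tflip V V u ⊗ w))) = frm u w y.
Proof.
elim/tens_ind: u => [a c|s t hs ht]; last by rewrite linearD tensDl !linearD hs ht frmD.
by rewrite tflipE tassocE ctrE linZ /frm ev2E -[g _]/(pair g a w) [pair g a w]pairC.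
Qed.

Lemma compatE L : metric_compat L <-> forall v w y, frm (L v) w y + frm (L w) v y = 0.
Proof.
have e (L' : {linear V -> tens V V}) v w y : pair g y (ctr V g (passoc V V V (ptmap (tflip V V \o L') id ((v ⊗ w) + tflip V V (v ⊗ w))))) =
    frm (L' v) w y + frm (L' w) v y.
  by rewrite tflipE linearD !tmapEI !linearD /= -!pair_ctr.
split=> [h v w y|h z]; first by rewrite -e h linear0.
elim/tens_ind: z => [v w|s t hs ht]; last first.
  have -> : s + t + tflip V V (s + t) = (s + tflip V V s) + (t + tflip V V t) by rewrite linearD addrACA.
  by rewrite [ptmap _ _ _]linearD [passoc _ _ _ _]linearD [ctr _ _ _]linearD hs ht addr0.
by apply: (pair_sep gC gnd) => y; rewrite e h.
Qed.

Lemma torsionE L : torsion_free L <-> forall v x y, frm (L v) x y - frm (L v) y x = - dl v x y.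
Proof.
split=> h v.
  by move=> x y; rewrite /dl -[RHS]frmN -h frmD frmN frm_flip.
by apply: frm_sep => x y; rewrite frmD !frmN frm_flip h.
Qed.

Lemma koszul_formula L : torsion_free L -> metric_compat L ->
  forall v x y, frm (L v) x y = koszul v x y.
Proof.
move=> /torsionE hT /compatE hC v x y.
have T1 := hT v x y; have T2 := hT x v y; have T3 := hT y v x.
have C1 := hC v x y; have C2 := hC v y x; have C3 := hC x y v.
apply: (mulfI h2); rewrite /koszul mulrA mulfV // mul1r.
move: T1 T2 T3 C1 C2 C3.
move: (frm (L v) x y) (frm (L v) y x) (frm (L x) v y) (frm (L x) y v) (frm (L y) v x) (frm (L y) x v) (dl x v y) (dl y v x) (dl v x y).
move=> a a' c c' e e' dx dy dv T1 T2 T3 C1 C2 C3.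
(* The classical combination of three torsion and three compatibility equations in which everything
   except 2a cancels. *)
have -> : 2%:R * a = (a - a') - (e - e') - (c - c') + (a + c) + (a' + e) - (c' + e') by ring.
by rewrite T1 T2 T3 C1 C2 C3; ring.
Qed.

Lemma koszul_unique L L' : torsion_free L -> metric_compat L -> torsion_free L' -> metric_compat L' ->
  forall v, L v = L' v.
Proof. by move=> t c t' c' v; apply: frm_sep => x y; rewrite !koszul_formula. Qed.

Lemma koszulP a u v x y : koszul (a *: u + v) x y = a * koszul u x y + koszul v x y.
Proof.
rewrite /koszul /dl linearP frmD frmZ.
have e w w'' : frm (del w) (a *: u + v) w'' = a * frm (del w) u w'' + frm (del w) v w''.
  have := frm_sumx (del w) (fun i : 'I_2 => if i == ord0 then a else 1) (fun i => if i == ord0 then u else v) w''.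
  by rewrite !big_ord_recl !big_ord0 /= scale1r !addr0 mul1r.
by rewrite !e; ring.
Qed.

(** The form [koszul v] with both indices raised: [d i] reads off the coefficient of [b i], so the
    pairings of the tensor with x and y restore [koszul v x y]. *)
Lemma koszul_ex : exists L : {linear V -> tens V V}, forall v, L v = \sum_i \sum_j (koszul v (b i) (b j) : K) *: (d i ⊗ d j).
Proof.
have lf : linear (fun v => \sum_i \sum_j (koszul v (b i) (b j) : K) *: (d i ⊗ d j)).
  move=> a u v; rewrite scaler_sumr -big_split; apply: eq_bigr => i _.
  rewrite scaler_sumr -big_split; apply: eq_bigr => j _ /=.
  by rewrite koszulP scalerDl scalerA.
by exists (HB.pack (fun v => \sum_i \sum_j (koszul v (b i) (b j) : K) *: (d i ⊗ d j)) (GRing.isLinear.Build _ _ _ _ _ lf) : {linear V -> tens V V}).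
Qed.

Lemma koszul_sumx v (I : finType) (c : I -> K) (u : I -> V) y :
  koszul v (\sum_i c i *: u i) y = \sum_i c i * koszul v (u i) y.
Proof.
rewrite /koszul /dl linear_sum !frm_sumx frm_sumy.
have -> : frm (\sum_i del (c i *: u i)) v y = \sum_i c i * frm (del (u i)) v y.
  rewrite /frm linear_sum; apply: eq_bigr => i _; by rewrite linearZ linZ.
rewrite -big_split -sumrB mulr_sumr; apply: eq_bigr => i _ /=.
by rewrite -mulrDr -mulrBr mulrCA.
Qed.

Lemma koszulS v x y : koszul v x y = koszul v y x - dl v x y.
Proof.
by rewrite /koszul [dl v y x]dlA; field.
Qed.

Lemma koszul_sumy v (I : finType) (c : I -> K) (u : I -> V) x :
  koszul v x (\sum_i c i *: u i) = \sum_i c i * koszul v x (u i).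
Proof.
rewrite koszulS koszul_sumx /dl frm_sumy -sumrB; apply: eq_bigr => i _.
by rewrite -mulrBr -koszulS.
Qed.

Lemma koszul_exists : exists L : {linear V -> tens V V}, torsion_free L /\ metric_compat L.
Proof.
have [L hL] := koszul_ex; exists L.
have F v x y : frm (L v) x y = koszul v x y.
  rewrite [in RHS](bd x) koszul_sumx hL /frm linear_sum; apply: eq_bigr => i _.
  rewrite [in RHS](bd y) koszul_sumy linear_sum mulr_sumr; apply: eq_bigr => j _.
  by rewrite linZ ev2E (pairC gC (d i) x) (pairC gC (d j) y) [LHS]mulrC -mulrA.
split.
  apply/torsionE => v x y; rewrite !F koszulS; ring.
apply/compatE => v w y; rewrite !F /koszul -mulrDr.
have -> : dl w v y + dl y v w - dl v w y + (dl v w y + dl y w v - dl w v y) = 0.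
  by rewrite [dl y w v]dlA; ring.
by rewrite mulr0.
Qed.

(** Koszul's formula involves only the metric and [del], so an automorphism preserving both commutes
    with L. Applied to right translations it yields right covariance. *)
Lemma koszul_natural (f f' : {linear V -> V}) L :
  (forall u v, g (f u ⊗ f v) = g (u ⊗ v)) -> cancel f' f -> cancel f f' ->
  (forall v, del (f v) = ptmap f f (del v)) -> torsion_free L -> metric_compat L ->
  forall v, L (f v) = ptmap f f (L v).
Proof.
move=> gf fK f'K delf tL cL v.
have frmf t x y : frm (ptmap f f t) x y = frm t (f' x) (f' y).
  elim/tens_ind: t => [u w|s t hs ht]; last by rewrite linearD !frmD hs ht.
  by rewrite tmapLE /frm !ev2E -{1}(fK x) -{1}(fK y) /= !gf.
have dlf u x y : dl u x y = dl (f' u) (f' x) (f' y) by rewrite -{1}(fK u) /dl delf frmf.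
apply: frm_sep => x y; rewrite frmf !koszul_formula // /koszul.
by rewrite (dlf x) (dlf y) (dlf (f v)) f'K.
Qed.

End Koszul.

(** * Exterior derivative *)

Section Differential.
Variables (K : fieldType) (n : nat) (G : linAlgGroup K n).
Hypothesis h2 : (2%:R : K) != 0.
Local Notation A := (coord_hopf G).
Local Notation H := (rdual_type A).
Local Notation E := (kahler A).
Local Notation BE := (BE G).
Local Notation BA := (BA G).
Local Notation one := (regfun_one G : A).
Variables (Om Om' : tens H H).
Hypothesis OmV : @tmul2 K (rdual A) Om Om' = rdual_one A ⊗ rdual_one A.
Hypothesis VOm : @tmul2 K (rdual A) Om' Om = rdual_one A ⊗ rdual_one A.
Hypothesis cOm : @dual_2cocycle K A Om.
Hypothesis nOm : @normalised K A Om.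
Local Notation EB := (deformed_calculus Om).
Local Notation B := (deformed_hopf Om).
Local Notation T := (tensA EB).
Local Notation q := (bq Om).
Local Notation od := (odot Om Om').
Local Notation lcT := (lcT OmV VOm cOm).
Local Notation sig := (sig OmV VOm cOm).
Local Notation Km := (Kmap Om Om').
Local Notation odb := (od_balanced OmV VOm cOm).

Lemma dK_ex : exists f : {linear A -> E}, forall a, f a = kq A (one ⊗ a).
Proof.
have fl : linear (fun a : A => kq A (one ⊗ a)) by move=> c a b; rewrite tpurePr linearP.
by exists (HB.pack (fun a : A => kq A (one ⊗ a)) (GRing.isLinear.Build _ _ _ _ _ fl) : {linear A -> E}).
Qed.
Definition dK := projT1 (cid dK_ex).
Lemma dKE a : dK a = kq A (one ⊗ a).
Proof. by rewrite /dK; case: (cid _). Qed.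

Lemma cdE (a : A) : cd EB a = dK a.
Proof. by rewrite dKE -adbE. Qed.

Lemma kqE (a b : A) : kq A (a ⊗ b) = kact a (dK b).
Proof. by rewrite dKE kahler_actE mulA1. Qed.

Lemma dKM (a b : A) : dK (hmul a b) = kact a (dK b) + kact b (dK a).
Proof. by rewrite -!kqE dKE kq_leibniz !mul1A. Qed.

Lemma dK1 : dK one = 0.
Proof.
by have /eqP := dKM one one; rewrite mulA1 !kahler_act1 -subr_eq0 opprD addNKr oppr_eq0 => /eqP.
Qed.

Lemma pact_dK s x a : pact (kcomod G s) x (dK a) = dK (pact (regcomod G s) x a).
Proof. by rewrite !dKE pact_kq pact_tens pact_one. Qed.

Lemma biequiv_dK : biequiv (M := BA) (N := BE) dK.
Proof. by split=> x a; rewrite /= pact_dK. Qed.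

Lemma od_alt_ex : exists f : {linear tens E E -> T}, forall z, f z = od z - od (tflip E E z).
Proof. by exists (od \- (od \o tflip E E)). Qed.
Definition od_alt := projT1 (cid od_alt_ex).
Lemma od_altE z : od_alt z = od z - od (tflip E E z).
Proof. by rewrite /od_alt; case: (cid _). Qed.
Lemma od_alt_sig z : od_alt z = od z - sig (od z).
Proof. by rewrite od_altE sigE. Qed.

Lemma od_alt_flip m e : od_alt (e ⊗ m) = - od_alt (m ⊗ e).
Proof. by rewrite !od_altE !tflipE opprB. Qed.

Lemma lcT_N a t : lcT (a ⊗ - t) = - lcT (a ⊗ t).
Proof. by rewrite -scaleN1r tensZr linearZ /= scaleN1r. Qed.

Lemma od_alt_l a m e : od_alt (kact a m ⊗ e) = lcT (a ⊗ od_alt (m ⊗ e)).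
Proof.
rewrite !od_altE !tflipE tensDr linearD /= -(odb _ _ a) -!lcTE; congr (_ + _).
by rewrite lcT_N.
Qed.

Lemma od_alt_r a m e : od_alt (m ⊗ kact a e) = od_alt (kact a m ⊗ e).
Proof. by rewrite !od_altE !tflipE !odb. Qed.

(** Antisymmetrising makes da ⊗ db well defined on forms: the cross terms produced by d(ab) and
    d(ac) are opposite multiples of the alternation of db ⊗ dc. *)
Lemma dd_ex : exists f : {linear E -> T}, forall z, f (kq A z) = od_alt (ptmap dK dK z).
Proof.
have F (a b c : A) : od_alt (ptmap dK dK (a ⊗ hmul b c)) =
    od_alt (ptmap dK dK (hmul a b ⊗ c)) + od_alt (ptmap dK dK (hmul a c ⊗ b)).
  rewrite !tmapLE !dKM tensDr !tensDl !linearD !od_alt_r.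
  rewrite (od_alt_l a) (od_alt_l a) (od_alt_flip (dK b) (dK c)).
  by rewrite lcT_N addrACA subrr add0r.
have [|f hf] := @kq_univ K n G T (od_alt \o ptmap dK dK); first exact: F.
by exists f => z; rewrite hf.
Qed.

(* [dd (a db) = da ⊗ db - db ⊗ da]; passing to 2-forms, this is twice [d2]. *)
Definition dd := projT1 (cid dd_ex).
Lemma ddE z : dd (kq A z) = od_alt (ptmap dK dK z).
Proof. by rewrite /dd; case: (cid _). Qed.

Lemma sig_alt z : sig (od_alt z) = - od_alt z.
Proof. by rewrite od_alt_sig linearB /= sigK opprB. Qed.

Lemma sig_dd e : sig (dd e) = - dd e.
Proof.
elim/kah_ind: e => [a b|x y hx hy]; last by rewrite !linearD /= hx hy.
by rewrite ddE sig_alt.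
Qed.

Lemma pact_alt s x m e : pact (comodT OmV VOm cOm s) x (od_alt (m ⊗ e)) =
  od_alt (pact (kcomod G s) x m ⊗ pact (kcomod G s) x e).
Proof. by rewrite !od_altE !tflipE linearB /= !pact_odE. Qed.

Lemma pact_dd s x e : pact (comodT OmV VOm cOm s) x (dd e) = dd (pact (kcomod G s) x e).
Proof.
elim/kah_ind: e => [a b|u v hu hv]; last by rewrite !linearD hu hv.
by rewrite pact_kq pact_tens !ddE !tmapLE pact_alt !pact_dK.
Qed.

Lemma dd_act a e : dd (kact a e) = lcT (a ⊗ dd e) + od_alt (dK a ⊗ e).
Proof.
elim/kah_ind: e => [b c|u v hu hv]; last by rewrite !linearD !tensDr !linearD hu hv addrACA.
rewrite kahler_actE !ddE !tmapLE dKM tensDl linearD.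
by rewrite od_alt_l -od_alt_r kqE.
Qed.

Definition wq : {linear T -> forms2 EB} := qpi [set t : T | braiding EB t - t = 0]%classic.

(** The relations divided out already form a subspace, the fixed vectors of [sig], so taking their
    span adds nothing. *)
Lemma wedge_eq x y : (wedge EB x = wedge EB y) <-> sig (x - y) = x - y.
Proof.
have e t : braiding EB t = sig t by exact: braidingE.
split=> [/qpiE|h].
  elim=> [|c w z hw _ hz]; first exact: linear0.
  have /eqP := hw : braiding EB w - w = 0.
  rewrite subr_eq0 e => /eqP hw'.
  rewrite linearP.
  rewrite hw'.
  by rewrite hz.
apply/qpiE/span_gen => /=; rewrite e h; exact: subrr.
Qed.

Lemma lact_cd (a b : A) : lact (a : B) (cd EB b) = kq A (Km BA BA (a ⊗ b)) :> E.
Proof.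
rewrite (lactBE OmV VOm) cdE.
have ea w : actL G (ptmap id dK w) = kq A w.
  elim/tens_ind: w => [x y|u v hu hv]; last by rewrite !linearD hu hv.
  by rewrite tmapIE actLE kqE.
have -> : (a : A) ⊗ dK b = ptmap id dK ((a : A) ⊗ (b : A)) by rewrite tmapIE.
by rewrite -[Kmap _ _ _ _ _](K_natr Om Om' (M := BA) (N := BA) (N' := BE) _ biequiv_dK) ea.
Qed.

(** The tensor da ⊗ db and half its antisymmetrisation differ by a symmetric tensor, which [wedge]
    kills. Thus 2-forms can be handled by antisymmetric representatives. *)
Lemma d2E r : d2 EB r = wedge EB ((2%:R^-1 : K) *: dd r).
Proof.
have F (a b : A) : wedge EB ((2%:R^-1 : K) *: dd (lact (a : B) (cd EB b))) =
    wedge EB (tpureA (cd EB a) (cd EB b)).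
  have -> : dd (lact (a : B) (cd EB b)) = q (dK a ⊗ dK b) - sig (q (dK a ⊗ dK b)).
    rewrite lact_cd (qE OmV) ddE od_alt_sig.
    by rewrite [ptmap dK dK _](K_nat Om Om' (M := BA) (N := BA) _ biequiv_dK biequiv_dK) tmapLE.
  apply/wedge_eq; rewrite tpureAE !cdE; set t := q _.
  have -> : 2%:R^-1 *: (t - sig t) - t = - (2%:R^-1 *: (t + sig t)).
    rewrite -{3}[t](scale_half_double h2) -scalerBr opprD addrACA subrr add0r.
    by rewrite -opprD scalerN addrC.
  by rewrite linearN linearZ linearD /= sigK addrC.
have h : exists L : {linear E -> forms2 EB}, forall a b : A,
   L (lact (a : B) (cd EB b)) = wedge EB (tpureA (cd EB a) (cd EB b)).
  by exists (wq \o (GRing.scale (2%:R^-1 : K) \o dd)) => a b; rewrite -F.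
have d2g (a b : A) : d2 EB (lact (a : B) (cd EB b)) = wedge EB (tpureA (cd EB a) (cd EB b)).
  apply: (lin_extE (gen := fun a b : A => lact (a : B) (cd EB b) : E)); exact: h.
(* [d2] is known on deformed products a db; since [Kmap] is invertible these span all forms. *)
have key z : d2 EB (kq A (Km BA BA z)) = wedge EB ((2%:R^-1 : K) *: dd (kq A (Km BA BA z))).
  elim/tens_ind: z => [a b|x y hx hy]; first by rewrite -lact_cd d2g F.
  by rewrite !linearD /= hx hy.
have [z ->] : exists z, r = kq A z.
  elim/kah_ind: r {F h d2g key} => [a b|x y [u ->] [v ->]]; first by exists (a ⊗ b).
  by exists (u + v); rewrite linearD.
by rewrite -[z](KinvK VOm (M := BA) (N := BA)) key.
Qed.

(** With X half of [dd r], which is antisymmetric, [D r + X] is killed by [wedge] exactly when it is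
    symmetric, that is when the antisymmetrisation of [D r] is -2X. *)
Lemma torsionlessE (D : EB -> T) : torsionless D <-> forall r, D r - sig (D r) = - dd r.
Proof.
have wD x y : wedge EB (x + y) = wedge EB x + wedge EB y := linearD wq x y.
have w0 : wedge EB 0 = 0 := linear0 wq.
have e r : (wedge EB (D r) + d2 EB r = 0) <-> (D r - sig (D r) = - dd r).
  have eX : dd r = 2%:R^-1 *: dd r + 2%:R^-1 *: dd r by rewrite -scalerDr scale_half_double.
  rewrite d2E -wD -w0; set X := 2%:R^-1 *: dd r in eX *.
  have sX : sig X = - X by rewrite /X linearZ /= sig_dd scalerN.
  rewrite eX; split=> [/wedge_eq|h].
    rewrite subr0 linearD /= sX => h.
    by apply/eqP; rewrite subr_eq addrC opprD addrA h addrK.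
  apply/wedge_eq; rewrite subr0 linearD /= sX.
  have hD : D r = sig (D r) - (X + X) by rewrite -h addrC subrK.
  transitivity (sig (D r) - (X + X) + X); last by rewrite -hD.
  by rewrite opprD addrA subrK.
by split=> h r; apply/e/h.
Qed.
End Differential.

Section FiniteDimension.
Variables (K : fieldType) (n : nat) (G : linAlgGroup K n).
Local Notation A := (coord_hopf G).
Local Notation H := (rdual_type A).
Variables (Om : tens H H).
Local Notation EB := (deformed_calculus Om).
Local Notation V := (lcoinv EB).
Local Notation pV := (pV Om).
Local Notation dK := (dK G).

(** Maurer-Cartan forms of the coordinates of GL_n restricted to G. *)
Definition mc_gen (k : 'I_(n * n + 1)) : V := pV (dK (polyfun G 'X_k)).

(** The projection sends a db to a(1) times that of db, and b ↦ [pV (dK b)] is a derivation at the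
    identity, so its values on algebra generators span. This is the finite dimension behind Koszul's
    formula. *)
Lemma mc_gen_spanning : spanning mc_gen.
Proof.
pose P (v : V) := exists c : 'I_(n * n + 1) -> K, v = \sum_i c i *: mc_gen i.
have P0 : P 0 by exists (fun=> 0); rewrite big1 // => i _; rewrite scale0r.
have PD u v : P u -> P v -> P (u + v).
  move=> [c ->] [d ->]; exists (fun i => c i + d i).
  by rewrite -big_split; apply: eq_bigr => i _; rewrite scalerDl.
have PZ a u : P u -> P (a *: u).
  move=> [c ->]; exists (fun i => a * c i).
  by rewrite scaler_sumr; apply: eq_bigr => i _; rewrite scalerA.
have PX k : P (mc_gen k).
  exists (fun i => (i == k)%:R); rewrite (bigD1 k) //= eqxx scale1r big1 ?addr0 // => i ik.
  by rewrite (negPf ik) scale0r.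
have Pd b : P (pV (dK b)).
  elim/regfun_ind: b => [|k|f g hf hg|c f hf|f g hf hg].
  - by rewrite dK1 linear0.
  - exact: PX.
  - by rewrite !linearD; apply: PD.
  - by rewrite !linearZ; apply: PZ.
  by rewrite -[regfun_mul f g]/(hmul (f : A) (g : A)) dKM linearD !pV_act; apply: PD; apply: PZ.
move=> v; rewrite -(pV_iV v).
elim/kah_ind: (iV Om v) => [a b|x y hx hy]; last by rewrite linearD; apply: PD.
by rewrite kqE pV_act; apply/PZ/Pd.
Qed.
End FiniteDimension.

(** * Metrics and connections *)

Section Metric.
Variables (K : fieldType) (n : nat) (G : linAlgGroup K n).
Hypothesis h2 : (2%:R : K) != 0.
Local Notation A := (coord_hopf G).
Local Notation H := (rdual_type A).
Local Notation E := (kahler A).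
Local Notation BE := (BE G).
Local Notation BA := (BA G).
Local Notation one := (regfun_one G : A).
Variables (Om Om' : tens H H).
Hypothesis OmV : @tmul2 K (rdual A) Om Om' = rdual_one A ⊗ rdual_one A.
Hypothesis VOm : @tmul2 K (rdual A) Om' Om = rdual_one A ⊗ rdual_one A.
Hypothesis cOm : @dual_2cocycle K A Om.
Hypothesis nOm : @normalised K A Om.
Local Notation EB := (deformed_calculus Om).
Local Notation B := (deformed_hopf Om).
Local Notation T := (tensA EB).
Local Notation od := (odot Om Om').
Local Notation BT := (BT OmV VOm cOm).
Local Notation coT := (coT OmV VOm cOm).
Local Notation comodT := (comodT OmV VOm cOm).
Local Notation rcT := (rcT OmV VOm cOm).
Local Notation sig := (sig OmV VOm cOm).
Local Notation V := (lcoinv EB).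
Local Notation iV := (iV Om).
Local Notation inclV := (inclV Om Om').
Local Notation comodV := (comodV Om).
Local Notation BV := (BV Om).
Local Notation Km := (Kmap Om Om').
Local Notation Ki := (Kinv Om Om').
Variable g : T -> B.
Hypothesis hg : is_metric g.
Hypothesis hbi : bi_invariant g.

Lemma gL_ex : exists f : {linear T -> A}, forall t, f t = g t.
Proof.
have [lg _ _ _] := hg.
by exists (HB.pack (g : T -> A) (GRing.isLinear.Build _ _ _ _ _ lg) : {linear T -> A}).
Qed.
Definition gL := projT1 (cid gL_ex).
Lemma gLE t : gL t = g t.
Proof. by rewrite /gL; case: (cid _). Qed.

(* Bi-invariance says that the values of [g t] are obtained by translating [t]. *)
Lemma gL_eval s t x : gL t x = gL (pact (comodT s) x t) (point1 G).
Proof.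
have blL : bilinear_for *:%R *:%R (fun (a : A) (u : T) => (gL u (point1 G) : K) *: a).
  apply: mk_bilin => c u v w; first by rewrite scalerDr !scalerA [_ * c]mulrC.
  by rewrite linearP [LHS]scalerDl scalerA.
have blR : bilinear_for *:%R *:%R (fun (u : T) (a : A) => (gL u (point1 G) : K) *: a).
  apply: mk_bilin => c u v w; last by rewrite scalerDr !scalerA [_ * c]mulrC.
  by rewrite linearP [LHS]scalerDl scalerA.
have [hl hr] := hbi.
have -> : pact (comodT s) x t = ctr T (ev x) (coT s t) by rewrite /pact actE.
case: s.
  rewrite {1}gLE -hr (rco2E OmV VOm cOm) tliftEp.
  have -> : (fun (u : T) (a : B) => hcounit B (g u) *: a) = (fun (u : T) (a : A) => (gL u (point1 G) : K) *: a).
    by apply/funext => u; apply/funext => a; rewrite gLE.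
  rewrite -[LHS]/(ev x _) -[RHS]/(ev (point1 G) _).
  elim/tens_ind: (coT _ _) => [u a|u v hu hv]; last by rewrite !linearD hu hv.
  by rewrite pliftE // ctrE [gL (_ *: _)]linearZ -[LHS]/(_ x) -[RHS]/(_ (point1 G)) !regfunZ mulrC.
rewrite {1}gLE -hl (lco2E OmV VOm cOm) tliftEp.
have -> : (fun (a : B) (u : T) => hcounit B (g u) *: a) = (fun (a : A) (u : T) => (gL u (point1 G) : K) *: a).
  by apply/funext => u; apply/funext => a; rewrite gLE.
rewrite -[LHS]/(ev x _) -[RHS]/(ev (point1 G) _).
elim/tens_ind: (coT _ _) => [u a|u v hu hv]; last by rewrite !linearD hu hv.
by rewrite tflipE pliftE // ctrE [gL (_ *: _)]linearZ -[LHS]/(_ x) -[RHS]/(_ (point1 G)) !regfunZ mulrC.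
Qed.

Lemma biequiv_gL : biequiv (M := BT) (N := BA) gL.
Proof.
have e s : equivariant (comodT s) (regcomod G s) gL.
  by move=> x t; apply: regfunP => y; rewrite (gL_eval s) pactM -(gL_eval s) pact_reg.
by split; exact: e.
Qed.

(** Right linearity over the deformed algebra is this identity precomposed with [Kmap], which is
    invertible and natural for the equivariant map [gL]. *)
Lemma gL_rcT t a : gL (rcT (t ⊗ a)) = hmul (gL t : A) a.
Proof.
have [_ hr _ _] := hg.
have key z : gL (rcT (Km BT BA z)) = mulL G (ptmap gL id (Km BT BA z)).
  elim/tens_ind: z => [u b|u v hu hv]; last by rewrite !linearD hu hv.
  rewrite -(ract2E OmV VOm cOm (b : B)) gLE hr (hmulBE OmV VOm) -gLE.
  by rewrite [ptmap _ _ _](K_natl Om Om' (M := BT) (M' := BA) (N := BA) _ biequiv_gL) tmapEI.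
by have := key (Ki BT BA (t ⊗ a)); rewrite (KinvK VOm) tmapEI mulLE.
Qed.

Lemma gL_sig t : gL (sig t) = gL t.
Proof. by have [_ _ hs _] := hg; rewrite -(braidingE OmV VOm cOm nOm) !gLE hs. Qed.

Lemma gc_ex : exists f : {linear tens V V -> K^o}, forall z, f z = gL (inclV z) (point1 G).
Proof. by exists (ev (point1 G) \o gL \o inclV). Qed.
Definition gc := projT1 (cid gc_ex).
Lemma gcE z : gc z = gL (inclV z) (point1 G).
Proof. by rewrite /gc; case: (cid _). Qed.

(** By [gL_eval] the value at x is the value at the identity on the translated tensor, and
    left-invariant tensors do not move. *)
Lemma gL_incl z : gL (inclV z) = (gc z : K) *: one.
Proof.
apply: regfunP => x; rewrite regfunZ mulr1 (gL_eval false) gcE.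
by have [h _] := biequiv_incl OmV VOm cOm; rewrite -[pact (comodT false) x _]h /= pact_tensE; congr (gL (inclV _) _); rewrite -[RHS]tmap_id; elim/tens_ind: z => [u v|u v hu hv]; rewrite ?linearD ?hu ?hv // tmapLE tmapE // !pact_triv.
Qed.

Lemma gcC z : gc (tflip V V z) = gc z.
Proof. by rewrite !gcE -(sig_incl OmV VOm cOm) gL_sig. Qed.

Lemma gc_inv x z : gc (pact (tcomod comodV comodV) x z) = gc z.
Proof.
have [_ h] := biequiv_incl OmV VOm cOm.
by rewrite !gcE [inclV _]h -(gL_eval true) gL_incl !regfunZ.
Qed.

(** The hypothesis concerns deformed tensors, whereas [gc] pairs classical ones. On [iV v] the left
    half of the twist is trivial, so only right functionals act. The classical kernel is stable
    under right translations ([h1]), hence under these functionals by [act_kill]. *)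
Lemma gc_nondegenerate v : (forall w, gc (v ⊗ w) = 0) -> v = 0.
Proof.
move=> hv; have [_ _ _ nd] := hg.
have h0 e : gL (od (iV v ⊗ e)) = 0.
  elim/(@kahV_ind _ _ _ Om): e => [a w|x y hx hy]; last by rewrite tensDr !linearD hx hy addr0.
  rewrite -(rcTE OmV VOm cOm) -inclVE gL_rcT gL_incl hv scale0r.
  by apply: regfunP => x /=; rewrite mul0r.
have h1 x e : gL (od (pact (kcomod G true) x (iV v) ⊗ e)) = 0.
  have -> : e = pact (kcomod G true) x (pact (kcomod G true) (pointV x) e) by rewrite pactM smulV pact1.
  by rewrite -(pact_odE OmV VOm cOm) (proj2 biequiv_gL) h0 linear0.
apply: (@iV_inj K n G Om); rewrite linear0.
apply: (nd (iV v : EB)) => e; rewrite tpureAE (qE OmV) KmapE op2_LR.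
have -> : op2 (bL BE) (bL BE) Om (iV v ⊗ (e : E)) = iV v ⊗ (e : E).
  by apply: (op2_invl nOm) => x; rewrite iV_inv.
rewrite -gLE; have : forall t, gL (od (op2 (bR BE) (bR BE) t (iV v ⊗ (e : E)))) = 0; last exact.
elim/tens_ind => [h k|x y hx hy]; last by rewrite op2D !linearD hx hy addr0.
rewrite op2E; move: (cact _ _ (e : E)) => e'.
have fl : exists f : {linear E -> A}, forall u, f u = gL (od (u ⊗ e')).
  have fl : linear (fun u : E => gL (od (u ⊗ e'))) by move=> c a b; rewrite tpurePl !linearP.
  by exists (HB.pack (fun u : E => gL (od (u ⊗ e'))) (GRing.isLinear.Build _ _ _ _ _ fl) : {linear E -> A}).
have [f hf] := fl.
rewrite -hf; apply: (@act_kill _ _ _ true _ _ (bR BE) f) => x.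
by rewrite hf h1.
Qed.

Lemma ract_scalar (v : V) (c : K) : ract (v : EB) (c *: one : B) = c *: iV v.
Proof.
rewrite (ractBE OmV VOm) -iVE tensZr !linearZ /=; congr (_ *: _).
rewrite (K_inv VOm nOm (M := BE) (N := BA)); try by right=> x; rewrite /= pact_one.
by rewrite actRE kahler_act1.
Qed.

(** On invariants g is a scalar and can be pulled out of the module; the deformed inner tensor
    contributes the single [Kmap]. *)
Lemma id_gE y : id_g (E := EB) g y = iV (ctr V gc (ptmap id (Km BV BV) (passoc V V V y))).
Proof.
pose F y := iV (ctr V gc (ptmap id (Km BV BV) (passoc V V V y))).
rewrite -[RHS]/(F y) /id_g tliftEp tpureE.
have e1 w : (fun u v : V => ract (u : EB) (g (lcoinv2_incl EB (v ⊗ w)))) =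
    (fun u v : V => F ((u ⊗ v) ⊗ w)).
  apply/funext => u; apply/funext => v.
  rewrite -gLE (lcoinv2_inclE OmV) gL_incl ract_scalar /F.
  by rewrite tassocE tmapIE ctrE linearZ.
have e2 : (fun (t : tens V V) (w : V) => plift (fun u v : V => ract (u : EB) (g (lcoinv2_incl EB (v ⊗ w)))) t) =
    (fun t w => F (t ⊗ w)).
  apply/funext => t; apply/funext => w; rewrite e1.
  elim/tens_ind: t => [u v|u v hu hv]; last by rewrite linearD hu hv /F tensDl !linearD.
  rewrite pliftE //; apply: mk_bilin => c x z t; first by rewrite /F !tpurePl !linearP.
  by rewrite /F tpurePr tpurePl !linearP.
rewrite e2; elim/tens_ind: y => [t w|u v hu hv]; last by rewrite linearD hu hv /F !linearD.
rewrite pliftE //; apply: mk_bilin => c x z t'; first by rewrite /F !tpurePl !linearP.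
by rewrite /F tpurePr !linearP.
Qed.

Fact BK_LR x y (c : K^o) : pact (trivc G false K^o) x (pact (trivc G true K^o) y c) = pact (trivc G true K^o) y (pact (trivc G false K^o) x c).
Proof. by rewrite !pact_triv. Qed.
Definition BK : bicomod G := Bicomod BK_LR.

Lemma biequiv_gc : biequiv (M := btens BV BV) (N := BK) gc.
Proof.
split=> x z; rewrite /= pact_triv ?gc_inv //.
congr (gc _); elim/tens_ind: z => [u v|u v hu hv]; last by rewrite linearD hu hv.
by rewrite pact_tens !pact_triv.
Qed.

(** As [gc] is equivariant into the trivial bicomodule, the twist passes to V ⊗ K, where
    normalisation makes it the identity. *)
Lemma ctr_gc_Ki y : ctr V gc (Ki BV (btens BV BV) y) = ctr V gc y.
Proof.
have e w : ctr V gc w = ctr V (idfun : {linear K^o -> K^o}) (ptmap id gc w).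
  by rewrite ctr_tmapr; apply: ctr_ext.
rewrite !e [ptmap _ _ _](Ki_natr OmV VOm (M := BV) (N := btens BV BV) (N' := BK) _ biequiv_gc).
congr (ctr _ _ _); elim/tens_ind: (ptmap _ _ _) => [u c|u v hu hv]; last by rewrite linearD hu hv.
by rewrite (Ki_inv OmV VOm nOm) //; right=> x; rewrite /= pact_triv.
Qed.

Variable D : E -> T.
Hypothesis Dlin : linear D.
Hypothesis De : biequiv (M := BE) (N := BT) D.
Let cn := connc Dlin (proj1 De).

Lemma biequiv_connc : biequiv (M := BV) (N := btens BV BV) cn.
Proof.
have [il ir] := biequiv_incl OmV VOm cOm.
split=> x v; apply: (inclV_inj OmV VOm cOm).
  by rewrite il /cn !conncE /= pact_triv -(proj1 De) /= iV_inv.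
by rewrite ir /cn !conncE /= iV_pact (proj2 De).
Qed.

(** The twists carried by symmetriser, braiding and connection are regrouped by [Ki_cocycle]: the
    inner one cancels the [Kmap] of [id_gE], and the outer one is absorbed by [ctr_gc_Ki]. The
    factor 2 cancels the half in the symmetriser. *)
Lemma Pi0E t : Pi0 (E := EB) g D t =
  iV (ctr V gc (passoc V V V (ptmap (tflip V V \o cn) id (Km BV BV t + tflip V V (Km BV BV t))))).
Proof.
set z := Km BV BV t.
have bf : biequiv (M := BV) (N := btens BV BV) (tflip V V \o cn).
  exact: (biequiv_comp (biequiv_flip BV BV) biequiv_connc).
rewrite /Pi0 (psym0E h2 OmV VOm cOm nOm) (braiding0E OmV VOm cOm nOm) -/z.
rewrite tmapEp -[t](KmapK OmV (M := BV) (N := BV)) -/z -linearD.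
have hb y : ptmap (braiding0 EB) id (ptmap (conn0 (E := EB) D) id y) =
    ptmap (Ki BV BV) id (ptmap (tflip V V \o cn) id y).
  elim/tens_ind: y => [u v|u v hu hv]; last by rewrite !linearD hu hv.
  rewrite !tmapEI (conn0E Dlin (proj1 De)) (braiding0E OmV VOm cOm nOm).
  by rewrite (KinvK VOm).
have lin c y : iV (ctr V gc (ptmap id (Km BV BV) (passoc V V V (ptmap (Ki BV BV) id (ptmap (tflip V V \o cn) id (c *: y)))))) =
    c *: iV (ctr V gc (ptmap id (Km BV BV) (passoc V V V (ptmap (Ki BV BV) id (ptmap (tflip V V \o cn) id y))))).
  by rewrite !linearZ.
rewrite hb id_gE lin scalerA mulfV // scale1r; congr (iV _).
rewrite [ptmap (tflip V V \o _) id _](Ki_natl OmV VOm (M := BV) (M' := btens BV BV) (N := BV) _ bf).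
rewrite -[passoc _ _ _ _](Ki_cocycle OmV VOm cOm (M := BV) (N := BV) (P := BV)).
rewrite [ptmap id _ _]tmap_canr ?ctr_gc_Ki // => u.
by rewrite (KinvK VOm).
Qed.
End Metric.

(** * Metric compatibility in classical terms *)

Section Compatible.
Variables (K : fieldType) (n : nat) (G : linAlgGroup K n).
Hypothesis h2 : (2%:R : K) != 0.
Local Notation A := (coord_hopf G).
Local Notation H := (rdual_type A).
Local Notation E := (kahler A).
Local Notation BE := (BE G).
Local Notation BA := (BA G).
Local Notation one := (regfun_one G : A).
Variables (Om Om' : tens H H).
Hypothesis OmV : @tmul2 K (rdual A) Om Om' = rdual_one A ⊗ rdual_one A.
Hypothesis VOm : @tmul2 K (rdual A) Om' Om = rdual_one A ⊗ rdual_one A.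
Hypothesis cOm : @dual_2cocycle K A Om.
Hypothesis nOm : @normalised K A Om.
Local Notation EB := (deformed_calculus Om).
Local Notation B := (deformed_hopf Om).
Local Notation T := (tensA EB).
Local Notation BT := (BT OmV VOm cOm).
Local Notation rcT := (rcT OmV VOm cOm).
Local Notation V := (lcoinv EB).
Local Notation iV := (iV Om).
Local Notation inclV := (inclV Om Om').
Local Notation BV := (BV Om).
Local Notation Km := (Kmap Om Om').
Local Notation Ki := (Kinv Om Om').
Variable g : T -> B.
Hypothesis hg : is_metric g.
Hypothesis hbi : bi_invariant g.
Local Notation gL := (gL hg).
Local Notation gc := (gc Om' hg).
Local Notation dK := (dK G).
Local Notation VV := (btens BV BV).
Local Notation incl := (lcoinv2_incl EB).

Lemma ract_one (e : EB) : ract e (one : B) = e.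
Proof.
rewrite (ractBE OmV VOm) (K_inv VOm nOm (M := BE) (N := BA)); try by right=> x; rewrite /= pact_one.
by rewrite actRE kahler_act1.
Qed.

Lemma lact_scalar (c : K) (e : EB) : lact (c *: one : B) e = c *: e.
Proof.
rewrite (lactBE OmV VOm) tensZl !linearZ /=; congr (_ *: _).
rewrite (K_inv VOm nOm (M := BA) (N := BE)); try by left=> x; rewrite /= pact_one.
by rewrite actLE kahler_act1.
Qed.

Lemma hmul_scalar (c : K) (a : B) : hmul (c *: one : B) a = c *: a.
Proof.
rewrite (hmulBE OmV VOm) tensZl !linearZ /=; congr (_ *: _).
rewrite (K_inv VOm nOm (M := BA) (N := BA)); try by left=> x; rewrite /= pact_one.
by rewrite mulLE mul1A.
Qed.

Lemma ract2_one (t : T) : ract2 t (one : B) = t.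
Proof.
rewrite (ract2E OmV VOm cOm) (K_inv VOm nOm (M := BT) (N := BA)); try by right=> x; rewrite /= pact_one.
exact: rcT1.
Qed.

Lemma ract_bilin : bilinear_for *:%R *:%R (fun (e : E) (a : A) => ract (e : EB) (a : B) : E).
Proof. by apply: mk_bilin => c x y z; rewrite !(ractBE OmV VOm) ?tpurePl ?tpurePr !linearP. Qed.

Lemma ract2_incl s (a : B) : ract2 (incl s) a =
  rcT (ptmap inclV id (Km VV BA (ptmap (Km BV BV) id (s ⊗ (a : A))))).
Proof.
rewrite (ract2E OmV VOm cOm) (lcoinv2_inclE OmV) tmapEI.
by rewrite [ptmap _ _ _](K_natl Om Om' (M := VV) (M' := BT) (N := BA) _ (biequiv_incl OmV VOm cOm)) tmapEI.
Qed.

Lemma ract2_incl_ind (P : T -> Prop) : (forall s a, P (ract2 (incl s) a)) ->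
  (forall x y, P x -> P y -> P (x + y)) -> forall t, P t.
Proof.
move=> hp hD t; rewrite -[t](theta_rec OmV VOm cOm).
set w := theta _ _ _ _.
rewrite -[w](KinvK VOm (M := VV) (N := BA)).
have -> : Ki VV BA w = ptmap (Km BV BV) id (ptmap (Ki BV BV) id (Ki VV BA w)).
  by rewrite tmap_canl // => u; rewrite (KinvK VOm).
elim/tens_ind: (ptmap (Ki BV BV) id _) => [s a|x y hx hy]; last by rewrite !linearD; apply: hD.
by rewrite -(ract2_incl s (a : B)).
Qed.

(** Needed to unfold the definite description [Pi]. Deformed right multiplication from V ⊗ V ⊗ A is
    the classical one composed with twists, so its inverse is [theta] followed by the inverse
    twists. *)
Lemma ract2_incl_univ (P : lmodType K) (F : tens V V -> A -> P) : bilinear_for *:%R *:%R F ->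
  exists L : {linear T -> P}, forall s (a : B), L (ract2 (incl s) a) = F s a.
Proof.
move=> bF; exists (plift F \o ptmap (Ki BV BV) id \o Ki VV BA \o theta OmV VOm cOm) => s a.
rewrite ract2_incl.
have th w : theta OmV VOm cOm (rcT (ptmap inclV id w)) = w.
  elim/tens_ind: w => [u v|u v hu hv]; last by rewrite !linearD hu hv.
  by rewrite tmapEI theta_rcT.
rewrite -[LHS]/(plift F (ptmap (Ki BV BV) id (Ki VV BA (theta OmV VOm cOm _)))) th (KmapK OmV).
by rewrite tmap_canl ?pliftE // => u; rewrite (KmapK OmV).
Qed.

Variable D : E -> T.
Hypothesis Dlin : linear D.
Hypothesis De : biequiv (M := BE) (N := BT) D.
Let cn := connc Dlin (proj1 De).

Lemma affine_l (W : lmodType K) (c a b : K) (u v w : W) :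
  (c *: u + v) + (c * a + b) *: w = c *: (u + a *: w) + (v + b *: w).
Proof. by rewrite scalerDl -scalerA addrACA -scalerDr. Qed.
Lemma affine_r (W : lmodType K) (c a : K) (u v w w' : W) :
  (c *: u + v) + a *: (c *: w + w') = c *: (u + a *: w) + (v + a *: w').
Proof. by rewrite !scalerDr !scalerA [c * a]mulrC addrACA. Qed.

(** The metric is constant on invariants, so dg vanishes there and compatibility reduces to [Pi0] =
    0. Conversely, once [Pi0] vanishes both sides extend to products with a by the same term g(t)
    da. *)
Lemma compatibleE : compatible (E := EB) g D <-> metric_compat gc cn.
Proof.
have P0E := Pi0E h2 nOm hg hbi Dlin De.
have gi t : g (incl t) = (gc (Km BV BV t) : K) *: one :> A.
  by rewrite -(gLE hg) (lcoinv2_inclE OmV) (gL_incl OmV VOm cOm hg hbi).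
have h0 : (forall t, Pi0 (E := EB) g D t = 0) <-> metric_compat gc cn.
  split=> [h z|h t]; last by rewrite P0E h linear0.
  by apply: (@iV_inj K n G Om); rewrite linear0 -(h (Ki BV BV z)) P0E (KinvK VOm).
rewrite -h0 /compatible /Pi.
pose F (t : tens V V) (a : A) : E := ract (Pi0 (E := EB) g D t) (a : B) + lact (g (incl t)) (cd EB (a : B)).
have [f fE] : exists f : {linear tens V V -> E}, forall t, Pi0 (E := EB) g D t = f t.
  exists (iV \o (ctr V gc \o (passoc V V V \o (ptmap (tflip V V \o cn) id \o
    ((idfun \+ tflip V V) \o Km BV BV))))) => t.
  exact: P0E.
have FE t a : F t a = ract (f t : EB) (a : B) + (gc (Km BV BV t) : K) *: dK a.
  by rewrite /F fE gi cdE lact_scalar.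
have bF : bilinear_for *:%R *:%R F.
  apply: mk_bilin => c x y z; rewrite !FE.
    rewrite linearP (bilinl c _ _ (z : A) ract_bilin).
    have -> : gc (Km BV BV (c *: x + y)) = c * gc (Km BV BV x) + gc (Km BV BV y) by rewrite linearP linP.
    exact: affine_l.
  rewrite (bilinr c _ _ (f x) ract_bilin) linearP.
  exact: affine_r.
have hF := ract2_incl_univ bF.
split=> h t.
  (* At the coefficient 1 the derivative term drops out, since d1 = 0, and [Pi] becomes [Pi0]. *)
  have := lin_extE (gen := fun (t : tens V V) (a : B) => ract2 (incl t) a) t one hF.
  rewrite [RHS]/F ract_one gi lact_scalar cdE dK1 scaler0 addr0 => <-.
  rewrite h ract2_one gi cdE linearZ /=.
  by rewrite dK1 scaler0.
have [_ gr _ _] := hg.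
have eF s (a : B) : F s a = dK (gL (ract2 (incl s) a)).
  rewrite FE -fE h gLE gr gi hmul_scalar linearZ.
  have r0 : ract (0 : EB) (a : B) = 0 :> E by rewrite (ractBE OmV VOm) tens0l !linear0.
  by transitivity ((0 : E) + (gc (Km BV BV s) : K) *: dK a); [congr (_ + _)|rewrite add0r].
have eL t' : lin_ext (fun (t : tens V V) (a : B) => ract2 (incl t) a) F t' = dK (gL t').
  elim/ract2_incl_ind: t' => [s a|x y hx hy]; last by rewrite !linearD hx hy.
  by rewrite lin_extE ?eF.
by rewrite cdE -(gLE hg) -eL.
Qed.
End Compatible.

Section Connection.
Variables (K : fieldType) (n : nat) (G : linAlgGroup K n).
Hypothesis h2 : (2%:R : K) != 0.
Local Notation A := (coord_hopf G).
Local Notation H := (rdual_type A).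
Local Notation E := (kahler A).
Local Notation BE := (BE G).
Local Notation BA := (BA G).
Variables (Om Om' : tens H H).
Hypothesis OmV : @tmul2 K (rdual A) Om Om' = rdual_one A ⊗ rdual_one A.
Hypothesis VOm : @tmul2 K (rdual A) Om' Om = rdual_one A ⊗ rdual_one A.
Hypothesis cOm : @dual_2cocycle K A Om.
Hypothesis nOm : @normalised K A Om.
Local Notation EB := (deformed_calculus Om).
Local Notation B := (deformed_hopf Om).
Local Notation T := (tensA EB).
Local Notation od := (odot Om Om').
Local Notation BT := (BT OmV VOm cOm).
Local Notation coT := (coT OmV VOm cOm).
Local Notation rcT := (rcT OmV VOm cOm).
Local Notation sig := (sig OmV VOm cOm).
Local Notation V := (lcoinv EB).
Local Notation iV := (iV Om).
Local Notation inclV := (inclV Om Om').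
Local Notation comodV := (comodV Om).
Local Notation BV := (BV Om).
Local Notation Km := (Kmap Om Om').
Local Notation Ki := (Kinv Om Om').
Local Notation lcT := (lcT OmV VOm cOm).
Local Notation dK := (dK G).
Local Notation dd := (dd OmV VOm cOm).
Local Notation vp := (vp OmV VOm cOm).
Local Notation odb := (od_balanced OmV VOm cOm).

Lemma tmap_flipl (W W' U : lmodType K) (f : {linear W -> W'}) (z : tens W U) :
  ptmap id f (tflip W U z) = tflip W' U (ptmap f id z).
Proof.
elim/tens_ind: z => [u v|x y hx hy]; last by rewrite !linearD hx hy.
by rewrite tflipE tmapIE tmapEI tflipE.
Qed.

Lemma bicovariantE (D : {linear E -> T}) : bicovariant (E := EB) D <-> biequiv (M := BE) (N := BT) D.
Proof.
have el m : (lco2 EB (D m) = tmap id D (lco EB m)) <-> ptmap D id (kco G false m) = coT false (D m).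
  rewrite (lco2E OmV VOm cOm) lcoE tmapEp tmap_flipl; split=> [/(congr1 (tflip _ _))|->//].
  by rewrite !tflipK.
have er m : (rco2 EB (D m) = tmap D id (rco EB m)) <-> ptmap D id (kco G true m) = coT true (D m).
  by rewrite (rco2E OmV VOm cOm) rcoE tmapEp; split=> ->.
split=> [[hl hr]|[hl hr]].
  by split; apply: co_equiv => m; [exact/el/hl|exact/er/hr].
by split=> m; [apply/el|apply/er]; [exact: (equiv_co hl)|exact: (equiv_co hr)].
Qed.

(** The deformed and the classical Leibniz rules are one additive predicate [P] on E ⊗ A, tested on
    the images of pure tensors under [Kmap] or on pure tensors themselves, and either family
    spans. *)
Lemma connectionE (D : {linear E -> T}) : biequiv (M := BE) (N := BT) D ->
  is_connection (E := EB) D <-> forall e a, D (kact a e) = rcT (D e ⊗ a) + od (e ⊗ dK a).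
Proof.
move=> De.
pose P w := D (actR G w) = rcT (ptmap D id w) + od (ptmap id dK w).
have PD u v : P u -> P v -> P (u + v).
  by rewrite /P => hu hv; rewrite !linearD hu hv addrACA.
have k1 (e : EB) (a : B) : (D (ract e a) = ract2 (D e) a + tpureA e (cd EB a)) <-> P (Km BE BA ((e : E) ⊗ (a : A))).
  rewrite /P (ractBE OmV VOm) (ract2E OmV VOm cOm) tpureAE cdE (qE OmV).
  rewrite [ptmap D _ _](K_natl Om Om' (M := BE) (M' := BT) (N := BA) _ De) tmapEI.
  by rewrite [ptmap _ dK _](K_natr Om Om' (M := BE) (N := BA) (N' := BE) _ (biequiv_dK G)) tmapIE.
have k2 e a : (D (kact a e) = rcT (D e ⊗ a) + od (e ⊗ dK a)) <-> P (e ⊗ a).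
  by rewrite /P actRE tmapEI tmapIE.
split=> [[_ h] e a|h].
  apply/k2; rewrite -[e ⊗ a](KinvK VOm (M := BE) (N := BA)).
  elim/tens_ind: (Ki BE BA _) => [m b|u v hu hv]; last by rewrite linearD; apply: PD.
  exact/k1/h.
split=> [|e a]; first exact: linearP.
apply/k1; elim/tens_ind: (Km BE BA _) => [m b|u v hu hv]; last exact: PD.
exact/k2/h.
Qed.

Lemma lcT_rcT t a : lcT (a ⊗ t) = rcT (t ⊗ a).
Proof.
elim/(od_ind OmV): t => [m e|x y hx hy]; last by rewrite tensDl tensDr !linearD hx hy.
by rewrite lcTE rcTE odb.
Qed.

Lemma rcTA t a b : rcT (rcT (t ⊗ b) ⊗ a) = rcT (t ⊗ (hmul a b : A)).
Proof.
elim/(od_ind OmV): t => [m e|x y hx hy]; last by rewrite !(tensDl, linearD) hx hy.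
by rewrite rcTE rcTE rcTE [kact a _]kahler_actA.
Qed.

Lemma del_ex : exists f : {linear V -> tens V V}, forall v, inclV (f v) = dd (iV v).
Proof.
exists (vp \o (dd \o iV)) => v.
rewrite -[LHS]/(inclV (vp (dd (iV v)))) incl_vp // => x.
by rewrite pact_dd iV_inv.
Qed.
(** The Maurer-Cartan differential of invariant forms, carrying the structure constants that enter
    Koszul's formula. *)
Definition del := projT1 (cid del_ex).
Lemma delE v : inclV (del v) = dd (iV v).
Proof. by rewrite /del; case: (cid _). Qed.

Lemma delA v : tflip V V (del v) = - del v.
Proof.
apply: (inclV_inj OmV VOm cOm).
by rewrite -(sig_incl OmV VOm cOm) (linearN inclV) delE sig_dd.
Qed.

Lemma del_pact x v : del (pact comodV x v) = ptmap (pact comodV x) (pact comodV x) (del v).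
Proof.
apply: (inclV_inj OmV VOm cOm).
have [_ h] := biequiv_incl OmV VOm cOm.
by rewrite -pact_tensE [inclV (pact _ _ _)]h !delE iV_pact /= pact_dd.
Qed.

(** Torsion is linear over A: the antisymmetrised term e ⊗ da of the Leibniz rule cancels the term
    da ⊗ e that [dd_act] produces. Hence it can be checked on invariant forms, which generate. *)
Lemma torsionless_left (D : E -> T) (Dlin : linear D) (Dl : equivariant (kcomod G false) (bL BT) D) :
  (forall e a, D (kact a e) = rcT (D e ⊗ a) + od (e ⊗ dK a)) ->
  torsionless (E := EB) D <-> torsion_free del (connc Dlin Dl).
Proof.
move=> hD; rewrite (torsionlessE h2 OmV VOm cOm nOm).
have e1 v : (D (iV v) - sig (D (iV v)) = - dd (iV v)) <->
    connc Dlin Dl v - tflip V V (connc Dlin Dl v) = - del v.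
  rewrite -(conncE Dlin Dl) (sig_incl OmV VOm cOm) -delE -!linearN -linearD.
  by split=> [/(inclV_inj OmV VOm cOm)|->].
split=> h v; first exact/e1/h.
have DD x y : D (x + y) = D x + D y by rewrite -[x]scale1r Dlin !scale1r.
elim/(@kahV_ind _ _ _ Om): v => [a v|x y hx hy]; last first.
  by rewrite DD (linearD sig) (linearD dd) opprD addrACA hx hy -opprD.
have /e1 hv := h v; move: (iV v) hv => e hv.
have hr : rcT (D e ⊗ a) - rcT (sig (D e) ⊗ a) = - rcT (dd e ⊗ a).
  rewrite -(linearB rcT) -(linearN rcT); congr (rcT _).
  by rewrite -!scaleN1r -!tensZl -tensDl !scaleN1r hv.
rewrite hD (linearD sig) (sig_rcT OmV VOm cOm) sigE tflipE opprD addrACA hr.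
by rewrite dd_act lcT_rcT od_altE tflipE opprD opprB.
Qed.

Section Extension.
Variable Lc : {linear V -> tens V V}.
Hypothesis bLc : biequiv (M := BV) (N := btens BV BV) Lc.

Lemma ext_ex : exists f : {linear tens V A -> T},
  forall v a, f (v ⊗ a) = rcT (inclV (Lc v) ⊗ a) + od (iV v ⊗ dK a).
Proof.
exists ((rcT \o ptmap (inclV \o Lc) id) \+ (od \o ptmap iV dK)) => v a.
transitivity (rcT (ptmap (inclV \o Lc) id (v ⊗ a)) + od (ptmap iV dK (v ⊗ a))); first by [].
by rewrite tmapEI tmapLE.
Qed.

(** Forms are free over the invariant ones ([nu_mu]), so the Leibniz rule may be used as a
    definition. *)
Lemma conn_ex : exists f : {linear E -> T},
  forall v a, f (kact a (iV v)) = rcT (inclV (Lc v) ⊗ a) + od (iV v ⊗ dK a).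
Proof.
have [f hf] := ext_ex; exists (f \o nu Om) => v a.
rewrite -[LHS]/(f (nu Om _)).
by rewrite -muE nu_mu.
Qed.
Definition conn := projT1 (cid conn_ex).
Lemma connE v a : conn (kact a (iV v)) = rcT (inclV (Lc v) ⊗ a) + od (iV v ⊗ dK a).
Proof. by rewrite /conn; case: (cid _). Qed.

Lemma conn_iV v : conn (iV v) = inclV (Lc v).
Proof. by rewrite -[iV v]kahler_act1 connE dK1 tens0r linear0 addr0 rcT1. Qed.

Lemma conn_leibniz e a : conn (kact a e) = rcT (conn e ⊗ a) + od (e ⊗ dK a).
Proof.
elim/(@kahV_ind _ _ _ Om): e => [b v|x y hx hy]; last first.
  by rewrite !(linearD, tensDl) hx hy addrACA.
rewrite kahler_actA !connE dKM tensDl tensDr !linearD rcTA rcTE -addrA.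
by rewrite odb.
Qed.

Lemma conn_biequiv : biequiv (M := BE) (N := BT) conn.
Proof.
have [il ir] := biequiv_incl OmV VOm cOm.
have [Ll Lr] := bLc.
have [rl rr] := biequiv_rcT OmV VOm cOm.
split=> x e; (elim/(@kahV_ind _ _ _ Om): e => [a v|y z hy hz]; last by rewrite !linearD hy hz).
  rewrite [bL BE]/= pact_kact iV_inv !connE [pact (bL BT) x (_ + _)]linearD -rl pact_tens -il -Ll [pact (bL BV) _ _]pact_triv.
  by rewrite [pact _ x (od _)]pact_odE iV_inv pact_dK.
rewrite [bR BE]/= pact_kact -iV_pact !connE [pact (bR BT) x (_ + _)]linearD -rr pact_tens -ir -Lr.
by rewrite [pact _ x (od _)]pact_odE -iV_pact pact_dK.
Qed.
End Extension.
End Connection.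

(** * Existence and uniqueness of the Levi-Civita connection *)

Section LeviCivita.
Variables (K : fieldType) (n : nat) (G : linAlgGroup K n).
Hypothesis h2 : (2%:R : K) != 0.
Local Notation A := (coord_hopf G).
Local Notation H := (rdual_type A).
Local Notation E := (kahler A).
Local Notation BE := (BE G).
Variables (Om Om' : tens H H).
Hypothesis OmV : @tmul2 K (rdual A) Om Om' = rdual_one A ⊗ rdual_one A.
Hypothesis VOm : @tmul2 K (rdual A) Om' Om = rdual_one A ⊗ rdual_one A.
Hypothesis cOm : @dual_2cocycle K A Om.
Hypothesis nOm : @normalised K A Om.
Local Notation EB := (deformed_calculus Om).
Local Notation B := (deformed_hopf Om).
Local Notation T := (tensA EB).
Local Notation BT := (BT OmV VOm cOm).
Local Notation rcT := (rcT OmV VOm cOm).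
Local Notation V := (lcoinv EB).
Local Notation inclV := (inclV Om Om').
Local Notation comodV := (comodV Om).
Local Notation BV := (BV Om).
Variable g : T -> B.
Hypothesis hg : is_metric g.
Hypothesis hbi : bi_invariant g.
Local Notation gc := (gc Om' hg).
Local Notation del := (del OmV VOm cOm).
Let gC := gcC OmV VOm cOm nOm hg.
Let gnd := gc_nondegenerate OmV VOm cOm nOm (hg := hg) hbi.

Lemma levi_civitaE (D : {linear E -> T}) (De : biequiv (M := BE) (N := BT) D) :
  levi_civita (E := EB) g D <->
  [/\ is_connection (E := EB) D, torsion_free del (connc (linearP D) (proj1 De))
    & metric_compat gc (connc (linearP D) (proj1 De))].
Proof.
have hc := compatibleE h2 nOm hg hbi (linearP D) De.
have hcn := connectionE De.
split=> [[c _ t m]|[c t m]].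
  split=> //; last exact/hc.
  by apply/(torsionless_left h2 nOm (linearP D) (proj1 De)); [exact/hcn|].
split=> //; last exact/hc; first by have /bicovariantE[] := De.
by apply/(torsionless_left h2 nOm (linearP D) (proj1 De)); [exact/hcn|].
Qed.

Lemma levi_civita_unique (D D' : EB -> T) :
  bicovariant D -> levi_civita g D -> bicovariant D' -> levi_civita g D' -> D = D'.
Proof.
(* The statement quantifies over bare functions; linearity is extracted from [is_connection] and
   then bundled. *)
have aux (F : EB -> T) : levi_civita g F -> exists f : {linear E -> T}, F = f.
  move=> [[Fl _] _ _ _].
  by exists (HB.pack (F : E -> T) (GRing.isLinear.Build _ _ _ _ _ Fl) : {linear E -> T}).
move=> bD lD bD' lD'.
have [f fE] := aux _ lD; have [f' fE'] := aux _ lD'; subst D D'.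
have ef : biequiv (M := BE) (N := BT) f by exact/bicovariantE.
have ef' : biequiv (M := BE) (N := BT) f' by exact/bicovariantE.
have [c t m] := (levi_civitaE ef).1 lD; have [c' t' m'] := (levi_civitaE ef').1 lD'.
have cE := (connectionE ef).1 c; have cE' := (connectionE ef').1 c'.
apply/funext => e; elim/(@kahV_ind _ _ _ Om): e => [a v|x y hx hy]; last by rewrite !linearD hx hy.
rewrite cE cE'; congr (rcT (_ ⊗ a) + _).
rewrite -(conncE (linearP f) (proj1 ef)) -(conncE (linearP f') (proj1 ef')).
by congr (inclV _); exact: (koszul_unique h2 gC gnd (del := del)).
Qed.

Lemma levi_civita_exists : exists D : EB -> T, bicovariant D /\ levi_civita g D.
Proof.
have [m [b [d bd]]] := dual_basis gC gnd (@mc_gen_spanning K n G Om).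
have [L [tL cL]] := koszul_exists h2 gC gnd bd (delA OmV VOm cOm).
have bL' : biequiv (M := BV) (N := btens BV BV) L.
  split=> x v; first by rewrite /= pact_triv; elim/tens_ind: (L v) => [u w|u w hu hw]; [rewrite pact_tens !pact_triv|rewrite linearD -hu -hw].
  (* Right translation by x preserves the metric and [del], and translation by the inverse point
     supplies the inverse automorphism. *)
  rewrite /= pact_tensE; apply: (koszul_natural h2 gC gnd (f' := pact comodV (pointV x)) (del := del)) => //.
  - by move=> u w; rewrite -pact_tens (gc_inv OmV VOm cOm hg hbi).
  - by move=> u; rewrite pactM smulV pact1.
  - by move=> u; rewrite pactM smulVV pact1.
  by move=> u; exact: del_pact.
have De := conn_biequiv OmV VOm cOm bL'.
exists (conn OmV VOm cOm L); split; first by apply/(bicovariantE OmV VOm cOm).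
apply/(levi_civitaE De).
(* Restricting the extended connection to invariant forms returns the Koszul solution. *)
have e : connc (linearP (conn OmV VOm cOm L)) (proj1 De) =1 L.
  by move=> v; apply: (inclV_inj OmV VOm cOm); rewrite (conncE (linearP (conn OmV VOm cOm L)) (proj1 De)); exact: conn_iV.
split; first by apply/(connectionE De) => v a; exact: conn_leibniz.
  by move=> v; rewrite e.
move=> z; rewrite -[RHS](cL z); congr (ctr V gc (passoc V V V _)).
by apply: tmapl_ext => v /=; rewrite e.
Qed.
End LeviCivita.
Theorem proposition8p11 (R : realType) (n : nat) (G : linAlgGroup R[i] n)
    (hG : semisimple_representations G)
    (Om : tens (rdual (coord_hopf G)) (rdual (coord_hopf G)))
    (hOm : normalised_dual_2cocycle Om)
    (g : tensA (deformed_calculus Om) -> deformed_hopf Om)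
    (hg : is_metric g) (hbi : bi_invariant g) :
  exists! D : deformed_calculus Om -> tensA (deformed_calculus Om),
    bicovariant D /\ levi_civita g D.
Proof.
have h2 : (2%:R : R[i]) != 0 by rewrite Num.Theory.pnatr_eq0.
case: hOm => [[Om' []]]; rewrite tpureE => OmV VOm nOm cOm.
have [D hD] := levi_civita_exists h2 OmV VOm cOm nOm hg hbi.
exists D; split=> // D' [bD' lD']; case: hD => bD lD.
exact: (levi_civita_unique h2 OmV VOm cOm nOm hg hbi bD lD bD' lD').
Qed.
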